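(* Let $(X,w)$ be a locally finite weighted tree and let $\gamma_1,\gamma_2\in\mathrm{Aut}(X,w)$ be hyperbolic automorphisms with translation lengths $m_1\ge m_2>0$ (positive reals) and axes $A_{\gamma_1},A_{\gamma_2}$, such that $\Gamma=\langle\gamma_1,\gamma_2\rangle$ is discrete. Let $l=\ell(A_{\gamma_1}\cap A_{\gamma_2})$ ($l=0$ if the axes share no segment of positive length). If $l>0$, suppose that $A_{\gamma_1}\cap A_{\gamma_2}$ is a path $[v^-,v^+]$ of finite length and that both $\gamma_1,\gamma_2$ translate from $v^-$ toward $v^+$ along it. Let $\alpha=m_2/m_1$. Define inductively, as long as $m_{i+1}>0$, $$q_i=\left\lfloor \frac{m_i}{m_{i+1}}\right\rfloor,\qquad m_{i+2}=m_i-q_im_{i+1},\qquad \gamma_{i+2}=\gamma_i\gamma_{i+1}^{-q_i}.$$ (A) If $\alpha$ is rational, then the sequence $\{m_i\}$ is finite, ending with $m_{k+1}=0$ and $m_k=\gcd(m_1,m_2)$, and exactly one of the following holds. (A1) $l=0$; then $\Gamma$ is free of rank two and $(\gamma_{\mathrm a},\gamma_{\mathrm b})=(\gamma_1,\gamma_2)$, with translation lengths $m_1,m_2$, is a Schottky pair of generators with disjoint axes. (A2) $0<l\le m_1+m_2-\gcd(m_1,m_2)$; then there are unique integers $j,q$ with $$(m_1+m_2)-m_j+(q-1)m_{j+1}<l\le (m_1+m_2)-m_j+qm_{j+1},\quad 1\le j\le k-1,\ 0\le q\le q_j-1.$$ (A2a) If $l=(m_1+m_2)-m_j+qm_{j+1}$,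 then $\gamma_j\gamma_{j+1}^{-q}$ is hyperbolic; set $l_0=\ell\big(A_{\gamma_j\gamma_{j+1}^{-q}}\cap\gamma_{j+1}.A_{\gamma_j\gamma_{j+1}^{-q}}\big)$ and $(\gamma_{\mathrm a},\gamma_{\mathrm b})=(\gamma_{j+1},\gamma_j\gamma_{j+1}^{-q-1})$, a generating pair of $\Gamma$ in which $\gamma_{\mathrm a}$ is hyperbolic with translation length $m_{j+1}$. (i) If $l_0\ge\frac{m_j-(q+1)m_{j+1}}2$, then $\Gamma$ is not free, $\gamma_{\mathrm b}$ is elliptic, and $A_{\gamma_{\mathrm a}}$ and $T_{\gamma_{\mathrm b}}$ are disjoint with $d(A_{\gamma_{\mathrm a}},T_{\gamma_{\mathrm b}})=\frac{m_j-(q+1)m_{j+1}}2$. (ii) If $l_0<\frac{m_j-(q+1)m_{j+1}}2$, then $\Gamma$ is free of rank two, $(\gamma_{\mathrm a},\gamma_{\mathrm b})$ is a Schottky pair, $\gamma_{\mathrm b}$ has translation length $m_j-(q+1)m_{j+1}-2l_0$, and the axes $A_{\gamma_{\mathrm a}},A_{\gamma_{\mathrm b}}$ are disjoint with $d(A_{\gamma_{\mathrm a}},A_{\gamma_{\mathrm b}})=l_0$. (A2b) If $l<(m_1+m_2)-m_j+qm_{j+1}$, then $\Gamma$ is free of rank two, $(\gamma_{\mathrm a},\gamma_{\mathrm b})=(\gamma_{j+1},\gamma_j\gamma_{j+1}^{-q})$ is a Schottky pair generating $\Gamma$ with translation lengths $m_{j+1}$ and $m_j-qm_{j+1}$, and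 $A_{\gamma_{\mathrm a}}\cap A_{\gamma_{\mathrm b}}$ has $v^+$ as an endpoint and length $l-m_1-m_2+m_j-(q-1)m_{j+1}$. (A3) $l>m_1+m_2-\gcd(m_1,m_2)$; then $\Gamma$ is not free, it is generated by $(\gamma_{\mathrm a},\gamma_{\mathrm b})=(\gamma_k,\gamma_{k+1})$ with $\gamma_k$ hyperbolic of translation length $m_k$ and $\gamma_{k+1}$ elliptic, and $A_{\gamma_{\mathrm a}}\cap T_{\gamma_{\mathrm b}}$ has $v^+$ as an endpoint and length $l-m_1-m_2+m_k$. (B) If $\alpha$ is irrational, then the sequence $\{m_i\}$ is infinite and $\Gamma$ falls into one of the following cases. (B1) If $l=0$, then $\Gamma$ is free of rank two, generated by $(\gamma_{\mathrm a},\gamma_{\mathrm b})=(\gamma_1,\gamma_2)$, with translation lengths $m_1,m_2$ and disjoint axes. (B2) If $0<l<m_1+m_2$, there are unique integers $j,q$ with $$(m_1+m_2)-m_j+(q-1)m_{j+1}<l\le (m_1+m_2)-m_j+qm_{j+1},\quad j\ge1,\ 0\le q\le q_j-1.$$ (B2a) If $l=(m_1+m_2)-m_j+qm_{j+1}$, then $\gamma_j\gamma_{j+1}^{-q}$ is hyperbolic; define $l_0$ as in the formula $l_0=\ell\big(A_{\gamma_j\gamma_{j+1}^{-q}}\cap\gamma_{j+1}.A_{\gamma_j\gamma_{j+1}^{-q}}\big)$ and let $(\gamma_{\mathrm a},\gamma_{\mathrm b})=(\gamma_{j+1},\gamma_j\gamma_{j+1}^{-q-1})$, a generating pair of $\Gamma$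 in which $\gamma_{\mathrm a}$ is hyperbolic with translation length $m_{j+1}$. If $l_0\ge\frac{m_j-(q+1)m_{j+1}}2$, then $\Gamma$ is not free, $\gamma_{\mathrm b}$ is elliptic, and $A_{\gamma_{\mathrm a}},T_{\gamma_{\mathrm b}}$ are disjoint with distance $\frac{m_j-(q+1)m_{j+1}}2$. If $l_0<\frac{m_j-(q+1)m_{j+1}}2$, then $\Gamma$ is free of rank two, $\gamma_{\mathrm b}$ is hyperbolic with translation length $m_j-(q+1)m_{j+1}-2l_0$, and $A_{\gamma_{\mathrm a}},A_{\gamma_{\mathrm b}}$ are disjoint with distance $l_0$. (B2b) If $l<(m_1+m_2)-m_j+qm_{j+1}$, then $\Gamma$ is free of rank two, generated by $(\gamma_{\mathrm a},\gamma_{\mathrm b})=(\gamma_{j+1},\gamma_j\gamma_{j+1}^{-q})$ with translation lengths $m_{j+1}$ and $m_j-qm_{j+1}$ and meeting axes with $\ell(A_{\gamma_{\mathrm a}}\cap A_{\gamma_{\mathrm b}})=l-m_1-m_2+m_j-(q-1)m_{j+1}$. (B3) It is impossible to have $l\ge m_1+m_2$.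
   Context: A weighted tree $(X,w)$ is a combinatorial tree $X$ together with a function $w:\mathcal E(X)\to\mathbb R_{>0}$ on its edges; it is locally finite if every vertex has finite valence. $\mathrm{Real}(X,w)$ is the metric tree obtained by identifying each edge $e$ with a closed interval of length $w(e)$ and gluing at vertices; $d$ is its path metric and $\ell$ denotes length (in $[0,\infty]$). An automorphism of $(X,w)$ is an isometry of $\mathrm{Real}(X,w)$ onto itself; these form $\mathrm{Aut}(X,w)$. An automorphism is elliptic if it fixes a point of $\mathrm{Real}(X,w)$ (with fixed subtree $T_g$), and hyperbolic otherwise; a hyperbolic $g$ has translation length $m_g=\min_x d(x,g.x)>0$, attained exactly on a bi-infinite geodesic $A_g$, its axis, along which $g$ translates by $m_g$. A subgroup $G<\mathrm{Aut}(X,w)$ is discrete if there is a finite subtree whose pointwise stabilizer in $G$ is trivial. For commensurable positive reals, $\gcd(m_1,m_2)$ is the largest real $c>0$ with $m_1,m_2\in c\mathbb Z$. Convention: two axes (or an axis and a fixed subtree) are called disjoint if they share no segment of positive length, even though they may meet at a point. Schottky pair: a pair $(g_1,g_2)$ of hyperbolic automorphisms such that there are four open segments $e_1^\pm,e_2^\pm$ of $\mathrm{Real}(X,w)$, containing no branch point, with $g_i.e_i^-=e_i^+$, and for each a connected component $H_i^\pm$ of $\mathrm{Real}(X,w)\setminus e_i^\pm$, such that the four sets $H_i^\pm$ are non-empty and pairwise disjoint and $g_i.(\mathrm{Real}(X,w)\setminus H_i^-)=e_i^+\cup H_i^+$, $g_i^{-1}.(\mathrm{Real}(X,w)\setminus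 H_i^+)=e_i^-\cup H_i^-$ for $i=1,2$. *)

(* Defs.v *)
From HB Require Import structures.
From mathcomp Require Import all_boot all_order all_algebra.
From mathcomp Require Import all_classical all_reals all_analysis.

Set Implicit Arguments.
Unset Strict Implicit.
Unset Printing Implicit Defensive.

Import Order.TTheory GRing.Theory Num.Theory.

Local Open Scope classical_set_scope.
Local Open Scope ring_scope.

(** ** Generation and freeness, for subsets of an abstract group *)

Definition is_subgroup (G : groupType) (H : set G) : Prop :=
  [/\ H 1%g, forall x y, H x -> H y -> H (x * y)%g
    & forall x, H x -> H (x^-1)%g].

Definition generated (G : groupType) (B : set G) : set G :=
  smallest (@is_subgroup G) B.

(* In a word, the letter [(x, true)] stands for [x] and [(x, false)] for
   [x^-1]. *)
Definition eval_word (G : groupType) (w : seq (G * bool)) : G :=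
  foldr (fun a z => ((if a.2 then a.1 else a.1^-1) * z)%g) 1%g w.

Definition reduced_word (G : groupType) (w : seq (G * bool)) : bool :=
  sorted (fun a b => (a.1 == b.1) ==> (a.2 == b.2)) w.

Definition free_basis (G : groupType) (B H : set G) : Prop :=
  generated B = H /\
  forall w : seq (G * bool), w <> [::] -> (forall a, a \in w -> B a.1) ->
    reduced_word w -> eval_word w <> 1%g.

Definition is_free (G : groupType) (H : set G) : Prop :=
  exists B, free_basis B H.

Definition free_of_rank (G : groupType) (n : nat) (H : set G) : Prop :=
  exists B, free_basis B H /\ (B #= `I_n)%card.

(** ** Weighted trees *)

Section Walks.
Variables (V E : Type) (src tgt : E -> V).

(* [(e, true)] is the edge [e] run from [src e] to [tgt e], [(e, false)] its
   reverse. *)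
Definition start (a : E * bool) : V := if a.2 then src a.1 else tgt a.1.
Definition stop (a : E * bool) : V := if a.2 then tgt a.1 else src a.1.

Fixpoint walk (x : V) (p : seq (E * bool)) (y : V) : Prop :=
  if p is a :: p' then start a = x /\ walk (stop a) p' y else x = y.

End Walks.

(* The orientation of the edges is auxiliary: it serves to identify [e] with the
   interval [[0, weight e]]. A circuit is a nonempty closed walk repeating
   neither a vertex nor an edge, so that acyclicity also excludes loops and
   multiple edges. *)
Record wtree (R : realType) := WTree {
  vertex : choiceType;
  edge : choiceType;
  src : edge -> vertex;
  tgt : edge -> vertex;
  weight : edge -> R;
  weight_gt0 : forall e, 0 < weight e;
  wtree_inhabited : inhabited vertex;
  wtree_connected : forall x y, exists p, walk src tgt x p y;
  wtree_acyclic : forall x p, walk src tgt x p x ->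
    uniq (map fst p) -> uniq (map (stop src tgt) p) -> p = [::]
}.

Definition incident (R : realType) (X : wtree R) (v : vertex X) :
  set (edge X) := [set e | src e = v \/ tgt e = v].

Definition locally_finite (R : realType) (X : wtree R) : Prop :=
  forall v : vertex X, finite_set (incident v).

(** ** The realization and its path metric *)

(* Gluing the intervals [[0, weight e]] at the vertices leaves the vertices and
   the interior points of the edges. *)
Inductive realization (R : realType) (X : wtree R) : Type :=
| Vert of vertex X
| Inner (e : edge X) (t : R) of 0 < t < weight e.

HB.instance Definition _ (R : realType) (X : wtree R) :=
  gen_eqMixin (realization X).
HB.instance Definition _ (R : realType) (X : wtree R) :=
  gen_choiceMixin (realization X).

(* [p] is the point of parameter [t] on the closed edge [e]. *)
Definition edge_point (R : realType) (X : wtree R) (e : edge X) (t : R)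
    (p : realization X) : Prop :=
  [\/ t = 0 /\ p = Vert (src e), t = weight e /\ p = Vert (tgt e)
    | exists ht : 0 < t < weight e, p = Inner ht].

(* [chain p q L]: there is a path of length [L] from [p] to [q] made of finitely
   many pieces, each contained in a closed edge. *)
Inductive chain (R : realType) (X : wtree R) :
  realization X -> realization X -> R -> Prop :=
| chain_nil p : chain p p 0
| chain_cons e s t p p' q L : edge_point e s p -> edge_point e t p' ->
    chain p' q L -> chain p q (`|s - t| + L).

Definition path_dist (R : realType) (X : wtree R) (p q : realization X) : R :=
  inf [set L | chain p q L].

Section WalkTheory.
Context (R : realType) (X : wtree R).
Local Notation walk := (walk (@src R X) (@tgt R X)).
Local Notation start := (start (@src R X) (@tgt R X)).
Local Notation stop := (stop (@src R X) (@tgt R X)).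

Lemma walk_cat x y z p q : walk x p y -> walk y q z -> walk x (p ++ q) z.
Proof. by elim: p x => [x /= ->//|a p IH x /= [-> /IH h] /h]. Qed.

Let flip (a : edge X * bool) := (a.1, ~~ a.2).

Lemma walk_rev x y p : walk x p y -> walk y (rev (map flip p)) x.
Proof.
elim: p x => [x /= ->//|a p IH x /= [<- /IH h]].
rewrite rev_cons -cats1; apply: (walk_cat h).
by case: a {h} => e []; split.
Qed.

Lemma start_or_stop a b : a.1 = b.1 -> start a = start b \/ start a = stop b.
Proof.
case: a b => e s [f t] /= ->.
by case: s t => [] []; rewrite /Defs.start /Defs.stop /=; auto.
Qed.

Lemma simple_suffix x y z q : walk z q y ->
  uniq (z :: map stop q) -> uniq (map fst q) -> x \in z :: map stop q ->
  exists r, [/\ walk x r y, uniq (x :: map stop r), uniq (map fst r)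
    & {subset map fst r <= map fst q}].
Proof.
elim: q z => [|b q IH] z.
  by move=> h u1 u2; rewrite inE => /eqP ->; exists [::].
move=> h u1 u2; rewrite in_cons => /orP[/eqP ->|hx].
  by exists (b :: q); split.
case: h => _ h; case/andP: u1 => _ u1; case/andP: (u2) => _ u2'.
have [r [r1 r2 r3 r4]] := IH _ h u1 u2' hx.
by exists r; split=> // e /r4 er; rewrite inE er orbT.
Qed.

Lemma simple_walk x y p : walk x p y ->
  exists q, [/\ walk x q y, uniq (x :: map stop q), uniq (map fst q)
    & {subset map fst q <= map fst p}].
Proof.
elim: p x => [x h|a p IH x [ax /IH [q [q1 q2 q3 q4]]]]; first by exists [::].
have [xq|xq] := boolP (x \in stop a :: map stop q).
  have [r [r1 r2 r3 r4]] := simple_suffix q1 q2 q3 xq.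
  by exists r; split=> // e /r4 /q4 er; rewrite inE er orbT.
exists (a :: q); split=> //; first by rewrite map_cons cons_uniq xq.
  rewrite map_cons cons_uniq q3 andbT; apply: contra xq.
  move=> /mapP [b bq ab].
  have [->|->] : x = start b \/ x = stop b by rewrite -ax; exact: (start_or_stop ab).
  - elim: q (stop a) q1 bq {q2 q3 q4} => // c q IHq z /= [<- h].
    rewrite !inE => /orP[/eqP ->|bq]; first by rewrite eqxx.
    by have := IHq _ h bq; rewrite inE => ->; rewrite orbT.
  - by rewrite inE map_f // orbT.
by move=> e; rewrite !inE => /orP[->//|/q4 ->]; rewrite orbT.
Qed.

(* Vertices that can be joined to [src e] without using [e]. *)
Definition side (e : edge X) (x : vertex X) : Prop :=
  exists p, walk (src e) p x /\ e \notin map fst p.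

Lemma map_fst_rev p : map fst (rev (map flip p)) = rev (map fst p).
Proof. by rewrite map_rev -map_comp. Qed.

Lemma side_src e : side e (src e).
Proof. by exists [::]. Qed.

Lemma side_walk e x y p : walk x p y -> e \notin map fst p ->
  side e x -> side e y.
Proof.
move=> h ep [q [q1 q2]]; exists (q ++ p); split; first exact: walk_cat h.
by rewrite map_cat mem_cat negb_or q2.
Qed.

Lemma sideE e x y p : walk x p y -> e \notin map fst p ->
  `[< side e x >] = `[< side e y >].
Proof.
move=> h ep; apply: asbool_equiv_eq; split; first exact: side_walk h ep.
by apply: (side_walk (walk_rev h)); rewrite map_fst_rev mem_rev.
Qed.

Lemma side_tgt e : ~ side e (tgt e).
Proof.
move=> [p [p1 p2]]; have [q [q1 q2 q3 q4]] := simple_walk (walk_rev p1).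
have eq : e \notin map fst q.
  by apply: contra p2 => /q4; rewrite map_fst_rev mem_rev.
have := @wtree_acyclic _ X (src e) ((e, true) :: q).
by move=> /(_ (conj erefl q1)); rewrite map_cons cons_uniq eq q3 => /(_ isT q2).
Qed.

End WalkTheory.

Section PathMetric.
Context (R : realType) (X : wtree R).
Implicit Types p q r : realization X.

Lemma chain_ge0 p q L : chain p q L -> 0 <= L.
Proof. by elim=> // *; rewrite addr_ge0. Qed.

Lemma chain_trans p q r L M : chain p q L -> chain q r M -> chain p r (L + M).
Proof.
elim=> [p0|e s t p0 p1 q0 L0 h1 h2 _ IH] h; first by rewrite add0r.
by rewrite -addrA; apply: chain_cons h1 h2 (IH h).
Qed.

Lemma chain1 (e : edge X) s t p q : edge_point e s p -> edge_point e t q ->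
  chain p q `|s - t|.
Proof. by move=> h1 h2; rewrite -[`|_|]addr0; apply: chain_cons h1 h2 (chain_nil _). Qed.

Lemma chain_sym p q L : chain p q L -> chain q p L.
Proof.
elim=> [p0|e s t p0 p1 q0 L0 h1 h2 _ IH]; first exact: chain_nil.
by rewrite addrC; apply: (chain_trans IH); rewrite distrC; apply: chain1 h2 h1.
Qed.

Lemma chain_ex p q : exists L, chain p q L.
Proof.
have src0 e : edge_point e 0 (Vert (@src _ X e)) by apply: Or31.
have tgtw e : edge_point e (weight e) (Vert (@tgt _ X e)) by apply: Or32.
have toV r : exists v M, chain r (Vert v) M.
  case: r => [v|e t ht]; first by exists v, 0; exact: chain_nil.
  by exists (src e), `|t - 0|; apply: (chain1 _ (src0 e)); apply: Or33; exists ht.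
have [v [M hM]] := toV p; have [u [N hN]] := toV q.
suff [K hK] : exists K, chain (Vert v) (Vert u) K.
  by exists (M + (K + N)); apply: chain_trans hM (chain_trans hK (chain_sym hN)).
have [w] := wtree_connected v u.
elim: w v {hM} => [v /= ->|[e b] w IH v [<- /IH [K hK]]].
  by exists 0; exact: chain_nil.
case: b hK => hK.
- by eexists; apply: chain_trans hK; apply: chain1 (src0 e) (tgtw e).
- by eexists; apply: chain_trans hK; apply: chain1 (tgtw e) (src0 e).
Qed.

Lemma chain_has_inf p q : has_inf [set L | chain p q L].
Proof.
by split; [exact: chain_ex|exists 0 => L /chain_ge0].
Qed.

Lemma path_dist_lb p q c : (forall L, chain p q L -> c <= L) ->
  c <= path_dist p q.
Proof. by move=> h; apply: lb_le_inf; [exact: chain_ex|move=> L /h]. Qed.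

Lemma path_dist_le p q L : chain p q L -> path_dist p q <= L.
Proof. by move=> h; apply: ge_inf => //; case: (chain_has_inf p q). Qed.

Lemma path_distxx p : path_dist p p = 0.
Proof.
apply/eqP; rewrite eq_le path_dist_le ?path_dist_lb //; last exact: chain_nil.
by move=> L /chain_ge0.
Qed.

Lemma path_dist_sym p q : path_dist p q = path_dist q p.
Proof.
by apply/eqP; rewrite eq_le; apply/andP; split; apply: path_dist_lb => L /chain_sym;
   exact: path_dist_le.
Qed.

Lemma path_dist_triangle q p r :
  path_dist p r <= path_dist p q + path_dist q r.
Proof.
rewrite -lerBlDr; apply: path_dist_lb => L hL.
rewrite lerBlDr addrC -lerBlDr; apply: path_dist_lb => M hM.
by rewrite lerBlDr addrC; apply/path_dist_le/(chain_trans hL).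
Qed.

(* 1-Lipschitz; the parameter along [e], extended by constants on both sides. *)
Let cut (e : edge X) p : R :=
  let f x := if `[< side e x >] then 0 else weight e in
  match p with
  | Vert x => f x
  | @Inner _ _ e' t _ => if e' == e then t else f (src e')
  end.

Let cut_src e : cut e (Vert (src e)) = 0.
Proof. by rewrite /cut asboolT //; exact: side_src. Qed.

Let cut_tgt e : cut e (Vert (tgt e)) = weight e.
Proof. by rewrite /cut asboolF //; exact: side_tgt. Qed.

Let cut_edge e t p : edge_point e t p -> cut e p = t.
Proof.
by case=> [[-> ->]|[-> ->]|[h ->]]; [exact: cut_src|exact: cut_tgt|rewrite /= eqxx].
Qed.

Let cut_other e e' t p : e' != e -> edge_point e' t p ->
  cut e p = cut e (Vert (src e')).
Proof.
move=> ee'; case=> [[_ ->]|[_ ->]|[h ->]] //=; last by rewrite (negbTE ee').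
rewrite -(@sideE _ _ e (src e') (tgt e') [:: (e', true)]) //.
by rewrite inE eq_sym.
Qed.

Let cut_le e p q L : chain p q L -> `|cut e p - cut e q| <= L.
Proof.
elim=> [p0|e' s t p0 p1 q0 L0 h1 h2 _ IH]; first by rewrite subrr normr0.
apply: le_trans (ler_distD (cut e p1) _ _) _; apply: lerD => //.
have [ee|ee] := eqVneq e' e.
  by subst e'; rewrite (cut_edge h1) (cut_edge h2).
by rewrite (cut_other ee h1) (cut_other ee h2) subrr normr0.
Qed.

Let cut_eq e p q : path_dist p q = 0 -> cut e p = cut e q.
Proof.
move=> pq0; apply/eqP; rewrite -subr_eq0 -normr_le0 -pq0.
by apply: path_dist_lb => L; exact: cut_le.
Qed.

Lemma path_dist_positivity p q : path_dist p q = 0 -> p = q.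
Proof.
have inner e t (ht : 0 < t < weight e) r :
    path_dist (Inner ht) r = 0 -> Inner ht = r.
  move=> /(@cut_eq e); rewrite {1}/cut eqxx.
  have neq b : t <> if b then 0 else weight e.
    by case: b => te; move: (ht); rewrite te ltxx ?andbF.
  case: r => [x /neq//|e' t' ht' /=]; case: eqP => [ee|_ /neq//].
  by subst e' => tt; subst t'; rewrite (bool_irrelevance ht ht').
case: p => [v|e t ht]; last exact: inner.
case: q => [u|e t ht]; last by rewrite path_dist_sym => /inner ->.
have [w /simple_walk[{}w [h _ h2 _]]] := wtree_connected v u.
case: w h h2 => [/= ->//|[e b] w [<- h]]; rewrite map_cons cons_uniq => /andP[ew _].
move=> /(@cut_eq e); have := sideE h ew; have := weight_gt0 e.
have := @side_src _ _ e; have := @side_tgt _ _ e; rewrite /= /start /stop /=.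
by case: b {h ew} => /= /asboolF hF /asboolT hT w0; rewrite ?hF ?hT => <- /eqP;
   rewrite ?(lt_eqF w0) ?(gt_eqF w0).
Qed.

HB.instance Definition _ := isMetric.Build R (realization X)
  path_distxx path_dist_positivity path_dist_sym path_dist_triangle.

End PathMetric.

(** ** Automorphisms *)

(* The group law is [g * h = g \o h]. *)
Record aut (R : realType) (X : wtree R) := Aut {
  aut_fun :> realization X -> realization X;
  aut_inv : realization X -> realization X;
  aut_isom : forall x y, mdist (aut_fun x) (aut_fun y) = mdist x y;
  aut_funK : cancel aut_fun aut_inv;
  aut_invK : cancel aut_inv aut_fun
}.

HB.instance Definition _ (R : realType) (X : wtree R) := gen_eqMixin (aut X).
HB.instance Definition _ (R : realType) (X : wtree R) :=
  gen_choiceMixin (aut X).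

Section AutGroup.
Context (R : realType) (X : wtree R).
Implicit Types g h : aut X.

Lemma autP g h : (forall x, g x = h x) -> g = h.
Proof.
case: g h => [f f' i1 c1 c1'] [k k' i2 c2 c2'] /= /funext fk; subst k.
have ff' : f' = k' by apply/funext => x; rewrite -{1}(c2' x) c1.
by subst k'; congr Aut; exact: Prop_irrelevance.
Qed.

Definition aut_one : aut X :=
  @Aut R X id id (fun _ _ => erefl) (fun _ => erefl) (fun _ => erefl).

Lemma aut_mul_isom g h x y : mdist (g (h x)) (g (h y)) = mdist x y.
Proof. by rewrite !aut_isom. Qed.

Definition aut_mul g h : aut X :=
  @Aut R X (g \o h) (aut_inv h \o aut_inv g) (aut_mul_isom g h)
    (can_comp (@aut_funK _ _ g) (@aut_funK _ _ h))
    (can_comp (@aut_invK _ _ h) (@aut_invK _ _ g)).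

Lemma aut_inv_isom g x y : mdist (aut_inv g x) (aut_inv g y) = mdist x y.
Proof. by rewrite -(aut_isom g) !aut_invK. Qed.

Definition aut_opp g : aut X :=
  @Aut R X (aut_inv g) g (aut_inv_isom g) (@aut_invK _ _ g) (@aut_funK _ _ g).

Lemma aut_mulA : associative aut_mul.
Proof. by move=> g h k; exact: autP. Qed.
Lemma aut_mul1g : left_id aut_one aut_mul.
Proof. by move=> g; exact: autP. Qed.
Lemma aut_mulg1 : right_id aut_one aut_mul.
Proof. by move=> g; exact: autP. Qed.
Lemma aut_mulVg : left_inverse aut_one aut_opp aut_mul.
Proof. by move=> g; apply: autP => x; exact: aut_funK. Qed.
Lemma aut_mulgV : right_inverse aut_one aut_opp aut_mul.
Proof. by move=> g; apply: autP => x; exact: aut_invK. Qed.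

HB.instance Definition _ := isGroup.Build (aut X)
  aut_mulA aut_mul1g aut_mulg1 aut_mulVg aut_mulgV.

End AutGroup.

Section Geometry.
Context (R : realType) (X : wtree R).
Implicit Types (g h : aut X) (x y : realization X) (A B S : set (realization X)).

Definition segment x y : set (realization X) :=
  [set z | mdist x z + mdist z y = mdist x y].

(* Meant for subsets isometric to an interval: the supremum of the lengths of
   the segments contained in [S], and [0] when [S] is empty. *)
Definition arc_length S : \bar R :=
  ereal_sup [set z | z = 0%E \/
    exists x y, segment x y `<=` S /\ z = (mdist x y)%:E].

Definition share_no_segment A B : Prop :=
  forall x y, segment x y `<=` A `&` B -> x = y.

Definition set_dist A B : R := inf [set mdist x y | x in A & y in B].

Definition fixed_set g : set (realization X) := [set x | g x = x].

Definition elliptic g : Prop := fixed_set g !=set0.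

Definition hyperbolic g : Prop := ~ elliptic g.

Definition translation_length g : R := inf (range (fun x => mdist x (g x))).

Definition axis g : set (realization X) :=
  [set x | mdist x (g x) = translation_length g].

(* [x] comes before [y] on the axis of [g], oriented by the action of [g]. *)
Definition translates_toward g x y : Prop :=
  exists c : R -> realization X,
    [/\ forall s t, mdist (c s) (c t) = `|s - t|,
        range c = axis g,
        forall t, g (c t) = c (t + translation_length g)
      & exists s t, [/\ s < t, c s = x & c t = y]].

(* A subtree is given by its set of vertices; it contains every edge whose two
   ends it contains. *)
Definition is_subtree (T : set (vertex X)) : Prop :=
  T !=set0 /\ forall u v, T u -> T v -> exists p,
    walk (@src R X) (@tgt R X) u p v /\
    forall a, a \in p -> T (stop (@src R X) (@tgt R X) a).

Definition subtree_points (T : set (vertex X)) : set (realization X) :=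
  [set x | match x with
           | Vert v => T v
           | @Inner _ _ e _ _ => T (src e) /\ T (tgt e)
           end].

Definition discrete (G : set (aut X)) : Prop :=
  exists T, [/\ finite_set T, is_subtree T
    & forall g, G g -> (forall x, subtree_points T x -> g x = x) -> g = 1%g].

Definition branch_point x : Prop :=
  exists v, x = Vert v /\ exists e1 e2 e3 : edge X,
    [/\ uniq [:: e1; e2; e3], incident v e1, incident v e2 & incident v e3].

Definition open_segment S : Prop :=
  exists x y, x <> y /\ S = segment x y `\` [set x; y].

Definition is_component A S : Prop :=
  exists2 x, A x & S = connected_component A x.

(* Both families are indexed by [i], with [true] for the first automorphism,
   and by the sign, with [true] for [+]. *)
Definition schottky_pair g1 g2 : Prop :=
  [/\ hyperbolic g1, hyperbolic g2
    & exists e H : bool -> bool -> set (realization X),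
      let g i := if i then g1 else g2 in
      [/\ forall i s, open_segment (e i s) /\
            (forall x, e i s x -> ~ branch_point x),
          forall i, g i @` e i false = e i true,
          forall i s, is_component (~` e i s) (H i s) /\ H i s !=set0,
          trivIset setT (fun k : bool * bool => H k.1 k.2)
        & forall i,
            g i @` (~` H i false) = e i true `|` H i true /\
            (g i)^-1%g @` (~` H i true) = e i false `|` H i false]].

End Geometry.

(** ** The Euclidean algorithm on translation lengths *)

Section Euclid.
Context (R : realType).

Definition common_divisor (a b c : R) : Prop :=
  [/\ 0 < c, exists z : int, a = z%:~R * c & exists z : int, b = z%:~R * c].

(* Junk value [0] when [a] and [b] are not commensurable. *)
Definition real_gcd (a b : R) : R :=
  xget 0 [set c | common_divisor a b c /\
                  forall c', common_divisor a b c' -> c' <= c].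

(* The sequences are indexed from [1]; their values at [0] and past the first
   vanishing [mseq a b i] are irrelevant. *)
Definition mseq (a b : R) (i : nat) : R :=
  (iter i.-1 (fun s : R * R => (s.2, s.1 - (Num.truncn (s.1 / s.2))%:R * s.2))
    (a, b)).1.

Definition qseq (a b : R) (i : nat) : nat :=
  Num.truncn (mseq a b i / mseq a b i.+1).

Lemma mseqSS a b i : (0 < i)%N ->
  mseq a b i.+2 = mseq a b i - (qseq a b i)%:R * mseq a b i.+1.
Proof. by case: i. Qed.

Definition gseq (X : wtree R) (g1 g2 : aut X) (i : nat) : aut X :=
  let a := translation_length g1 in let b := translation_length g2 in
  (iteri i.-1 (fun n s => (s.2, s.1 * s.2 ^- qseq a b n.+1)%g) (g1, g2)).1.

Lemma gseqSS (X : wtree R) (g1 g2 : aut X) i : (0 < i)%N ->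
  let q := qseq (translation_length g1) (translation_length g2) in
  gseq g1 g2 i.+2 = (gseq g1 g2 i * gseq g1 g2 i.+1 ^- q i)%g.
Proof. by case: i. Qed.

End Euclid.

Definition exactly_one (P Q S : Prop) : Prop :=
  [\/ [/\ P, ~ Q & ~ S], [/\ ~ P, Q & ~ S] | [/\ ~ P, ~ Q & S]].

(* Main.v *)
(* Euclid's algorithm on the translation lengths acts on the pair of axes. If [a]
   and [h] translate by [m <= n] in the same direction along an intersection of
   length [L > m] ending at [v], then [h a^-1] translates by [n - m] and its axis
   meets that of [a] along the terminal segment of length [L - m], so [L - m - n]
   is an invariant of the process. It stops at the first pair with [L <= m]: for
   [L < m] the projections to the two axes yield disjoint half-trees (a Schottky
   pair), and for [L = m] the product [h a^-1] leaves the axis of [a] at [v],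
   where the position of its axis or fixed point set is read off the overlap of
   the axis of [h] with its translate by [a]. If the lengths become equal while
   [L > m], the last quotient is a nontrivial elliptic element, which has finite
   order by local finiteness and discreteness. If the algorithm never stops, [v]
   is a branch point moved by arbitrarily small amounts, against local finiteness. *)

Require Import Defs.
From HB Require Import structures.
From mathcomp Require Import all_boot all_order all_algebra.
From mathcomp Require Import all_classical all_reals all_analysis.
From mathcomp Require Import lra.

Set Implicit Arguments.
Unset Strict Implicit.
Unset Printing Implicit Defensive.

Import Order.TTheory GRing.Theory Num.Theory.

Local Open Scope classical_set_scope.
Local Open Scope ring_scope.

(** * R-trees and lines *)

(** Automorphisms are arbitrary isometries of the realization and may carry a vertex of valence two
    into the interior of an edge, so the combinatorics of edges is not preserved. The argument
    therefore runs on parametrized axes: a line [c] with [g (c t) = c (t + m)], and the parameter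
    [gate c x] of the projection of [x]. In these coordinates [g] shifts gates by [m], half-trees
    are inequalities on gates, and most geometric claims become linear arithmetic over the
    four-point condition. The two axes of a pair are parametrized with the terminal end of their
    overlap at 0; keeping this end fixed through the whole algorithm is what permits a uniform lower
    bound on translation lengths in the irrational case. The metric part is done in abstract
    R-trees. Local finiteness enters only through small balls of the realization: it isolates
    vertices and makes small spheres finite. Failure of freeness is always detected by torsion,
    which rules out free groups of every rank. *)

Ltac abs_lra :=
  repeat match goal with H : context [Num.norm _] |- _ => revert H end;
  repeat match goal with
  | |- context [Num.norm ?x] => case: (ger0P x) => ?
  end; intros; lra.

(* [lra] up to symmetry of the distance. *)
Ltac sym_once x y :=
  lazymatch goal with
  | _ : mdist x y = mdist y x |- _ => fail
  | _ : mdist y x = mdist x y |- _ => fail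
  | _ => have := metric_sym x y => ?
  end.
Ltac dlra :=
  intros;
  repeat match goal with
  | H : context [mdist ?x ?y] |- _ => sym_once x y
  | |- context [mdist ?x ?y] => sym_once x y
  end; lra.

Section Between.
Context (R : realType) (T : metricType R).
Implicit Types x y z w p q m n a b c : T.
Local Notation d := (@mdist R T).

Definition between x p y := d x p + d p y = d x y.

(** Zero-hyperbolicity: each side of a geodesic triangle lies in the union of the other two. *)
Definition thin_triangles := forall x y z p,
  between x p y -> between x p z \/ between z p y.

(** Only one point at each distance is asked for; thinness makes such points fit together into an
    isometric embedding, see [segment_param]. *)
Definition geodesic_pair x y := forall t : R, 0 <= t <= d x y ->
  exists z, d x z = t /\ d z y = d x y - t.

Lemma between_sym x p y : between x p y -> between y p x.
Proof. by rewrite /between; dlra. Qed.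

Context (thin : thin_triangles).

Lemma geodesic_trans x m y : geodesic_pair x m -> geodesic_pair m y ->
  geodesic_pair x y.
Proof.
move=> gxm gmy t /andP[t0 ty].
have tri1 := metric_triangle x m y; have tri2 := metric_triangle m x y.
have tri3 := metric_triangle x y m.
(* The Gromov product of [x] and [y] at [m], that is, the length of the backtracking at [m]; [n]
   below is the point where the two pieces part. *)
pose k := (d x m + d m y - d x y) / 2.
have [n [xn nm]] : exists n, d x n = d x m - k /\ d n m = k.
  have [n [xn nm]] := gxm (d x m - k) ltac:(rewrite /k; dlra).
  by exists n; split=> //; lra.
have bn : between x n m by rewrite /between; lra.
have [ny xny] : d n y = d m y - k /\ d x n + d n y = d x y.
  by case: (thin y bn); rewrite /between => h; split; move: h xn nm;
     rewrite /k; clear; dlra.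
clearbody k; clear tri1 tri2 tri3.
case: (leP t (d x n)) => tn.
  have [z [xz zm]] := gxm t ltac:(have := mdist_ge0 n m; lra).
  have bz : between x z m by rewrite /between; lra.
  exists z; split=> //; have zn : d z n <= d x n - t.
    by case: (thin n bz); rewrite /between; clear -xz zm xn nm tn; dlra.
  have := metric_triangle x z y; have := metric_triangle z n y.
  by clear -xz zn xny; lra.
have [z [mz zy]] := gmy (k + (t - d x n)) ltac:(have := mdist_ge0 n m; lra).
have bmny : between m n y by rewrite /between; clear -nm ny; dlra.
exists z; have nz : d n z <= t - d x n.
  by case: (thin z bmny); rewrite /between; clear -mz zy ny nm tn; dlra.
have := metric_triangle x n z; have := metric_triangle x z y.
by clear -nz zy ny xny => *; split; lra.
Qed.

End Between.

Definition rtree (R : realType) (T : metricType R) :=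
  thin_triangles T /\ forall x y : T, geodesic_pair x y.

Section RTree.
Context (R : realType) (T : metricType R) (treeT : rtree T).
Implicit Types x y z w p q m n a b c : T.
Local Notation d := (@mdist R T).

Let thin := proj1 treeT.
Let geod := proj2 treeT.

(** The median lies on the segment from [x] to [y], at the Gromov product of [y] and [z] from [x].
    Thinness puts it on one of the other sides, and the distances then put it on both. *)
Lemma median_ex x y z :
  exists m, [/\ between x m y, between y m z & between x m z].
Proof.
have t1 := metric_triangle x y z; have t2 := metric_triangle y x z.
have t3 := metric_triangle x z y.
have [m [xm my]] := @geod x y ((d x y + d x z - d y z) / 2) ltac:(dlra).
clear t1 t2 t3.
have b : between x m y by rewrite /between; lra.
exists m; case: (thin z b) => h; split=> //; move: h; rewrite /between;
  clear -xm my; dlra.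
Qed.

(** Gromov's four-point condition, the form in which the tree enters most of the arithmetic
    below. *)
Lemma four_point x y z w :
  d x y + d z w <= d x z + d y w \/ d x y + d z w <= d x w + d y z.
Proof.
have [m [bxy byz bxz]] := median_ex x y z.
have tri := metric_triangle z m w.
case: (thin w bxy) => k1; case: (thin w bxz) => k2.
- case: (thin w byz) => k3; move: bxy byz bxz k1 k2 k3 tri; rewrite /between; clear;
  by [left; dlra|right; dlra].
- by right; move: bxy byz bxz k1 k2 tri; rewrite /between; clear; dlra.
- by left; move: bxy byz bxz k1 k2 tri; rewrite /between; clear; dlra.
- by left; move: bxy byz bxz k1 k2 tri; rewrite /between; clear; dlra.
Qed.

Lemma between_uniq x y p q : between x p y -> between x q y -> d x p = d x q ->
  p = q.
Proof.
move=> hp hq pq; apply: mdist_positivity; have := mdist_ge0 p q.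
by case: (four_point x y p q); move: hp hq pq; rewrite /between; clear; dlra.
Qed.

(** Local geodesics are global: two geodesics that overlap in a nondegenerate segment cannot
    backtrack at its ends. *)
Lemma between_concat a b c e : between a b c -> between b c e -> b <> c ->
  d a e = d a b + d b c + d c e.
Proof.
rewrite /between => h1 h2 bc.
have bc0 : 0 < d b c by rewrite mdist_gt0; apply/eqP.
have := metric_triangle a c e; have := mdist_ge0 c e; have := mdist_ge0 a b.
by case: (four_point a c b e); move: h1 h2 bc0; clear; dlra.
Qed.

Lemma segment_param x y : exists f : R -> T, [/\ f 0 = x, f (d x y) = y &
  forall s t, 0 <= s <= d x y -> 0 <= t <= d x y -> d (f s) (f t) = `|s - t|].
Proof.
have /choice[f fP] : forall t, exists z, 0 <= t <= d x y ->
    d x z = t /\ d z y = d x y - t.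
  move=> t; have [ht|ht] := pselect (0 <= t <= d x y); last by exists x.
  by have [z hz] := geod ht; exists z.
have d0 := mdist_ge0 x y.
exists f; split.
- by apply/esym/mdist_positivity; case: (fP 0); rewrite ?lexx.
- by apply: mdist_positivity; case: (fP (d x y)); rewrite ?lexx ?d0 //; lra.
have wl s t : s <= t -> 0 <= s <= d x y -> 0 <= t <= d x y ->
    d (f s) (f t) = t - s.
  move=> st /fP[xs sy] /fP[xt ty].
  have bs : between x (f s) y by rewrite /between; lra.
  have := mdist_ge0 (f s) (f t).
  by case: (thin (f t) bs); rewrite /between; move: xs sy xt ty st; clear; dlra.
move=> s t hs ht; case: (leP s t) => st.
  by rewrite wl // distrC ger0_norm ?subr_ge0.
by rewrite metric_sym wl ?(ltW st) // ger0_norm // subr_ge0 ltW.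
Qed.

End RTree.

Section Lines.
Context (R : realType) (T : metricType R) (treeT : rtree T).
Implicit Types x y z : T.
Local Notation d := (@mdist R T).

Definition line (c : R -> T) := forall s t, d (c s) (c t) = `|s - t|.

Lemma line_inj c s t : line c -> c s = c t -> s = t.
Proof.
move=> lc st; have := lc s t; rewrite st mdistxx => /esym/eqP.
by rewrite normr_eq0 subr_eq0 => /eqP.
Qed.

Lemma line_shift c u : line c -> line (fun t => c (t + u)).
Proof. by move=> lc s t; rewrite lc; congr Num.norm; lra. Qed.

Lemma line_opp c : line c -> line (fun t => c (- t)).
Proof. by move=> lc s t; rewrite lc -normrN; congr Num.norm; lra. Qed.

Lemma between_line c s t u : line c -> s <= t <= u -> between (c s) (c t) (c u).
Proof. by move=> lc /andP[st tu]; rewrite /between !lc; abs_lra. Qed.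

Lemma between_line_eq c x s u : line c -> between (c s) x (c u) ->
  s <= u -> x = c (s + d (c s) x).
Proof.
move=> lc hx su; have dx := mdist_ge0 (c s) x; have dx' := mdist_ge0 x (c u).
have h : d (c s) x <= u - s.
  by move: hx; rewrite /between lc => h; move: h dx dx'; abs_lra.
apply: (between_uniq treeT hx).
  by apply: between_line => //; apply/andP; split; lra.
by rewrite lc; abs_lra.
Qed.

Lemma lines_agree c c' s t u : line c -> line c' -> c s = c' s -> c u = c' u ->
  s <= t <= u -> c t = c' t.
Proof.
move=> lc lc' cs cu stu; apply: (between_uniq treeT (between_line lc stu)).
  by rewrite cs cu; exact: between_line.
by rewrite {2}cs lc lc'.
Qed.

Lemma gate_ex c x : line c ->
  exists p D, 0 <= D /\ forall t, d x (c t) = D + `|t - p|.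
Proof.
move=> lc; pose g t := d x (c t).
have lip s t : g s <= g t + `|s - t|.
  by rewrite /g (le_trans (metric_triangle x (c t) (c s))) // lc distrC.
have lip2 s t : `|s - t| <= g s + g t.
  by rewrite -lc /g (le_trans (metric_triangle (c s) x (c t))) // metric_sym.
(* On a bounded interval the values at the ends determine [p] and [D], and the four-point condition
   gives the values in between. *)
have loc s u : s < u -> exists p D, [/\ 0 <= D, s <= p <= u &
    forall t, s <= t <= u -> g t = D + `|t - p|].
  move=> su; exists ((g s - g u + s + u) / 2), ((g s + g u - (u - s)) / 2).
  have h1 := lip s u; have h2 := lip u s; have h3 := lip2 s u.
  split; [by abs_lra|by apply/andP; split; abs_lra|].
  move=> t /andP[st tu].
  have h4 := lip s t; have h5 := lip u t.
  have := four_point treeT (c s) (c u) x (c t).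
  rewrite !lc (metric_sym (c s) x) (metric_sym (c u) x) -/(g s) -/(g t) -/(g u).
  move: (g s) (g t) (g u) h1 h2 h3 h4 h5 => a b e.
  have -> : `|s - u| = u - s by rewrite distrC ger0_norm // subr_ge0 ltW.
  have -> : `|u - s| = u - s by rewrite ger0_norm // subr_ge0 ltW.
  have -> : `|s - t| = t - s by rewrite distrC ger0_norm // subr_ge0.
  have -> : `|u - t| = u - t by rewrite ger0_norm // subr_ge0.
  by move=> ? ? ? ? ? [] ?; abs_lra.
have g0 : 0 <= g 0 by exact: mdist_ge0.
(* A foot lies within [g 0] of the parameter 0. So the feet found on this window and on any larger
   one belong to both, and evaluating the two formulas at both feet shows that they coincide. *)
pose N := g 0 + 1; have [p [D [D0 /andP[p1 p2] hp]]] := loc (- N) N ltac:(rewrite /N; lra).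
have pN : `|p| <= g 0.
  by have := hp 0 ltac:(rewrite /N; lra); move: D0; clear; abs_lra.
exists p, D; split=> // t; rewrite -/(g t).
pose M := N + `|t|; have t0 := normr_ge0 t.
have [p' [D' [D'0 _ hp']]] := loc (- M) M ltac:(rewrite /M /N; lra).
have p'N : `|p'| <= g 0.
  by have := hp' 0 ltac:(rewrite /M /N; lra); move: D'0; clear; abs_lra.
have tM : - M <= t <= M by rewrite /M; move: g0 t0; rewrite /N; clear; abs_lra.
have r q : `|q| <= g 0 -> (- N <= q <= N) && (- M <= q <= M).
  by rewrite /M /N ler_norml => /andP[? ?]; apply/andP; split; lra.
have /andP[r1 r2] := r _ pN; have /andP[r3 r4] := r _ p'N.
have e1 := hp _ r1; have e2 := hp _ r3; have e3 := hp' _ r2; have e4 := hp' _ r4.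
have [pp DD] : p' = p /\ D' = D.
  rewrite e1 in e3; rewrite e2 in e4; move: e3 e4; clear; rewrite !subrr normr0.
  by move=> ? ?; split; abs_lra.
by rewrite hp' // pp DD.
Qed.

(* The parameter of the projection of [x] to the line [c]. *)
Definition gate (c : R -> T) x : R :=
  xget 0 [set p | forall t, d x (c t) = d x (c p) + `|t - p|].

Lemma gateP c x t : line c -> d x (c t) = d x (c (gate c x)) + `|t - gate c x|.
Proof.
move=> lc; rewrite /gate; case: xgetP => [p _ -> //|].
have [p [D [_ h]]] := gate_ex x lc => /(_ p); case=> t'.
by rewrite !h subrr normr0 addr0.
Qed.

(** One sample on each side of [p] is enough, because the distance to the line is a constant plus
    the distance to the gate. *)
Lemma gate_uniq c x p u v : line c -> u < p < v ->
  d x (c u) = d x (c p) + (p - u) -> d x (c v) = d x (c p) + (v - p) ->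
  gate c x = p.
Proof.
move=> lc /andP[up pv]; rewrite (gateP x u lc) (gateP x v lc) (gateP x p lc).
move: (gate c x) (d x _) => g D; clear -up pv; abs_lra.
Qed.

Lemma gate_line c t : line c -> gate c (c t) = t.
Proof.
by move=> lc; apply: (@gate_uniq _ _ _ (t - 1) (t + 1) lc); rewrite ?lc; first lra;
   abs_lra.
Qed.

Lemma dist_gate_ge0 c x : 0 <= d x (c (gate c x)).
Proof. exact: mdist_ge0. Qed.

(** When the feet differ, the geodesic must run along the line from one to the other; this is the
    four-point condition for the two points and their feet. *)
Lemma dist_gate c x y : line c -> gate c x <> gate c y ->
  d x y = d x (c (gate c x)) + `|gate c x - gate c y| + d y (c (gate c y)).
Proof.
move=> lc /eqP gxy; set p := gate c x; set q := gate c y.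
have pq0 : 0 < `|p - q| by rewrite normr_gt0 subr_eq0.
have := metric_triangle x (c p) y; have := metric_triangle (c p) (c q) y.
have := mdist_ge0 x (c p); have := mdist_ge0 y (c q).
have := gateP x q lc; have := gateP y p lc; rewrite -/p -/q lc.
have := four_point treeT x (c q) y (c p); rewrite lc (distrC q p).
by move: `|p - q| pq0 => a; clear; case; dlra.
Qed.

Lemma gate_lipschitz c x y : line c -> `|gate c x - gate c y| <= d x y.
Proof.
move=> lc; have [->|/(dist_gate lc) ->] := pselect (gate c x = gate c y).
  by rewrite subrr normr0 mdist_ge0.
by have := mdist_ge0 x (c (gate c x)); have := mdist_ge0 y (c (gate c y)); lra.
Qed.

(** A strict extremum of the gate at [y] would make the geodesic run over a piece of the line and
    back. This gives the convexity of half-trees. *)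
Lemma gate_between c x y z : line c -> between x y z ->
  (gate c x <= gate c y <= gate c z) || (gate c z <= gate c y <= gate c x).
Proof.
move=> lc hxyz; apply: contraT; rewrite negb_or !negb_and -!ltNge => h.
have xy : gate c x <> gate c y by move: h => /andP[]; clear => /orP[] ? /orP[] ?; lra.
have yz : gate c y <> gate c z by move: h => /andP[]; clear => /orP[] ? /orP[] ?; lra.
move: hxyz; rewrite /between (dist_gate lc xy) (dist_gate lc yz).
have := metric_triangle x (c (gate c x)) z.
rewrite (metric_sym (c _) z) (gateP z (gate c x) lc).
have := mdist_ge0 y (c (gate c y)).
have a1 : 0 < `|gate c x - gate c y| by rewrite normr_gt0 subr_eq0; apply/eqP.
move: xy yz h a1; move: (gate c x) (gate c y) (gate c z) => a b e xy yz h.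
by move: h => /andP[]; clear => /orP[] ? /orP[] ?; abs_lra.
Qed.

Lemma gate_translate c x (f : T -> T) m : line c ->
  (forall x y, d (f x) (f y) = d x y) -> (forall t, f (c t) = c (t + m)) ->
  gate c (f x) = gate c x + m.
Proof.
move=> lc fi fc; have h t : d (f x) (c t) = d x (c (t - m)).
  by rewrite -{1}(subrK m t) -fc fi.
apply: (@gate_uniq _ _ _ (gate c x + m - 1) (gate c x + m + 1) lc).
- by apply/andP; split; lra.
- by rewrite !h (gateP x _ lc) addrK; congr (_ + _); abs_lra.
- by rewrite !h (gateP x _ lc) addrK; congr (_ + _); abs_lra.
Qed.

(** The gates of [x] and [f x] differ by [m], so the geodesic between them goes down to the line and
    up again. Hence the line is exactly the set of minimal displacement. *)
Lemma dist_translate c x (f : T -> T) m : line c -> m != 0 ->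
  (forall x y, d (f x) (f y) = d x y) -> (forall t, f (c t) = c (t + m)) ->
  d x (f x) = 2 * d x (c (gate c x)) + `|m|.
Proof.
move=> lc m0 fi fc; have gf := gate_translate x lc fi fc.
have ne : gate c x <> gate c (f x) by rewrite gf => h; move/eqP: m0; apply; lra.
rewrite (dist_gate lc ne) gf -fc fi.
have -> : gate c x - (gate c x + m) = - m by lra.
by rewrite normrN; lra.
Qed.

End Lines.

(** * Existence of axes of isometries of an R-tree *)

Section Axes.
Context (R : realType) (T : metricType R) (treeT : rtree T).
Implicit Types (x y z : T) (c : R -> T).
Local Notation d := (@mdist R T).

Section Isometry.
Context (f f' : T -> T) (fi : forall x y, d (f x) (f y) = d x y).
Context (fK : cancel f f') (f'K : cancel f' f).

Let iter_isom n x y : d (iter n f x) (iter n f y) = d x y.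
Proof. by elim: n => //= n IH; rewrite fi. Qed.

Let f'i x y : d (f' x) (f' y) = d x y.
Proof. by rewrite -fi !f'K. Qed.

Let power (k : int) : T -> T :=
  match k with Posz n => iter n f | Negz n => iter n.+1 f' end.

Let powerS k x : power (k + 1) x = f (power k x).
Proof.
case: k => [n|[|n]]; first by rewrite -PoszD addn1.
  by rewrite /= f'K.
have -> : Negz n.+1 + 1 = Negz n by rewrite !NegzE -(addn1 n.+1) PoszD opprD addrNK.
by rewrite /= f'K.
Qed.

Let power_isom k x y : d (power k x) (power k y) = d x y.
Proof.
case: k => [n|n]; first exact: iter_isom.
by rewrite /power; elim: n.+1 => // m IH; rewrite /= f'i.
Qed.

Let power_iter k (n : nat) x : power (k + n%:Z) x = power k (iter n f x).
Proof.
elim: n x => [x|n IH x]; first by rewrite addr0.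
rewrite -addn1 PoszD addrA powerS IH addn1 /=.
have comm y : f (power k y) = power k (f y).
  case: (k) => [m|m]; first by rewrite /power -iterS iterSr.
  by rewrite /power; elim: m.+1 => //= m' IHm; rewrite f'K -IHm fK.
exact: comm.
Qed.

(** Two consecutive distances are carried through the induction, so that the segments from [x] to
    its iterate n + 1 and from iterate n to iterate n + 2 overlap and can be concatenated. *)
Lemma dist_iter x n : 0 < d x (f x) -> d x (f (f x)) = 2 * d x (f x) ->
  d x (iter n f x) = n%:R * d x (f x).
Proof.
move=> m0 h.
suff H : d x (iter n f x) = n%:R * d x (f x) /\
    d x (iter n.+1 f x) = n.+1%:R * d x (f x) by case: H.
elim: n => [|n [IH1 IH2]]; first by rewrite /= mdistxx mul0r mul1r.
split=> //; have dn : d (iter n f x) (iter n.+1 f x) = d x (f x).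
  by rewrite iterSr iter_isom.
have dn1 : d (iter n.+1 f x) (iter n.+2 f x) = d x (f x).
  by rewrite [in RHS]/mdist; rewrite (iterSr n.+1) iter_isom.
rewrite (between_concat treeT (b := iter n f x) (c := iter n.+1 f x)).
- by rewrite IH1 dn dn1 -[in RHS]natr1 -[in RHS]natr1; lra.
- by rewrite /between IH1 IH2 dn -natr1; lra.
- by rewrite /between dn dn1 (iterSr n.+1) (iterSr n) iter_isom h; lra.
- by move=> e; move: m0; rewrite -dn e mdistxx ltxx.
Qed.

(** The hypothesis says that there is no backtracking at [f x], so the translates of the segment
    from [x] to [f x] fit together into a line. *)
Lemma axis_through x : 0 < d x (f x) -> d x (f (f x)) = 2 * d x (f x) ->
  exists c, [/\ line c, c 0 = x & forall t, f (c t) = c (t + d x (f x))].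
Proof.
move=> m0 h2; set m := d x (f x) in m0 h2 *.
have [s [s0 sm ss]] := segment_param treeT x (f x); rewrite -/m in sm ss.
pose fl (t : R) := Num.floor (t / m).
pose r t := t - (fl t)%:~R * m.
pose c t := power (fl t) (s (r t)).
have rP t : 0 <= r t <= m /\ r t < m.
  have := floor_itv (t / m); rewrite -/(fl t) => /andP[h3 h4].
  move: h3 h4; rewrite ler_pdivlMr // ltr_pdivrMr // intrD /r mulrDl mul1r.
  by move=> *; split; [apply/andP; split; lra|lra].
(* Distance from the initial segment to its n-th translate. For n > 0 the upper bound is the path
   through [f x] and iterate n of it, and the lower bound compares with the whole distance from [x]
   to the end of that translate. *)
have key n a b : 0 <= a <= m -> 0 <= b <= m -> a < m ->
    d (s a) (iter n f (s b)) = `|n%:R * m + b - a|.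
  case: n => [|n] ha hb am; first by rewrite /= ss // mul0r add0r distrC.
  have xa : d x (s a) = a.
    by rewrite -s0 ss ?lexx ?(ltW m0) // sub0r normrN ger0_norm //; case/andP: ha.
  have ax : d (s a) (f x) = m - a.
    by rewrite -sm ss ?lexx ?(ltW m0) // distrC ger0_norm // subr_ge0 ltW.
  have xb : d (iter n.+1 f x) (iter n.+1 f (s b)) = b.
    by rewrite iter_isom -s0 ss ?lexx ?(ltW m0) // sub0r normrN ger0_norm //; case/andP: hb.
  have bx : d (iter n.+1 f (s b)) (iter n.+2 f x) = m - b.
    rewrite (iterSr n.+1) iter_isom -sm ss ?lexx ?(ltW m0) // distrC.
    by rewrite ger0_norm // subr_ge0; case/andP: hb.
  have xx k := @dist_iter x k m0 h2; rewrite -/m in xx.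
  have fx : d (f x) (iter n.+1 f x) = n%:R * m by rewrite /= fi xx.
  have t1 := metric_triangle x (s a) (iter n.+2 f x).
  have t2 := metric_triangle (s a) (iter n.+1 f (s b)) (iter n.+2 f x).
  have t3 := metric_triangle (s a) (f x) (iter n.+1 f (s b)).
  have t4 := metric_triangle (f x) (iter n.+1 f x) (iter n.+1 f (s b)).
  move: t1 t2 t3 t4; rewrite xx xa ax xb bx fx.
  rewrite -[n.+2%:R]natr1 -[n.+1%:R]natr1 !mulrDl !mul1r.
  have nm : 0 <= n%:R * m by rewrite mulr_ge0 // ltW.
  move: (n%:R * m) nm (d (s a) (iter n.+1 f (s b))) => N N0 A.
  move: ha hb am (d (s a) _) (d (f x) _); clear -N0.
  by move=> /andP[? ?] /andP[? ?] ? B C ? ? ? ?; rewrite ger0_norm; lra.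
have wl u t : u <= t -> d (c u) (c t) = `|u - t|.
  move=> ut; have : fl u <= fl t.
    by apply: le_floor; rewrite ler_pM2r // invr_gt0.
  rewrite -subr_ge0; case E : (fl t - fl u) => [n|//] _.
  have ft : fl t = fl u + n%:Z by rewrite -E addrC subrK.
  have [ru ru'] := rP u; have [rt rt'] := rP t.
  rewrite /c ft power_iter power_isom key // /r ft intrD distrC.
  by congr Num.norm; lra.
exists c; split.
- move=> u t; case: (leP u t) => [/wl //|/ltW /wl h].
  by rewrite metric_sym h distrC.
- by rewrite /c /r /fl mul0r floor0 mul0r subr0 s0.
- move=> t; rewrite /c.
  have flS : fl (t + m) = fl t + 1.
    apply: floor_def; rewrite mulrDl divff ?gt_eqF //.
    by have /andP[] := floor_itv (t / m); rewrite -/(fl t) !intrD; lra.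
  rewrite flS powerS; congr (f (power _ (s _))).
  by rewrite /r flS intrD; lra.
Qed.

End Isometry.

(** For any [x0], the midpoint [x] of the segment from [x0] to [f x0] is either fixed or on the
    axis. *)
Lemma axis_ex (f f' : T -> T) (x0 : T) : (forall x y, d (f x) (f y) = d x y) ->
  cancel f f' -> cancel f' f -> (forall x, f x <> x) ->
  exists c m, [/\ line c, 0 < m & forall t, f (c t) = c (t + m)].
Proof.
move=> fi fK f'K nofix; pose D := d x0 (f x0).
have dD : d (f x0) (f (f x0)) = D by exact: fi.
have D0 : 0 < D by rewrite mdist_gt0; apply/eqP => /esym; exact: nofix.
have [x [x0x xf]] := treeT.2 x0 (f x0) (D / 2) ltac:(rewrite -/D; lra).
rewrite -/D in xf.
have bx : between x0 x (f x0) by rewrite /between -/D; lra.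
have [d1 d2] : d (f x0) (f x) = D / 2 /\ d (f x) (f (f x0)) = D / 2.
  by rewrite !fi; split=> //; lra.
have bfx : between (f x0) (f x) (f (f x0)) by rewrite /between dD; lra.
(* Here the segments from [f x0] to [x0] and to [f (f x0)] share at least their halves near [f x0],
   so [f] fixes the midpoint. *)
case: (leP (d x0 (f (f x0))) D) => hD.
  exfalso; apply: (nofix x); apply: (between_uniq treeT bfx).
    case: (treeT.1 _ _ (f (f x0)) _ bx); last first.
      by rewrite /between; clear -dD; dlra.
    rewrite /between => h; apply/eqP; rewrite eq_le metric_triangle andbT.
    by move: h hD x0x xf dD; clear; dlra.
  by move: d1 xf; clear; dlra.
have [m0 [b1 b2 b3]] := median_ex treeT x0 (f x0) (f (f x0)).
(* The length of the backtracking at [f x0]. It ends at [m0], before the midpoints are reached, so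
   the path through [x], [m0], [f x], [f m0] is geodesic. *)
pose k := (2 * D - d x0 (f (f x0))) / 2.
have kD : k < D / 2 by rewrite /k; lra.
have [k1 k2 k3] : [/\ d m0 (f x0) = k, d x0 m0 = D - k & d m0 (f (f x0)) = D - k].
  by move: b1 b2 b3; rewrite /between /k -/D dD; clear; split; dlra.
have xm0 : d x m0 = D / 2 - k.
  case: (treeT.1 _ _ m0 _ bx); rewrite /between; last first.
    by have := mdist_ge0 m0 x; clear -xf kD k1; dlra.
  by clear -x0x k2; dlra.
have m0f : d m0 (f x) = D / 2 - k.
  case: (treeT.1 _ _ m0 _ bfx); rewrite /between.
    by have := mdist_ge0 m0 (f x); clear -d1 kD k1; dlra.
  by clear -d2 k3; dlra.
have xfx : d x (f x) = D - 2 * k.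
  have := metric_triangle x m0 (f x); have := metric_triangle x0 x (f (f x0)).
  have := metric_triangle x (f x) (f (f x0)); have : d x0 (f (f x0)) = 2 * D - 2 * k.
    by rewrite /k; lra.
  by clear -xm0 m0f x0x d2; dlra.
have fxm : d (f x) (f m0) = D / 2 - k by rewrite fi.
have mfm : d m0 (f m0) = D - 2 * k.
  have := metric_triangle (f x0) m0 (f (f x0)); have := metric_triangle m0 (f m0) (f (f x0)).
  have : d (f m0) (f (f x0)) = k by rewrite fi.
  by have := metric_triangle m0 (f x) (f m0); clear -dD k1 m0f fxm; dlra.
have ffx : d (f m0) (f (f x)) = D / 2 - k by rewrite fi.
have c1 : d x (f m0) = 3 * (D / 2 - k).
  rewrite (between_concat treeT (b := m0) (c := f x)); [by lra| | |].
  - by rewrite /between; lra.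
  - by rewrite /between; lra.
  - by move=> e; move: m0f; rewrite e mdistxx; lra.
have c2 : d x (f (f x)) = 2 * d x (f x).
  rewrite (between_concat treeT (b := f x) (c := f m0)); [by lra| | |].
  - by rewrite /between; lra.
  - by rewrite /between !fi; lra.
  - by move=> e; move: fxm; rewrite e mdistxx; lra.
have xfx0 : 0 < d x (f x) by lra.
have [c [lc _ fc]] := axis_through fi fK f'K xfx0 c2.
by exists c, (d x (f x)).
Qed.

(** A translation seen on an arbitrarily short interval forces hyperbolicity: a point [b (- u)] of
    that interval with [u <= n] satisfies the hypotheses of [axis_through]. *)
Lemma axis_germ (f f' : T -> T) b (n e : R) :
  (forall x y, d (f x) (f y) = d x y) -> cancel f f' -> cancel f' f -> line b -> 0 < n -> 0 < e ->
  (forall t : R, - e <= t <= 0 -> f (b t) = b (t + n)) ->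
  exists c, [/\ line c, forall t, f (c t) = c (t + n)
    & forall t : R, - e <= t <= n -> c t = b t].
Proof.
move=> fi fK f'K lb n0 e0 fb; pose u := Num.min e n.
have [ue un] : u <= e /\ u <= n by rewrite /u !ge_min !lexx orbT.
have u0 : 0 < u by rewrite /u lt_min e0.
pose x := b (- u); have fx : f x = b (n - u).
  by rewrite /x fb ?(addrC n) //; apply/andP; split; lra.
have fb0 : f (b 0) = b n by rewrite fb ?add0r // lexx andbT; lra.
have xfx : d x (f x) = n by rewrite fx lb; abs_lra.
have ffx : d (f (b 0)) (f (f x)) = n - u by rewrite fi fx lb; abs_lra.
have c2 : d x (f (f x)) = 2 * d x (f x).
  rewrite (between_concat treeT (b := f x) (c := f (b 0))).
  - rewrite xfx ffx fi lb; abs_lra.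
  - by rewrite fx fb0; apply: between_line => //; apply/andP; split; lra.
  - by rewrite /between ffx !fi xfx lb; abs_lra.
  - by rewrite fx fb0 => /(line_inj lb); lra.
have x0 : 0 < d x (f x) by rewrite xfx.
have [c' [lc' c'0 fc']] := axis_through fi fK f'K x0 c2; rewrite xfx in fc'.
pose c t := c' (t + u).
have lc : line c by exact: line_shift.
have fc t : f (c t) = c (t + n) by rewrite /c fc' addrAC.
have cx : c (- u) = b (- u) by rewrite /c addNr.
have cfx : c (n - u) = b (n - u) by rewrite -fx /x -cx fc addrC.
have c0 : c 0 = b 0.
  by apply: (lines_agree treeT lc lb cx cfx); apply/andP; split; lra.
have cn : c n = b n by rewrite -fb0 -c0 fc add0r.
(* The far end [b (- e)] is displaced by exactly [n], so it has distance 0 to the axis. *)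
have [q ce] : exists q, b (- e) = c q.
  have h : d (b (- e)) (f (b (- e))) = n.
    by rewrite fb ?lexx ?oppr_le0 ?(ltW e0) // lb; abs_lra.
  exists (gate c (b (- e))); apply: mdist_positivity.
  move: h; rewrite (dist_translate treeT _ lc (lt0r_neq0 n0) fi fc).
  by rewrite gtr0_norm //; lra.
have qe : q = - e.
  have := lb (- e) 0; have := lb (- e) n; rewrite ce -c0 -cn !lc.
  by clear -n0 e0; abs_lra.
exists c; split=> // t ht; apply: (lines_agree treeT lc lb _ cn ht).
by rewrite ce qe.
Qed.

End Axes.

(** * Pairs of lines *)

Section TwoLines.
Context (R : realType) (T : metricType R) (treeT : rtree T).
Implicit Types (x y z w : T) (a b c : R -> T) (L : R).
Local Notation d := (@mdist R T).

(** Comparing equal parameters also encodes that the lines run in the same direction, with common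
    terminal point at 0. That this is the whole intersection of the ranges is [overlap_meet]. *)
Definition overlap a b L := forall t : R, a t = b t <-> - L <= t <= 0.

Lemma overlap_sym a b L : overlap a b L -> overlap b a L.
Proof. by move=> ov t; split=> [/esym/ov //|/ov]. Qed.

(** Reversal exchanges the two ends, so facts beyond 0 give facts below [- L]. *)
Lemma overlap_flip a b L : overlap a b L ->
  overlap (fun t => a (- (t + L))) (fun t => b (- (t + L))) L.
Proof.
move=> ov t; split=> [/ov/andP[? ?]|/andP[? ?]]; first by apply/andP; split; lra.
by apply/ov/andP; split; lra.
Qed.

Lemma line_flip c L : line c -> line (fun t => c (- (t + L))).
Proof. by move=> lc; apply: line_shift (line_opp lc). Qed.

(** Disagreement just beyond the ends suffices: lines that agree at two parameters agree between
    them. *)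
Lemma overlap_of a b L (u v : R) : line a -> line b -> 0 <= L -> 0 < u -> v < - L ->
  a 0 = b 0 -> a (- L) = b (- L) ->
  (forall t : R, 0 < t <= u -> a t <> b t) ->
  (forall t : R, v <= t < - L -> a t <> b t) -> overlap a b L.
Proof.
move=> la lb L0 u0 vL e0 eL hu hv t; split=> [abt|ht]; last first.
  exact: (lines_agree treeT la lb eL e0 ht).
apply/andP; split; rewrite leNgt; apply/negP => ht.
- apply: (hv (Num.max t v)); first by rewrite le_max lexx orbT gt_max ht vL.
  apply: (lines_agree treeT la lb abt eL).
  by rewrite le_max lexx /= ge_max (ltW ht) ltW.
- apply: (hu (Num.min t u)); first by rewrite lt_min ht u0 ge_min lexx orbT.
  apply: (lines_agree treeT la lb e0 abt).
  by rewrite ge_min lexx andbT le_min (ltW ht) ltW.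
Qed.

(** A foot of [a s] on [b] beyond 0 would be a common point of equal parameter; a foot below 0
    contradicts the distances to the two ends, which are distinct because [0 < L]. *)
Lemma overlap_dist_ge a b L s t : line a -> line b -> 0 < L -> overlap a b L ->
  0 <= s -> d (a s) (b t) = s + `|t|.
Proof.
move=> la lb L0 ov s0; have e0 : a 0 = b 0 by apply/ov; lra.
have eL : a (- L) = b (- L) by apply/ov; lra.
have h0 := gateP treeT (a s) 0 lb; have hL := gateP treeT (a s) (- L) lb.
have D0 := dist_gate_ge0 b (a s).
have gp := gateP treeT (a s) _ lb.
move: h0 hL D0 gp; rewrite -e0 -eL !la; set p := gate _ _; set D := d _ _.
move=> h0 hL D0 gp; have p0 : 0 <= p by move: h0 hL; clear -s0 L0 D0; abs_lra.
have Ds : D = s - p by move: h0; clear -p0 s0; abs_lra.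
suff p00 : p = 0 by rewrite gp Ds p00 !subr0.
apply/eqP; rewrite eq_le p0 andbT leNgt; apply/negP => pgt0.
have bt : between (a 0) (b p) (a s).
  rewrite /between e0 lb (metric_sym (b p)) -/D -e0 la Ds.
  by clear -p0 s0; abs_lra.
have := between_line_eq treeT la bt s0.
rewrite e0 lb add0r sub0r normrN ger0_norm // => /esym/ov.
by move: pgt0; clear; lra.
Qed.

Lemma overlap_dist_le a b L s t : line a -> line b -> 0 < L -> overlap a b L ->
  s <= - L -> d (a s) (b t) = - (s + L) + `|t + L|.
Proof.
move=> la lb L0 ov sL.
have := @overlap_dist_ge _ _ L (- (s + L)) (- (t + L)) (line_flip L la)
  (line_flip L lb) L0 (overlap_flip ov).
have hh u : - (- (u + L) + L) = u by lra.
by rewrite !hh normrN => -> //; lra.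
Qed.

(** The point [b 1] has gate 0 on [a], so the geodesic from [x] to it passes through [a 0]; this and
    the distance to [b (- L)] locate the foot on [b]. *)
Lemma overlap_gate_gt a b L x : line a -> line b -> 0 < L -> overlap a b L ->
  0 < gate a x -> gate b x = 0.
Proof.
move=> la lb L0 ov p0; have ovs := overlap_sym ov.
have e0 : a 0 = b 0 by apply/ov; lra.
have eL : a (- L) = b (- L) by apply/ov; lra.
have h u : d (b 1) (a u) = 1 + `|u|.
  by apply: overlap_dist_ge L0 ovs _ => //; lra.
have g1 : gate a (b 1) = 0.
  by apply: (@gate_uniq _ _ treeT _ _ _ (- 1) 1 la); rewrite ?h; first lra; abs_lra.
have ne : gate a x <> gate a (b 1) by rewrite g1; lra.
apply: (@gate_uniq _ _ treeT _ _ _ (- L) 1 lb); first by apply/andP; split; lra.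
  rewrite -e0 -eL (gateP treeT x 0 la) (gateP treeT x (- L) la).
  by move: p0; clear -L0; abs_lra.
rewrite (dist_gate treeT la ne) g1 -e0 (gateP treeT x 0 la) h.
by move: p0; clear; abs_lra.
Qed.

Lemma overlap_gate_lt a b L x : line a -> line b -> 0 < L -> overlap a b L ->
  gate a x < - L -> gate b x = - L.
Proof.
move=> la lb L0 ov pL.
have flip c : line c -> gate (fun t => c (- (t + L))) x = - (gate c x + L).
  move=> lc; apply: (@gate_uniq _ _ treeT _ _ _ (- (gate c x + L) - 1)
     (- (gate c x + L) + 1) (line_flip L lc)); first by apply/andP; split; lra.
  - rewrite [LHS](gateP treeT x _ lc) [X in _ = X + _](gateP treeT x _ lc).
    by move: (gate c x) => g; clear; abs_lra.
  - rewrite [LHS](gateP treeT x _ lc) [X in _ = X + _](gateP treeT x _ lc).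
    by move: (gate c x) => g; clear; abs_lra.
have := overlap_gate_gt (x := x) (line_flip L la) (line_flip L lb) L0 (overlap_flip ov).
by rewrite !flip // => h; have := h ltac:(lra); lra.
Qed.

(** The union of the lines has the shape of an H; the cases are the interior of the common bar and
    its two ends, beyond which [x] can follow only one line. *)
Lemma overlap_gates a b L x : line a -> line b -> 0 < L -> overlap a b L ->
  [\/ gate a x = gate b x /\ - L < gate a x < 0,
      [/\ 0 <= gate a x, 0 <= gate b x & gate a x = 0 \/ gate b x = 0]
    | [/\ gate a x <= - L, gate b x <= - L & gate a x = - L \/ gate b x = - L]].
Proof.
move=> la lb L0 ov; have ovs := overlap_sym ov.
have e0 : a 0 = b 0 by apply/ov; lra.
have eL : a (- L) = b (- L) by apply/ov; lra.
have h0 : d x (a 0) = d x (b 0) by rewrite e0.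
have hL : d x (a (- L)) = d x (b (- L)) by rewrite eL.
have a1 := @overlap_gate_gt _ _ _ x la lb L0 ov.
have a2 := @overlap_gate_lt _ _ _ x la lb L0 ov.
have b1 := @overlap_gate_gt _ _ _ x lb la L0 ovs.
have b2 := @overlap_gate_lt _ _ _ x lb la L0 ovs.
move: h0 hL; rewrite (gateP treeT x 0 la) (gateP treeT x (- L) la).
rewrite (gateP treeT x 0 lb) (gateP treeT x (- L) lb).
move: (gate a x) (gate b x) (d x _) (d x _) a1 a2 b1 b2 => p q D D' a1 a2 b1 b2.
case: (ltP 0 p) => p0.
  by move=> _ _; apply: Or32; rewrite (a1 p0) lexx (ltW p0); split=> //; right.
case: (ltP 0 q) => q0.
  by move=> _ _; apply: Or32; rewrite (b1 q0) lexx (ltW q0); split=> //; left.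
case: (ltP p (- L)) => pL.
  by move=> _ _; apply: Or33; rewrite (a2 pL) lexx (ltW pL); split=> //; right.
case: (ltP q (- L)) => qL.
  by move=> _ _; apply: Or33; rewrite (b2 qL) lexx (ltW qL); split=> //; left.
rewrite !sub0r !normrN (ler0_norm p0) (ler0_norm q0).
rewrite -!opprD !normrN !ger0_norm; [|lra|lra] => h0 hL.
have pq : p = q by lra.
rewrite -pq; move: p0; rewrite le_eqVlt => /orP[/eqP ->|p0].
  by apply: Or32; rewrite lexx; split=> //; left.
move: pL; rewrite le_eqVlt => /orP[/eqP <-|pL].
  by apply: Or33; rewrite lexx; split=> //; left.
by apply: Or31; rewrite pL p0.
Qed.

Lemma overlap_gate_line a b L s : line a -> line b -> 0 < L -> overlap a b L ->
  [\/ - L <= s <= 0 /\ gate a (b s) = s, 0 <= s /\ gate a (b s) = 0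
    | s <= - L /\ gate a (b s) = - L].
Proof.
move=> la lb L0 ov; have ovs := overlap_sym ov.
case: (ltP 0 s) => s0.
  apply: Or32; split; first exact: ltW.
  by apply: (overlap_gate_gt lb la L0 ovs); rewrite gate_line.
case: (ltP s (- L)) => sL.
  apply: Or33; split; first exact: ltW.
  by apply: (overlap_gate_lt lb la L0 ovs); rewrite gate_line.
by apply: Or31; rewrite ?sL ?s0; split=> //; rewrite -(ov s).2 ?sL ?s0 // gate_line.
Qed.

Lemma overlap_meet a b L s t : line a -> line b -> 0 < L -> overlap a b L ->
  a s = b t -> s = t /\ - L <= s <= 0.
Proof.
move=> la lb L0 ov st.
suff s_t : s = t by split=> //; apply/ov; rewrite st s_t.
have := @overlap_gates a b L (a s) la lb L0 ov.
have gb : gate b (a s) = t by rewrite st gate_line.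
rewrite (gate_line treeT s la) gb.
have e0 : a 0 = b 0 by apply/ov; lra.
have eL : a (- L) = b (- L) by apply/ov; lra.
case=> [[]//|[_ _ []]|[_ _ []]] h; move: st; rewrite h.
- by rewrite e0 => /(line_inj lb).
- by rewrite -e0 => /(line_inj la).
- by rewrite eL => /(line_inj lb).
- by rewrite -eL => /(line_inj la).
Qed.

(** If the foot on one line moved while the point runs along the other, [dist_gate] would make the
    segment between the feet common to both. [D = 0] covers lines that cross at a point. *)
Lemma bridge_ex a b : line a -> line b ->
  (forall x y, [set z | between x z y] `<=` range a `&` range b -> x = y) ->
  exists s0 t0 D, 0 <= D /\ forall s t, d (a s) (b t) = `|s - s0| + D + `|t - t0|.
Proof.
move=> la lb noseg.
have const c e : line c -> line e ->
    (forall x y, [set z | between x z y] `<=` range c `&` range e -> x = y) ->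
    forall s s', gate e (c s) = gate e (c s').
  move=> lc le nosg.
  have wl s s' : s <= s' -> gate e (c s) = gate e (c s').
    move=> ss; have [//|ne] := pselect (gate e (c s) = gate e (c s')).
    apply: (line_inj le); apply: nosg => z; rewrite /= /between le => zs.
    set p := gate e (c s) in ne zs *; set q := gate e (c s') in ne zs *.
    have ds := dist_gate treeT le ne; rewrite -/p -/q in ds.
    have pq : between (e p) z (e q) by rewrite /between le.
    split; last first.
      case: (leP p q) => h; first by exists (p + d (e p) z) => //; rewrite -(between_line_eq treeT le pq h).
      exists (q + d (e q) z) => //.
      by rewrite -(between_line_eq treeT le (between_sym pq) (ltW h)).
    have bz : between (c s) z (c s').
      rewrite /between ds; have := metric_triangle (c s) (e p) z.
      have := metric_triangle z (e q) (c s'); have := metric_triangle (c s) z (c s').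
      by rewrite ds (metric_sym (e q)); move: zs; clear; lra.
    by exists (s + d (c s) z) => //; rewrite -(between_line_eq treeT lc bz ss).
  by move=> s s'; case: (leP s s') => [/wl|/ltW /wl].
have gb := const a b la lb noseg.
have ga : forall s s', gate a (b s) = gate a (b s').
  by apply: const => // x y; rewrite setIC; exact: noseg.
pose t0 := gate b (a 0); pose s0 := gate a (b 0).
exists s0, t0, (d (a s0) (b t0)); split; first exact: mdist_ge0.
move=> s t; rewrite (gateP treeT (a s) t lb) (gb s 0) -/t0.
rewrite (metric_sym (a s)) (gateP treeT (b t0) s la) (ga t0 0) -/s0.
by rewrite (metric_sym (b t0)); lra.
Qed.

(** The form of the ping-pong condition shared by overlapping axes, where both intervals are the
    overlap, and disjoint ones, where both shrink to the feet of the bridge. *)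
Definition separated a b (a0 a1 b0 b1 : R) := forall x,
  ~~ (a0 <= gate a x <= a1) -> b0 <= gate b x <= b1.

Lemma separated_overlap a b L : line a -> line b -> 0 < L -> overlap a b L ->
  separated a b (- L) 0 (- L) 0.
Proof.
move=> la lb L0 ov x; have := overlap_gates x la lb L0 ov.
move: (gate a x) (gate b x) => p q; clear -L0; rewrite negb_and -!ltNge.
by move=> [[? /andP[? ?]]|[? ? [?|?]]|[? ? [?|?]]] /orP[?|?]; apply/andP; split; lra.
Qed.

Lemma separated_bridge a b s0 t0 D : line a -> line b ->
  (forall s t, d (a s) (b t) = `|s - s0| + D + `|t - t0|) ->
  separated a b s0 s0 t0 t0.
Proof.
move=> la lb h x.
have ga t : gate a (b t) = s0.
  by apply: (@gate_uniq _ _ treeT _ _ _ (s0 - 1) (s0 + 1) la); rewrite ?(metric_sym (b t)) ?h;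
    [apply/andP; split; lra|abs_lra|abs_lra].
move=> gx; have ne t : gate a x <> gate a (b t).
  by rewrite ga => e; move: gx; rewrite e lexx.
suff -> : gate b x = t0 by rewrite lexx.
apply: (@gate_uniq _ _ treeT _ _ _ (t0 - 1) (t0 + 1) lb); first by apply/andP; split; lra.
- rewrite (dist_gate treeT la (ne _)) [in RHS](dist_gate treeT la (ne _)) !ga.
  by rewrite !(metric_sym (b _)) !h; move: (d x _) => E; clear; abs_lra.
- rewrite (dist_gate treeT la (ne _)) [in RHS](dist_gate treeT la (ne _)) !ga.
  by rewrite !(metric_sym (b _)) !h; move: (d x _) => E; clear; abs_lra.
Qed.

End TwoLines.

(** * The quotient of two translations with overlapping axes *)

Section Reduction.
Context (R : realType) (T : metricType R) (treeT : rtree T).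
Implicit Types (x y z w : T) (L D : R).
Local Notation d := (@mdist R T).
Context (f f' h : T -> T) (a b : R -> T) (m n L : R).
Context (fi : forall x y, d (f x) (f y) = d x y) (fK : cancel f f')
  (f'K : cancel f' f) (hi : forall x y, d (h x) (h y) = d x y)
  (la : line a) (lb : line b) (fa : forall t, f (a (t + m)) = h (a t))
  (hb : forall t, h (b t) = b (t + n)) (m0 : 0 < m)
  (ov : overlap a b L).

(** On the last part of the overlap, of length [L - m], the map [f] goes back by [m] along [a],
    still inside the overlap, and forward by [n] along [b]. This germ of a translation is extended
    by [axis_germ]. *)
Lemma reduce_hyperbolic : m < L -> m < n ->
  exists c, [/\ line c, forall t, f (c t) = c (t + (n - m)) & overlap a c (L - m)].
Proof.
have m_gt0 := m0; move=> mL mn.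
have fb t : - (L - m) <= t <= 0 -> f (b t) = b (t + (n - m)).
  move=> /andP[? ?]; have <- : a t = b t by apply/ov; apply/andP; split; lra.
  rewrite -{1}(subrK m t) fa; have -> : a (t - m) = b (t - m).
    by apply/ov; apply/andP; split; lra.
  by rewrite hb; congr b; lra.
have nm0 : 0 < n - m by lra.
have Lm0 : 0 < L - m by lra.
have [c [lc fc cb]] := axis_germ treeT fi fK f'K lb nm0 Lm0 fb.
exists c; split=> //.
have v_lt : - (L - m) - (n - m) < - (L - m) by lra.
refine (overlap_of treeT la lc (ltW Lm0) nm0 v_lt _ _ _ _).
- by rewrite cb; [apply/ov|]; apply/andP; split; lra.
- by rewrite cb; [apply/ov|]; apply/andP; split; lra.
- move=> t /andP[t0 tu]; rewrite cb; last by apply/andP; split; lra.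
  by move/ov; lra.
(* Pulled back by [h], such an agreement would be one of [a] and [b] below [- L]. The window has
   length [n - m] so that [t + (n - m)] falls where [c] is known to equal [b]. *)
- move=> t /andP[tv tL] act.
  have : a (t - m) = b (t - m); last by move/ov; lra.
  apply: mdist_positivity; rewrite -hi -fa subrK act fc hb cb; last first.
    by apply/andP; split; lra.
  by rewrite (_ : t + (n - m) = t - m + n) ?mdistxx //; lra.
Qed.

(** If [a t] is fixed, [h] carries [a (t - m)] to [a t], so their gates on [b] differ by [m], the
    full distance of the two points; this leaves them no room outside the overlap. *)
Lemma reduce_elliptic : m < L -> n = m ->
  forall t, f (a t) = a t <-> - (L - m) <= t <= 0.
Proof.
have m_gt0 := m0; move=> mL nm t; have L0 : 0 < L by lra.
rewrite -{1}(subrK m t) fa; split=> [e|/andP[? ?]]; last first.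
  have -> : a (t - m) = b (t - m) by apply/ov; apply/andP; split; lra.
  by rewrite hb nm subrK; apply/esym/ov; apply/andP; split; lra.
have g : gate b (a t) = gate b (a (t - m)) + n.
  by rewrite -(gate_translate treeT _ lb hi hb) e.
have := overlap_gates treeT (a (t - m)) la lb L0 ov.
have := overlap_gates treeT (a t) la lb L0 ov.
rewrite g nm !(gate_line treeT _ la).
move: (gate b _) => q h1 h2.
case: h1 => [[? /andP[? ?]]|[? ? [?|?]]|[? ? [?|?]]];
case: h2 => [[? /andP[? ?]]|[? ? [?|?]]|[? ? [?|?]]]; apply/andP; split; lra.
Qed.

(** Otherwise [h] would carry [a 1] to [a (1 + m)]; both have gate 0 on [b], whereas [h] shifts
    gates by [n]. *)
Lemma quotient_nontrivial : 0 < L -> 0 < n -> exists x, f x <> x.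
Proof.
move=> L0 n0; apply: contrapT => /forallNP nf; have m_gt0 := m0.
have e : h (a 1) = a (1 + m) by rewrite -fa; apply: contrapT; exact: nf.
have := gate_translate treeT (a 1) lb hi hb; rewrite e.
rewrite !(overlap_gate_gt treeT la lb L0 ov) ?(gate_line treeT _ la) //; first lra.
by lra.
Qed.

End Reduction.

(** * Axes that overlap along exactly one period *)

Section Fork.
Context (R : realType) (T : metricType R) (treeT : rtree T).
Implicit Types (x y z w : T) (L D : R).
Local Notation d := (@mdist R T).

(** For a parameter [N] where the rays differ, [D] is the distance from their origin to the median
    of the origin, [b N] and [c N]. *)
Lemma fork b c : line b -> line c -> b 0 = c 0 ->
  (forall t : R, 0 <= t -> b t = c t) \/
  exists D : R, [/\ 0 <= D, forall t, 0 <= t <= D -> b t = c t &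
    forall s t, D <= s -> D <= t -> d (b s) (c t) = s + t - 2 * D].
Proof.
move=> lb lc e0; have [|] := pselect (forall t : R, 0 <= t -> b t = c t); first by left.
move=> /existsNP[N /not_implyP[N0 ne]]; right.
have dN : 0 < d (b N) (c N) by rewrite mdist_gt0; apply/eqP.
have b0N : d (b 0) (b N) = N by rewrite lb; abs_lra.
have c0N : d (b 0) (c N) = N by rewrite e0 lc; abs_lra.
have [m [m1 m2 m3]] := median_ex treeT (b 0) (b N) (c N).
pose D := d (b 0) m; have D0 : 0 <= D by exact: mdist_ge0.
have DN : D < N by move: m1 m2 m3; rewrite /between -/D b0N c0N; clear -dN; dlra.
have dD : d (b N) (c N) = 2 * N - 2 * D.
  by move: m1 m2 m3; rewrite /between -/D b0N c0N; clear; dlra.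
have bD : b D = m by rewrite [RHS](between_line_eq treeT lb m1) // add0r.
have cD : c D = m.
  by rewrite e0 in m3; rewrite [RHS](between_line_eq treeT lc m3) // -e0 add0r.
exists D; split=> //.
  move=> t ht; apply: (lines_agree treeT lb lc e0 _ ht); by rewrite bD cD.
have bDm s : D <= s -> d (b s) m = s - D by move=> ?; rewrite -bD lb; abs_lra.
have cDm s : D <= s -> d (c s) m = s - D by move=> ?; rewrite -cD lc; abs_lra.
(* Up to [N] triangle inequalities suffice; beyond [N], first for one ray and then for both,
   geodesics through the median are prolonged by concatenation. *)
have short s t : D <= s -> D <= t -> s <= N -> t <= N ->
    d (b s) (c t) = s + t - 2 * D.
  move=> Ds Dt sN tN; have := metric_triangle (b s) m (c t).
  have := metric_triangle (b N) (b s) (c N); have := metric_triangle (b s) (c t) (c N).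
  have : d (b N) (b s) = N - s by rewrite lb; abs_lra.
  have : d (c t) (c N) = N - t by rewrite lc; abs_lra.
  have := bDm s Ds; have := cDm t Dt; move: dD; clear; dlra.
have mid s t : D <= s -> D <= t -> s <= N -> d (b s) (c t) = s + t - 2 * D.
  move=> Ds Dt sN; case: (leP t N) => tN; first exact: short.
  have := short s N Ds ltac:(lra) sN ltac:(lra).
  have := cDm N ltac:(lra); have := bDm s Ds => h1 h2 h3.
  have mcN : d m (c N) = N - D by rewrite metric_sym.
  have cNt : d (c N) (c t) = t - N by rewrite lc; abs_lra.
  have mct : d m (c t) = t - D by rewrite metric_sym cDm.
  rewrite (between_concat treeT (b := m) (c := c N)).
  - by rewrite h1 mcN cNt; lra.
  - by rewrite /between h1 h3 mcN; lra.
  - by rewrite /between mcN cNt mct; lra.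
  - by move=> e; move: mcN; rewrite e mdistxx; lra.
move=> s t Ds Dt; case: (leP s N) => sN; first exact: mid.
have := mid N t ltac:(lra) Dt ltac:(lra) => h3.
have h1 := bDm N ltac:(lra).
have mct : d m (c t) = t - D by rewrite metric_sym cDm.
have bsN : d (b s) (b N) = s - N by rewrite lb; abs_lra.
have bsm := bDm s Ds.
rewrite (between_concat treeT (b := b N) (c := m)).
- by rewrite bsN h1 mct; lra.
- by rewrite /between bsN h1 bsm; lra.
- by rewrite /between h1 mct h3; lra.
- by move=> e; move: h1; rewrite e mdistxx; lra.
Qed.

(* [f] is [h g^-1], for translations [g] and [h] whose axes overlap along exactly
   one period of [g]. *)
Lemma quotient_fixed (f g h : T -> T) (a b : R -> T) (m n : R) x :
  (forall x y, d (g x) (g y) = d x y) -> (forall x y, d (h x) (h y) = d x y) ->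
  line a -> line b -> (forall t, g (a t) = a (t + m)) ->
  (forall t, h (b t) = b (t + n)) -> (forall x, f (g x) = h x) ->
  (exists y, g y = x) -> 0 < m -> m <= n -> overlap a b m -> f x = x ->
  gate a x = 0.
Proof.
move=> gi hi la lb ga hb fg [y yx] m0 mn ov fx.
have hy : h y = x by rewrite -fg yx.
have g1 := gate_translate treeT y la gi ga; rewrite yx in g1.
have g2 := gate_translate treeT y lb hi hb; rewrite hy in g2.
have := overlap_gates treeT x la lb m0 ov.
have := overlap_gates treeT y la lb m0 ov.
rewrite g1 g2; move: (gate a y) (gate b y) => p q; clear -m0 mn => h1 h2.
case: h1 => [[? /andP[? ?]]|[? ? [?|?]]|[? ? [?|?]]];
by case: h2 => [[? /andP[? ?]]|[? ? [?|?]]|[? ? [?|?]]]; lra.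
Qed.

Section LastStep.
Context (f f' g g' h : T -> T) (a b : R -> T) (m n : R).
Context (fi : forall x y, d (f x) (f y) = d x y) (fK : cancel f f')
  (f'K : cancel f' f) (gi : forall x y, d (g x) (g y) = d x y)
  (g'K : cancel g' g)
  (hi : forall x y, d (h x) (h y) = d x y)
  (la : line a) (lb : line b) (ga : forall t, g (a t) = a (t + m))
  (hb : forall t, h (b t) = b (t + n)) (fg : forall x, f (g x) = h x)
  (m0 : 0 < m) (mn : m <= n) (ov : overlap a b m).

(** The translate by [g] of the axis of [h]. Since [g] carries the point where [b] enters [a] to the
    point where it leaves, the shift by [m] makes [c] enter [a 0] from outside just where [b]
    departs. By [fc], [f] carries [c] back to [b]. *)
Let c (t : R) := g (b (t - m)).

Let lc : line c.
Proof. by move=> s t; rewrite gi lb; congr Num.norm; lra. Qed.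

Let c0 : c 0 = a 0.
Proof.
have := m0; rewrite /c sub0r => m_gt0; have <- : a (- m) = b (- m) by apply/ov; lra.
by rewrite ga addNr.
Qed.

Let b0 : b 0 = a 0.
Proof. by have := m0; move=> ?; apply/esym/ov; lra. Qed.

Let fc t : f (c t) = b (t + (n - m)).
Proof. by rewrite /c fg hb; congr b; lra. Qed.

Let distab s t : 0 <= t -> d (a s) (b t) = `|s| + t.
Proof.
move=> t0; rewrite metric_sym addrC.
exact: (overlap_dist_ge treeT _ lb la m0 (overlap_sym ov) t0).
Qed.

Let distac s t : t <= 0 -> d (a s) (c t) = `|s| - t.
Proof.
move=> t0; rewrite -[s in LHS](subrK m) -ga gi metric_sym.
rewrite (overlap_dist_le treeT _ lb la m0 (overlap_sym ov)); last lra.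
by rewrite !subrK addrC.
Qed.

(** Gates on [a] show that a common point lies on the departing ray of [b] and on the arriving ray
    of [c]; its distance to [a 0] makes the two parameters opposite. *)
Lemma axes_quotient_meet x : (range b `&` (g @` range b)) x <->
  exists2 t, 0 <= t & x = b t /\ x = c (- t).
Proof.
split=> [[[s _ <-] [_ [u _ <-] e]]|[t t0 [xb xc]]]; last first.
  split; first by exists t.
  by exists (b (- t - m)) => //; exists (- t - m).
have m_gt0 := m0.
have g1 := gate_translate treeT (b u) la gi ga; rewrite e in g1.
have h2 := overlap_gate_line treeT u la lb m0 ov.
have h1 := overlap_gate_line treeT s la lb m0 ov.
have [s0 u0] : 0 <= s /\ u + m <= 0.
  move: h1 h2; rewrite g1; move: (gate a _) => q h1 h2.
  by case: h1 => [[/andP[? ?] ?]|[? ?]|[? ?]]; case: h2 => [[/andP[? ?] ?]|[? ?]|[? ?]]; split; lra.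
have ec : b s = c (u + m) by rewrite /c addrK.
have := distab 0 s0; rewrite ec distac // => us.
have su : s = - (u + m) by move: us; rewrite normr0; lra.
by exists s => //; split=> //; congr c; lra.
Qed.

Let lc' : line (fun t => c (- t)).
Proof. exact: line_opp. Qed.

(** The fixed point is the midpoint between [a 0] and its image [b (n - m)]; any other fixed point
    is equidistant from these two and has gate 0 on [a]. The last clause matters when [n = m], where
    the fixed set touches the axis. *)
Lemma last_step_elliptic : b ((n - m) / 2) = c (- ((n - m) / 2)) ->
  exists y, [/\ f y = y, d (a 0) y = (n - m) / 2 &
    forall s z, f z = z -> (n - m) / 2 + `|s| <= d (a s) z /\ (a s = z -> s = 0)].
Proof.
move=> e; have m_gt0 := m0; have m_n := mn.
exists (b ((n - m) / 2)); split.
- by rewrite {1}e fc; congr b; lra.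
- by rewrite distab ?normr0 ?add0r //; lra.
move=> s z fz; have gz : gate a z = 0.
  by apply: (quotient_fixed gi hi la lb ga hb fg _ m0 mn ov fz); exists (g' z).
have hz u : d (a u) z = d (a 0) z + `|u|.
  by rewrite metric_sym (gateP treeT z u la) gz subr0 metric_sym.
split; last first.
  by move=> az; rewrite -gz -az gate_line.
rewrite hz lerD2r.
have : d z (b (n - m)) = d z (a 0) by rewrite -[n - m]add0r -fc c0 -{1}fz fi.
have : d (a 0) (b (n - m)) = n - m by rewrite distab ?normr0 ?add0r //; lra.
by have := metric_triangle (a 0) z (b (n - m)); dlra.
Qed.

(** The point [x] where the rays part has image [b (n - m - D)] and preimage [y] on [c]. They lie on
    different branches at [x], so [y], [x], [f x] span two periods of the axis. *)
Lemma last_step_hyperbolic D : 0 <= D -> D < (n - m) / 2 ->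
  (forall t, 0 <= t <= D -> b t = c (- t)) ->
  (forall s t, D <= s -> D <= t -> d (b s) (c (- t)) = s + t - 2 * D) ->
  exists e, [/\ line e, forall t, f (e t) = e (t + (n - m - 2 * D))
    & forall s t, d (a s) (e t) = `|s| + D + `|t|].
Proof.
move=> D0 Dh e far; have m_gt0 := m0; set v := n - m - 2 * D.
have v0 : 0 < v by rewrite /v; lra.
pose x := b D; have xc : x = c (- D) by rewrite /x e // D0 lexx.
have fx : f x = b (n - m - D) by rewrite xc fc; congr b; lra.
pose y := c (- (n - m - D)).
have fy : f y = x by rewrite fc /x; congr b; lra.
have xfx : d x (f x) = v by rewrite fx /x lb /v; abs_lra.
have yx : d y (f y) = v by rewrite -(fi y) fy.
have ffx : d y (f (f y)) = 2 * v.
  by rewrite fy fx metric_sym far /v; lra.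
have v0' : 0 < d y (f y) by rewrite yx.
rewrite -yx in ffx.
have [k [lk ky fk]] := axis_through treeT fi fK f'K v0' ffx.
rewrite yx in fk.
have k1 : k v = b D by rewrite -[v]add0r -fk ky fy.
have k2 : k (2 * v) = b (n - m - D).
  by rewrite -fx /x -k1 fk; congr k; lra.
exists (fun t => k (t + v)); split; first exact: line_shift.
  by move=> t; rewrite fk addrAC.
move=> s t.
have as1 : d (a s) (k v) = `|s| + D by rewrite k1 distab.
have as0 : d (a s) (k 0) = `|s| + D + v.
  by rewrite ky distac /v; lra.
have as2 : d (a s) (k (2 * v)) = `|s| + D + v.
  by rewrite k2 distab /v; lra.
have gk : gate k (a s) = v.
  apply: (@gate_uniq _ _ treeT _ _ _ 0 (2 * v) lk); [lra| |].
  - by rewrite as0 as1; lra.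
  - by rewrite as2 as1; lra.
by rewrite (gateP treeT (a s) (t + v) lk) gk as1 addrK.
Qed.

End LastStep.
End Fork.

(** * Generation, freeness and ping-pong *)

Section Generated.
Context (G : groupType).
Implicit Types (A B : set G) (x y a b : G).

Lemma generated_subgroup B : is_subgroup (generated B).
Proof.
split; first by move=> H [[h _] _].
- by move=> x y hx hy H HB; case: (HB) => [[_ h _] _]; apply: h; [exact: hx|exact: hy].
- by move=> x hx H HB; case: (HB) => [[_ _ h] _]; apply: h; exact: hx.
Qed.

Lemma generated_incl B : B `<=` generated B.
Proof. exact: sub_gen_smallest. Qed.

Lemma generated_le A B : A `<=` generated B -> generated A `<=` generated B.
Proof. by move=> AB; apply: smallest_sub => //; exact: generated_subgroup. Qed.

Lemma generated_swap a b : generated [set a; b] = generated [set b; a].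
Proof. by rewrite setUC. Qed.

Lemma generated_mulV a b (n : nat) :
  generated [set a; (b * a ^- n)%g] = generated [set a; b].
Proof.
have pow (H : set G) x : is_subgroup H -> H x -> forall k : nat, H (x ^+ k)%g.
  move=> [h1 hm _] hx; elim=> [|k IH]; first by rewrite expg0.
  by rewrite expgS; apply: hm.
have [h1 hm hv] := generated_subgroup [set a; b].
have [k1 km kv] := generated_subgroup [set a; (b * a ^- n)%g].
have ha : generated [set a; b] a by apply: generated_incl; left.
have hb : generated [set a; b] b by apply: generated_incl; right.
have ka : generated [set a; (b * a ^- n)%g] a by apply: generated_incl; left.
have kb : generated [set a; (b * a ^- n)%g] (b * a ^- n)%g by apply: generated_incl; right.
apply/seteqP; split; apply: generated_le => x [->//|->].
- by apply: hm => //; apply: hv; apply: pow ha _; exact: generated_subgroup.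
- rewrite -[X in generated _ X](mulgVK (a ^+ n)%g); apply: km => //.
  by apply: pow ka _; exact: generated_subgroup.
Qed.

End Generated.

Section Words.
Context (G : groupType).
Implicit Types (B : set G) (w u v : seq (G * bool)) (l : G * bool).

Definition letter l : G := if l.2 then l.1 else (l.1^-1)%g.
Definition compat (l l' : G * bool) : bool := (l.1 == l'.1) ==> (l.2 == l'.2).

Lemma eval_cons l w : eval_word (l :: w) = (letter l * eval_word w)%g.
Proof. by []. Qed.

Lemma eval_cat u v : eval_word (u ++ v) = (eval_word u * eval_word v)%g.
Proof. by elim: u => [|l u IH]; rewrite ?mul1g // cat_cons !eval_cons IH mulgA. Qed.

Lemma letter_cancel l l' : ~~ compat l l' -> (letter l * letter l' = 1)%g.
Proof.
case: l l' => x s [y t]; rewrite /compat negb_imply /= => /andP[/eqP -> st].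
by move: st; rewrite /letter /=; case: s; case: t => //= _; rewrite ?mulgV ?mulVg.
Qed.

Lemma generated_word B x : generated B x ->
  exists w, (forall l, l \in w -> B l.1) /\ eval_word w = x.
Proof.
apply: (smallest_sub (X := [set x | exists w, (forall l, l \in w -> B l.1) /\ eval_word w = x])).
  split; first by exists [::].
  - move=> _ _ [u [hu <-]] [v [hv <-]]; exists (u ++ v); rewrite eval_cat; split=> //.
    by move=> l; rewrite mem_cat => /orP[/hu|/hv].
  - move=> _ [u [hu <-]]; elim: u hu => [|l u IH] hu.
      by exists [::]; rewrite /= invg1.
    have [|v [hv ev]] := IH; first by move=> k ku; apply: hu; rewrite inE ku orbT.
    exists (v ++ [:: (l.1, ~~ l.2)]); split.
      move=> k; rewrite mem_cat inE => /orP[/hv //|/eqP ->].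
      by apply: (hu l); rewrite inE eqxx.
    rewrite eval_cat ev !eval_cons mulg1 invgM; congr (_ * _)%g.
    by rewrite /letter /=; case: l.2; rewrite ?invgK.
move=> b Bb; exists [:: (b, true)]; split; last by rewrite eval_cons mulg1.
by move=> l; rewrite inE => /eqP ->.
Qed.

Lemma not_path_split l w : ~~ path compat l w ->
  exists u v a b, l :: w = u ++ a :: b :: v /\ ~~ compat a b.
Proof.
elim: w l => [//|b w IH] l /=; rewrite negb_and => /orP[h|/IH].
  by exists [::], w, l, b.
by move=> [u [v [a [c [-> h]]]]]; exists (l :: u), v, a, c.
Qed.

(* A word of minimal length among those whose value is conjugate to [x] is
   cyclically reduced, so that its powers are reduced. *)
Lemma free_torsion B (H : set G) x (n : nat) : free_basis B H -> H x ->
  (0 < n)%N -> (x ^+ n = 1)%g -> x = 1%g.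
Proof.
move=> [<- red] /generated_word[w0 [Bw0 ew0]] n0 xn; apply/eqP; apply: contraT => x1.
pose P (k : nat) := `[< exists w y, [/\ forall l, l \in w -> B l.1,
   eval_word w = (y * x * y^-1)%g & size w = k] >].
have exP : exists k, P k.
  by exists (size w0); apply/asboolP; exists w0, 1%g; rewrite invg1 mulg1 mul1g.
case: (ex_minnP exP) => k /asboolP[w [y [Bw ew sw]]] kmin.
have shorter w' y' : (forall l, l \in w' -> B l.1) ->
    eval_word w' = (y' * x * y'^-1)%g -> (size w <= size w')%N.
  by move=> h1 h2; rewrite sw; apply: kmin; apply/asboolP; exists w', y'.
have cyc : cycle compat w.
  case: w Bw ew sw shorter => // l w Bw ew sw shorter.
  rewrite /cycle; apply: contraT => /not_path_split[u [v [a [b [e ab]]]]].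
  move: e; rewrite -rcons_cons; case/lastP: v => [|v c].
    (* With [v] empty the cancelling pair straddles the ends of the cyclic word; conjugation by the
       letter [a] removes both letters. *)
    rewrite -[a :: _]/([:: a] ++ [:: b]) catA cats1 => /rcons_inj[e lb].
    move: Bw ew shorter; subst b; case: u e => [[la _]|l' u [_ ->]].
      by move: ab; rewrite la /compat !eqxx.
    move=> Bw ew shorter.
    have := @shorter u (letter a * y)%g; rewrite /= size_cat addn1 ltnNge.
    rewrite leqW //; apply.
      by move=> k' ku; apply: Bw; rewrite inE mem_cat ku orbT.
    move: ew; rewrite eval_cons eval_cat eval_cons mulg1 => ew.
    rewrite invgM.
    have la := letter_cancel ab.
    have al : (letter l = (letter a)^-1)%g by rewrite -[LHS](mulKg (letter a)) la mulg1.
    have -> : (letter a * y * x * (y^-1 * (letter a)^-1))%g =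
      (letter a * (y * x * y^-1) * (letter a)^-1)%g by rewrite !mulgA.
    by rewrite -ew al !mulgA mulgV mul1g mulgK.
  rewrite -!rcons_cons -rcons_cat => /rcons_inj[e _].
  move: Bw ew shorter; rewrite e => Bw ew shorter.
  have := @shorter (u ++ v) y; rewrite !size_cat /= !addnS ltnNge.
  rewrite leqW //; apply.
    by move=> k' kuv; apply: Bw; rewrite !(mem_cat, inE) in kuv *; case/orP: kuv => ->; rewrite ?orbT.
  by rewrite -ew !eval_cat !eval_cons [(letter a * _)%g]mulgA letter_cancel // mul1g.
have wn : w <> [::].
  move=> e; move: ew x1; rewrite e /= => ew /eqP; apply.
  by rewrite -[x](mulKg y) -[(y * x)%g](mulgK y^-1%g) -ew invgK mul1g mulVg.
pose ww := flatten (nseq n w).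
have eww : eval_word ww = 1%g.
  have -> : eval_word ww = (y * x ^+ n * y^-1)%g.
    rewrite /ww; elim: (n) => [|j IH]; first by rewrite /= expg0 mulg1 mulgV.
    by rewrite /= eval_cat IH ew expgS !mulgA mulgVK.
  by rewrite xn mulg1 mulgV.
case: (red ww _ _ _ eww).
- by rewrite /ww; case: (n) n0 => // j _ /=; case: (w) wn.
- move=> l /flattenP[w' /nseqP[-> _]]; exact: Bw.
rewrite /reduced_word /ww -/compat; case: w cyc wn {Bw ew sw shorter ww eww} => // l w cyc _.
move: cyc; rewrite /cycle rcons_path => /andP[p1 p2].
suff h k' : path compat (last l w) (flatten (nseq k' (l :: w))).
  by case: (n) => //= j; rewrite cat_path p1 h.
by elim: k' => //= j IH; rewrite p2 cat_path p1.
Qed.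

Lemma not_free_torsion (H : set G) x (n : nat) : H x -> x <> 1%g -> (0 < n)%N ->
  (x ^+ n = 1)%g -> ~ is_free H.
Proof. by move=> Hx x1 n0 xn [B fB]; apply: x1; exact: free_torsion fB Hx n0 xn. Qed.

End Words.

(** A reduced word sends the base point into the set attached to its first letter, hence away from
    the base point. Single letters already show that the two generators differ, which gives rank
    two. *)
Lemma ping_pong (G : groupType) (T : Type) (act : G -> T -> T)
    (act1 : forall x, act 1%g x = x)
    (actM : forall a b x, act (a * b)%g x = act a (act b x))
    (g : bool -> G) (U : bool -> bool -> set T) (x0 : T) :
  (forall i s j t x, U i s x -> U j t x -> i = j /\ s = t) ->
  (forall i s, ~ U i s x0) ->
  (forall i x, ~ U i false x -> U i true (act (g i) x)) ->
  (forall i x, ~ U i true x -> U i false (act (g i)^-1%g x)) ->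
  free_of_rank 2 (generated [set g true; g false]).
Proof.
move=> dis base pos neg.
have gx i : U i true (act (g i) x0) by apply: pos; exact: base.
have g_inj i j : g i = g j -> i = j.
  by move=> e; have := gx i; rewrite {1}e => /dis /(_ (gx j)) [].
have push i s x : ~ U i (~~ s) x -> U i s (act (letter (g i, s)) x).
  by case: s => /=; [exact: pos|exact: neg].
exists [set g true; g false]; split; last first.
  apply/eq_cardSP; exists (g true); first by left.
  rewrite (_ : _ `\` _ = [set g false]) ?card_set1 //.
  apply/seteqP; split=> [y [[->|->//]] /(_ erefl)//|_ ->].
  by split; [right|move=> /g_inj].
split=> // w wn hw rw ew.
suff : exists i s w', [/\ w = (g i, s) :: w' & U i s (act (eval_word w) x0)].
  by move=> [i [s [w' [_]]]]; rewrite ew act1; exact: base.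
elim: w hw rw wn {ew} => // l w IH hw rw _.
have [i li] : exists i, l.1 = g i.
  by case: (hw l); rewrite ?mem_head // => ->; [exists true|exists false].
exists i, l.2, w; rewrite eval_cons actM -li -surjective_pairing; split=> //.
have -> : l = (g i, l.2) by rewrite -li -surjective_pairing.
apply: push.
case: w IH hw rw => [|l' w] IH hw rw; first by rewrite /= act1; exact: base.
have [j [t [w' [[el _] Uj]]]] : exists j t w', [/\ l' :: w = (g j, t) :: w' &
    U j t (act (eval_word (l' :: w)) x0)].
  apply: IH => //; first by move=> k kw; apply: hw; rewrite inE kw orbT.
  by move: rw => /andP[_].
move=> /(dis _ _ _ _ _ Uj)[ji ts].
by move: rw => /andP[]; rewrite el li /= ji eqxx ts; case: l.2.
Qed.

(** * The realization of a weighted tree *)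

Section RealizationTree.
Context (R : realType) (X : wtree R).
Implicit Types (x y z w p q : realization X) (e : edge X).
Local Notation d := (@mdist R (realization X)).

(** Lower bounds on the infimum over chains come from test functions that are 1-Lipschitz on every
    closed edge. *)
Lemma mdist_lb (f : realization X -> R) x y :
  (forall e s t p q, edge_point e s p -> edge_point e t q ->
     f p - f q <= `|s - t|) ->
  f x - f y <= d x y.
Proof.
move=> f_lip; apply: path_dist_lb => L.
elim=> [p|e s t p q r M ep eq _ IH]; first by rewrite subrr.
by have := f_lip _ _ _ _ _ ep eq; move: IH; lra.
Qed.

Lemma edge_point_range e t p : edge_point e t p -> 0 <= t <= weight e.
Proof.
have w0 := weight_gt0 e.
by case=> [[-> _]|[-> _]|[/andP[t0 tw] _]]; rewrite ?lexx ?(ltW w0) ?(ltW t0) ?ltW.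
Qed.

Lemma edge_point_ex e t : 0 <= t <= weight e -> exists p, edge_point e t p.
Proof.
move=> /andP[]; rewrite le_eqVlt => /orP[/eqP <- _|t0].
  by exists (Vert (src e)); apply: Or31.
rewrite le_eqVlt => /orP[/eqP ->|tw]; first by exists (Vert (tgt e)); apply: Or32.
have ht : 0 < t < weight e by rewrite t0.
by exists (Inner ht); apply: Or33; exists ht.
Qed.

Lemma edge_point_inj e t p q : edge_point e t p -> edge_point e t q -> p = q.
Proof.
have w0 := weight_gt0 e.
by case=> [[t0 ->]|[t0 ->]|[h ->]]; case=> [[t1 ->]|[t1 ->]|[h' ->]] //;
  rewrite ?(bool_irrelevance h h') //; exfalso; move: w0; rewrite -?t0 -?t1;
  lra.
Qed.

(* The parameter of the nearest point projection to the closed edge [e]. *)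
Definition cut e p : R :=
  let f v := if `[< side e v >] then 0 else weight e in
  match p with
  | Vert v => f v
  | @Inner _ _ e' t _ => if e' == e then t else f (src e')
  end.

Lemma cut_edge e t p : edge_point e t p -> cut e p = t.
Proof.
case=> [[-> ->]|[-> ->]|[h ->]] /=; last by rewrite eqxx.
- by rewrite asboolT //; exact: side_src.
- by rewrite asboolF //; exact: side_tgt.
Qed.

Lemma cut_other e e' t p : e' != e -> edge_point e' t p ->
  cut e p = cut e (Vert (src e')).
Proof.
move=> ee'; case=> [[_ ->]|[_ ->]|[h ->]] //=; last by rewrite (negbTE ee').
rewrite -(@sideE _ _ e (src e') (tgt e') [:: (e', true)]) //.
by rewrite inE eq_sym.
Qed.

Lemma cut_ge0_le e p : 0 <= cut e p <= weight e.
Proof.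
have w0 := ltW (weight_gt0 e).
case: p => [v|e' t h] /=; first by case: ifP => _; rewrite lexx w0.
case: eqP h => [->|_] h; last by case: ifP => _; rewrite lexx w0.
by case/andP: h => *; rewrite !ltW.
Qed.

Lemma cut_edge_point e p : 0 < cut e p < weight e -> edge_point e (cut e p) p.
Proof.
case: p => [v|e' t h] /=; first by case: ifP; rewrite ltxx ?andbF.
case: eqP => [ee|_]; last by case: ifP; rewrite ltxx ?andbF.
by subst e' => _; apply: Or33; exists h.
Qed.

Lemma cut_lipschitz e x y : `|cut e x - cut e y| <= d x y.
Proof.
have lip z u : cut e z - cut e u <= d z u.
  apply: mdist_lb => e' s t p q hp hq.
  have [ee|ee] := eqVneq e' e; first by subst e'; rewrite (cut_edge hp) (cut_edge hq) ler_norm.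
  by rewrite (cut_other ee hp) (cut_other ee hq) subrr.
by rewrite ler_norml lip andbT lerNl opprB metric_sym lip.
Qed.

Lemma mdist_edge e s t p q : edge_point e s p -> edge_point e t q ->
  d p q = `|s - t|.
Proof.
move=> hp hq; apply/eqP; rewrite eq_le; apply/andP; split.
  by apply: path_dist_le; exact: chain1 hp hq.
by have := cut_lipschitz e p q; rewrite (cut_edge hp) (cut_edge hq).
Qed.

(** The parameter along the directed edge [(e, b)]. For [p] on [e], the points of larger value form
    the branch at [p] in that direction. *)
Definition dcut e (b : bool) p : R := if b then cut e p else weight e - cut e p.

Lemma dcut_edge_point e b (s : R) : 0 <= s <= weight e ->
  exists p t, edge_point e t p /\ dcut e b p = s.
Proof.
move=> hs.
have hs' : 0 <= (if b then s else weight e - s) <= weight e.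
  by case: b; move: hs => /andP[]; lra.
have [p hp] := edge_point_ex hs'.
exists p, (if b then s else weight e - s); split=> //.
by rewrite /dcut (cut_edge hp); case: b {hs' hp} => //; lra.
Qed.

(** The test function is the distance to [p], with a minus sign outside the branch containing [x].
    The sign changes only at [p], so it stays Lipschitz. *)
Lemma dcut_sep e t b p x y : edge_point e t p ->
  dcut e b p < dcut e b x -> dcut e b y <= dcut e b p ->
  d x p + d p y <= d x y.
Proof.
move=> ep hx hy.
pose f z := if dcut e b p < dcut e b z then d z p else - d z p.
suff: f x - f y <= d x y.
  by rewrite /f hx ltNge hy /= opprK (metric_sym y p).
apply: mdist_lb => e' s u z z' hz hz'.
have dz := mdist_edge hz hz'.
have := metric_triangle z z' p; have := metric_triangle z' z p.
rewrite (metric_sym z' z) dz => h1 h2.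
have := mdist_ge0 z p; have := mdist_ge0 z' p => z'0 z0.
have [ee|ee] := eqVneq e' e; last first.
  rewrite /f {1}/dcut {1}/dcut /dcut (cut_other ee hz) (cut_other ee hz').
  by case: ifP => _; lra.
subst e'.
rewrite /f /dcut (cut_edge hz) (cut_edge hz') (cut_edge ep).
have := mdist_edge hz ep; have := mdist_edge hz' ep.
move: h1 h2 z0 z'0; clear; move: (d z p) (d z' p) => D D'.
case: b => /=; (case: ltP => ?; case: ltP => ?; [lra| |lra|lra]);
  move=> ? ? ? ? zs zu; have -> : `|s - u| = D + D' by rewrite zs zu; abs_lra.
all: lra.
Qed.

(** Both geodesics from [p] pass through the point [m] of the edge at the smaller of the two values,
    so the path from [x] to [y] through [p] backtracks. *)
Lemma dcut_same_side e b p x y : dcut e b p < dcut e b x ->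
  dcut e b p < dcut e b y -> d x y < d x p + d p y.
Proof.
move=> hx hy; pose s := Num.min (dcut e b x) (dcut e b y).
have hs : dcut e b p < s by rewrite lt_min hx.
have sx : s <= dcut e b x by rewrite ge_min lexx.
have sy : s <= dcut e b y by rewrite ge_min lexx orbT.
have srange : 0 <= s <= weight e.
  have := cut_ge0_le e p; have := cut_ge0_le e x; move: hs sx; rewrite /dcut.
  by case: (b) => ? ? /andP[? ?] /andP[? ?]; apply/andP; split; lra.
have [m [t [em dm]]] := dcut_edge_point b srange.
have h z : s <= dcut e b z -> d p m + d m z <= d p z.
  move=> sz; apply: (@dcut_sep e t (~~ b) m) => //; move: dm hs sz; rewrite /dcut;
  by case: (b) => /= *; lra.
have := h _ sx; have := h _ sy; have := metric_triangle x m y.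
have := cut_lipschitz e p m; rewrite (metric_sym x p) (metric_sym x m).
move: dm hs; rewrite /dcut; case: (b) => *; abs_lra.
Qed.

(** Between vertices the direction is the first edge of a simple walk. An inner target is replaced
    by the source of its edge, unless [p] is an end of that edge. *)
Lemma germ_ex p x : p <> x ->
  exists e t b, edge_point e t p /\ dcut e b p < dcut e b x.
Proof.
have vertV v u : v <> u -> exists e t b, edge_point e t (Vert v) /\
    dcut e b (Vert v) < dcut e b (Vert u).
  move=> vu; have [r /simple_walk[{}r [h _ h2 _]]] := wtree_connected v u.
  case: r h h2 => [/= /vu//|[e b] r [<- h]]; rewrite map_cons cons_uniq => /andP[er _].
  exists e, (if b then 0 else weight e), b; split.
    by case: (b); [apply: Or31|apply: Or32].
  have := sideE h er; have := weight_gt0 e; rewrite /dcut /= => w0 <-.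
  have := @side_src _ _ e; have := @side_tgt _ _ e.
  by rewrite /start /stop; case: (b) => /= /asboolF -> /asboolT ->; lra.
case: p => [v|e t ht] px; last first.
  have et : edge_point e t (Inner ht) by apply: Or33; exists ht.
  have ct : cut e (Inner ht) = t by exact: cut_edge et.
  case: (ltgtP (cut e x) t) => h.
  - by exists e, t, false; split=> //; rewrite /dcut ct; lra.
  - by exists e, t, true; split=> //; rewrite /dcut ct.
  - case: px; apply: edge_point_inj et _.
    by rewrite -h; apply: cut_edge_point; rewrite h.
case: x px => [u|e t ht] px.
  by apply: vertV => vu; apply: px; rewrite vu.
have [t0 tw] := andP ht.
have ct : cut e (Inner ht) = t by rewrite /= eqxx.
have [->|vs] := pselect (v = src e).
  have es : edge_point e 0 (Vert (src e)) by apply: Or31.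
  by exists e, 0, true; split=> //; rewrite /dcut ct (cut_edge es).
have [->|vt] := pselect (v = tgt e).
  have es : edge_point e (weight e) (Vert (tgt e)) by apply: Or32.
  by exists e, (weight e), false; split=> //; rewrite /dcut ct (cut_edge es); lra.
have [e' [t' [b [h1 h2]]]] := vertV _ _ vs.
have [ee|ee] := eqVneq e e'.
  by subst e'; case: h1 => [[_ [/vs]]|[_ [/vt]]|[]].
exists e', t', b; split=> //; move: h2.
have ei : edge_point e t (Inner ht) by apply: Or33; exists ht.
by rewrite {2 4}/dcut -(cut_other ee ei).
Qed.

(** The branch at [p] containing [x] does not contain [y]; according as it contains [z] or not, [p]
    separates [z] from [y] or from [x]. *)
Lemma thin_realization : thin_triangles (realization X).
Proof.
move=> x y z p; rewrite /between => pxy.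
have [->|px] := pselect (p = x); first by left; rewrite mdistxx add0r.
have [e [t [b [ep hx]]]] := germ_ex px.
have hy : dcut e b y <= dcut e b p.
  rewrite leNgt; apply/negP => hy.
  by have := dcut_same_side hx hy; rewrite pxy ltxx.
case: (leP (dcut e b z) (dcut e b p)) => hz; [left|right]; apply/eqP;
  rewrite eq_le metric_triangle andbT.
- exact: dcut_sep ep hx hz.
- exact: dcut_sep ep hz hy.
Qed.

Lemma geodesic_edge e s t x y : edge_point e s x -> edge_point e t y ->
  geodesic_pair x y.
Proof.
move=> ex ey r; have xy := mdist_edge ex ey; rewrite xy => /andP[r0 rd].
have /andP[s0 sw] := edge_point_range ex; have /andP[t0 tw] := edge_point_range ey.
have hr : 0 <= (if s <= t then s + r else s - r) <= weight e.
  by case: ifPn rd => h rd; apply/andP; split; abs_lra.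
have [z ez] := edge_point_ex hr; exists z.
rewrite (mdist_edge ex ez) (mdist_edge ez ey).
by move: rd; case: ifPn; clear -r0 => ? ?; split; abs_lra.
Qed.

Lemma rtree_realization : rtree (realization X).
Proof.
split; first exact: thin_realization.
move=> x y; have [L] := chain_ex x y.
elim=> {x y L} [p t|e s u x m y L ex em _ IH].
  by rewrite mdistxx => /andP[? ?]; exists p; rewrite mdistxx; split; lra.
by apply: (geodesic_trans thin_realization) IH; exact: geodesic_edge ex em.
Qed.

End RealizationTree.

Lemma finite_lower_bound (R : realType) (T : Type) (A : set T) (f : T -> R) :
  finite_set A -> (forall x, A x -> 0 < f x) ->
  exists2 r, 0 < r & forall x, A x -> r <= f x.
Proof.
move=> finA f0.
have [n] := (finite_setP A).1 finA; elim: n A f0 {finA} => [|n IH] A f0.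
  by rewrite II0 card_eq0 => /eqP A0; exists 1 => // x; rewrite A0.
move=> /eq_cardSP[y Ay cA].
have [|r r0 hr] := IH (A `\ y) _ cA; first by move=> x [/f0].
exists (Num.min r (f y)); first by rewrite lt_min r0 f0.
move=> x Ax; rewrite ge_min; have [->|xy] := pselect (x = y); first by rewrite lexx orbT.
by rewrite hr.
Qed.

(** * Axes of automorphisms, interiors of edges and half-trees *)

Section Axis.
Import numFieldNormedType.Exports.
Context (R : realType) (X : wtree R).
Implicit Types (x y z w p q : realization X) (g : aut X) (c : R -> realization X).
Local Notation d := (@mdist R (realization X)).
Local Notation tree := (rtree_realization X).

Definition axis_line g c (m : R) :=
  [/\ line c, 0 < m & forall t, g (c t) = c (t + m)].

Lemma axis_line_shift g c m u : axis_line g c m ->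
  axis_line g (fun t => c (t + u)) m.
Proof.
move=> [lc m0 gc]; split=> //; first exact: line_shift.
by move=> t; rewrite gc addrAC.
Qed.

Lemma axis_line_ex g : hyperbolic g -> exists c m, axis_line g c m.
Proof.
move=> hg; case: (wtree_inhabited X) => v.
have [|c [m [lc m0 gc]]] := axis_ex tree (Vert v) (aut_isom g) (@aut_funK _ _ g)
  (@aut_invK _ _ g); first by move=> x gx; apply: hg; exists x.
by exists c, m.
Qed.

Section AxisLine.
Context g c m (gcm : axis_line g c m).

Lemma axis_line_dist x : d x (g x) = 2 * d x (c (gate c x)) + m.
Proof.
case: gcm => lc m0 gc.
by rewrite (dist_translate tree x lc (lt0r_neq0 m0) (aut_isom g) gc) gtr0_norm.
Qed.

Lemma axis_line_length : translation_length g = m.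
Proof.
case: gcm => lc m0 gc; apply/eqP; rewrite eq_le; apply/andP; split.
  apply: ge_inf; last by exists (c 0) => //=; rewrite axis_line_dist (gate_line tree 0 lc) mdistxx mulr0 add0r.
  by exists 0 => _ [x _ <-]; exact: mdist_ge0.
apply: lb_le_inf; first by exists (d (c 0) (g (c 0))), (c 0).
by move=> _ [x _ <-]; rewrite axis_line_dist; have := mdist_ge0 x (c (gate c x)); lra.
Qed.

Lemma axis_lineE : axis g = range c.
Proof.
case: gcm => lc m0 gc; apply/seteqP; split=> [x|_ [t _ <-]]; rewrite /axis /= axis_line_length.
  rewrite axis_line_dist => h; exists (gate c x) => //.
  by apply/esym/mdist_positivity; lra.
by rewrite axis_line_dist (gate_line tree t lc) mdistxx mulr0 add0r.
Qed.

Lemma axis_line_hyperbolic : hyperbolic g.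
Proof.
case: gcm => lc m0 gc [x gx]; have := axis_line_dist x; rewrite gx mdistxx.
by have := mdist_ge0 x (c (gate c x)); lra.
Qed.

End AxisLine.

Lemma near_inner e (t : R) p q : edge_point e t p -> d p q < t ->
  d p q < weight e - t ->
  exists s, [/\ 0 < s < weight e, edge_point e s q & d p q = `|s - t|].
Proof.
move=> ep h1 h2; have := cut_lipschitz e p q; rewrite (cut_edge ep) => h.
have hq : 0 < cut e q < weight e.
  by move: h; rewrite ler_norml => /andP[? ?]; apply/andP; split; lra.
have eq := cut_edge_point hq.
by exists (cut e q); split=> //; rewrite (mdist_edge ep eq) distrC.
Qed.

Lemma near_vertex (v : vertex X) : locally_finite X ->
  exists2 r, 0 < r & forall q, d (Vert v) q < r -> q <> Vert v ->
    exists e (b : bool), [/\ incident v e, 0 < d (Vert v) q < weight e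
      & edge_point e (if b then d (Vert v) q else weight e - d (Vert v) q) q].
Proof.
move=> lf; have [r r0 hr] := finite_lower_bound (lf v) (fun e _ => weight_gt0 e).
exists r => // q qr qv.
have [e [t [b [ev h]]]] := germ_ex (p := Vert v) (x := q) (fun e => qv (esym e)).
have := cut_lipschitz e (Vert v) q; have := cut_ge0_le e q.
have w0 := weight_gt0 e.
case: (ev) h => [[t0 [vs]]|[tw [vt]]|[] //]; rewrite /dcut (cut_edge ev).
- have := hr e (or_introl (esym vs)); rewrite t0; case: b => ? h /andP[c0 cw]; last by lra.
  rewrite sub0r normrN ger0_norm // => hd.
  have hq : 0 < cut e q < weight e by apply/andP; split; lra.
  have eq := cut_edge_point hq; have dq := mdist_edge ev eq.
  rewrite t0 sub0r normrN ger0_norm // in dq.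
  by exists e, true; rewrite dq; split=> //; left.
- have := hr e (or_intror (esym vt)); rewrite tw; case: b => ? h /andP[c0 cw]; first by lra.
  rewrite ger0_norm ?subr_ge0 // => hd.
  have hq : 0 < cut e q < weight e by apply/andP; split; lra.
  have eq := cut_edge_point hq; have dq := mdist_edge ev eq.
  rewrite tw ger0_norm ?subr_ge0 // in dq.
  exists e, false; rewrite dq; split; [by right|by apply/andP; split; lra|].
  by rewrite opprB addrC subrK.
Qed.

(** Not invariant under automorphisms, because of vertices of valence two. *)
Definition inner_point x := exists e t, 0 < t < weight e /\ edge_point e t x.

Lemma not_inner_point x : ~ inner_point x -> exists v, x = Vert v.
Proof.
case: x => [v _|e t ht []]; first by exists v.
by exists e, t; split=> //; apply: Or33; exists ht.
Qed.

Lemma inner_not_branch x : inner_point x -> ~ branch_point x.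
Proof.
move=> [e [t [ht et]]] [v [xv _]]; move: et ht; rewrite xv.
by case=> [[-> _]|[-> _]|[]//]; rewrite ltxx ?andbF.
Qed.

Lemma vertex_isolated (v : vertex X) : locally_finite X ->
  exists2 r, 0 < r & forall q, d (Vert v) q < r -> q <> Vert v -> inner_point q.
Proof.
move=> /(near_vertex v)[r r0 hr]; exists r => // q /hr h /h[e [b [_ hd eq]]].
exists e; eexists; split; last exact: eq.
by case: b {eq}; move: hd => /andP[? ?]; apply/andP; split; lra.
Qed.

Definition inner_arc c (s t : R) := forall u, s <= u <= t -> inner_point (c u).

Lemma inner_arc_ex c u v : locally_finite X -> line c -> u < v ->
  exists s t, [/\ u < s, s < t, t < v & inner_arc c s t].
Proof.
move=> lf lc uv.
have [s [us sv [e [t [ht et]]]]] : exists s, [/\ u < s, s < v & inner_point (c s)].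
  pose s := (u + v) / 2; have [hs|/not_inner_point[x xs]] := pselect (inner_point (c s)).
    by exists s; split=> //; rewrite /s; lra.
  have [r r0 hr] := vertex_isolated x lf.
  pose k := Num.min (r / 2) ((v - u) / 4).
  have [k1 k2] : k <= r / 2 /\ k <= (v - u) / 4 by rewrite /k !ge_min !lexx orbT.
  have k0 : 0 < k by rewrite /k lt_min; apply/andP; split; lra.
  have dk : d (c s) (c (s + k)) = k by rewrite lc; abs_lra.
  exists (s + k); split; [by rewrite /s; lra|by rewrite /s; lra|].
  apply: hr; first by rewrite -xs dk; lra.
  by rewrite -xs => /(line_inj lc); lra.
have [t0 tw] := andP ht.
pose k := Num.min ((v - s) / 2) (Num.min (t / 2) ((weight e - t) / 2)).
have [k1 k2 k3] : [/\ k <= (v - s) / 2, k <= t / 2 & k <= (weight e - t) / 2].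
  by rewrite /k !ge_min !lexx !orbT.
have k0 : 0 < k by rewrite /k !lt_min; apply/and3P; split; lra.
exists s, (s + k); split; [lra|lra|lra|] => x /andP[sx xk].
have dx : d (c s) (c x) = x - s by rewrite lc; abs_lra.
have [|| t' [ht' et' _]] := near_inner (q := c x) et; rewrite ?dx; [lra|lra|].
by exists e, t'.
Qed.

(** The tree does not branch inside an edge: a point at small distance [k] from [c t] towards [x]
    would be a third one besides [c (t + k)] and [c (t - k)]. *)
Lemma gate_inner c x (t : R) : line c -> inner_point (c t) -> gate c x = t ->
  x = c t.
Proof.
move=> lc [e [u [/andP[u0 uw] eu]]] gx.
apply: mdist_positivity; apply/eqP; rewrite eq_le mdist_ge0 andbT leNgt.
apply/negP => D0; set D := d x (c t) in D0.
pose k := Num.min D (Num.min (u / 2) ((weight e - u) / 2)).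
have [k1 k2 k3] : [/\ k <= D, k <= u / 2 & k <= (weight e - u) / 2].
  by rewrite /k !ge_min !lexx !orbT.
have k0 : 0 < k by rewrite /k !lt_min; apply/and3P; split; lra.
have [z [zc zx]] := tree.2 (c t) x k ltac:(rewrite metric_sym -/D; lra).
have near q : d (c t) q = k -> exists s, edge_point e s q /\ k = `|s - u|.
  move=> dq; have [||s [_ es ds]] := near_inner (q := q) eu; rewrite ?dq; [lra|lra|].
  by exists s; rewrite -dq.
have d1 : d (c t) (c (t + k)) = k by rewrite lc; abs_lra.
have d2 : d (c t) (c (t - k)) = k by rewrite lc; abs_lra.
have [s [es sk]] := near _ zc.
have [s1 [es1 sk1]] := near _ d1; have [s2 [es2 sk2]] := near _ d2.
have far r : `|r - t| = k -> z <> c r.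
  move=> rk zr; have := gateP tree x r lc; rewrite gx rk -zr -/D.
  by rewrite metric_sym zx metric_sym -/D; lra.
have n1 : z <> c (t + k) by apply: far; rewrite addrAC subrr add0r gtr0_norm.
have n2 : z <> c (t - k).
  by apply: far; rewrite addrAC subrr add0r normrN gtr0_norm.
have m1 : s <> s1 by move=> ss; apply: n1; subst s1; exact: edge_point_inj es es1.
have m2 : s <> s2 by move=> ss; apply: n2; subst s2; exact: edge_point_inj es es2.
have m3 : s1 <> s2.
  move=> ss; subst s2; have := edge_point_inj es1 es2.
  by move/(line_inj lc); lra.
have pm r : k = `|r - u| -> r = u + k \/ r = u - k by clear; abs_lra.
by case: (pm _ sk); case: (pm _ sk1); case: (pm _ sk2) => ? ? ?; subst s s1 s2.
Qed.

Lemma inner_arc_segment c s t : line c -> s < t -> inner_arc c s t ->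
  [set x | s < gate c x < t] = segment (c s) (c t) `\` [set c s; c t].
Proof.
move=> lc st arc; apply/seteqP; split=> x /=.
  move=> /andP[sx xt]; have xc : x = c (gate c x).
    by apply: gate_inner => //; apply: arc; rewrite !ltW.
  split; first by rewrite /segment /= xc; apply: between_line => //; rewrite !ltW.
  by move=> []; rewrite xc => /(line_inj lc) e; move: sx xt; rewrite e ltxx.
move=> [xs nx]; have xc := between_line_eq tree lc xs (ltW st).
have d1 : d (c s) x != 0.
  by apply/negP => /eqP/mdist_positivity e; apply: nx; left; rewrite e.
have d2 : d x (c t) != 0.
  by apply/negP => /eqP/mdist_positivity e; apply: nx; right; rewrite e.
have d1' : 0 < d (c s) x by rewrite lt_neqAle eq_sym d1 mdist_ge0.
have d2' : 0 < d x (c t) by rewrite lt_neqAle eq_sym d2 mdist_ge0.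
rewrite {1 2}xc !gate_line //; [|exact: tree]; move: xs; rewrite /segment /= lc.
by rewrite distrC gtr0_norm ?subr_gt0 // => ?; apply/andP; split; lra.
Qed.

Lemma gate_opp c x : line c -> gate (fun t => c (- t)) x = - gate c x.
Proof.
move=> lc; apply: (@gate_uniq _ _ tree _ _ _ (- gate c x - 1) (- gate c x + 1)
   (line_opp lc)); first by apply/andP; split; lra.
- rewrite [LHS](gateP tree x _ lc) [X in _ = X + _](gateP tree x _ lc).
  by move: (gate c x) => g; clear; abs_lra.
- rewrite [LHS](gateP tree x _ lc) [X in _ = X + _](gateP tree x _ lc).
  by move: (gate c x) => g; clear; abs_lra.
Qed.

Lemma gate_continuous c : line c -> continuous (gate c : realization X -> R).
Proof.
move=> lc x A /nbhs_ballP[e e0 eA]; apply/nbhs_ballP; exists e => // y.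
rewrite ballEmdist /= => xy; apply: eA; rewrite /ball /=.
by apply: le_lt_trans xy; exact: (gate_lipschitz tree).
Qed.

Lemma segment_connected x y : connected (segment x y).
Proof.
have [f [f0 f1 fd]] := segment_param tree x y.
pose D := d x y; have D0 : 0 <= D by exact: mdist_ge0.
(* Clamping extends the parametrization to a continuous map on the whole real line. *)
pose k (u : R) := Num.min (Num.max u 0) D.
have kr u : 0 <= k u <= D by rewrite /k ge_min lexx orbT le_min D0 le_max lexx orbT.
have kl u v : `|k u - k v| <= `|u - v|.
  rewrite /k /Num.min /Num.max; clear -D0; clearbody D.
  case: (ltP u 0) => hu; case: (ltP v 0) => hv; first by rewrite subrr normr0.
  - by case: (ltP 0 D) => ?; case: (ltP v D) => ?; abs_lra.
  - by case: (ltP u D) => ?; case: (ltP 0 D) => ?; abs_lra.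
  - by case: (ltP u D) => ?; case: (ltP v D) => ?; abs_lra.
have ck : continuous (f \o k).
  move=> u A /nbhs_ballP[e e0 eA]; apply/nbhs_ballP; exists e => // v.
  rewrite /ball /= => uv; apply: eA; rewrite ballEmdist /= fd //.
  exact: le_lt_trans uv.
have fx u : 0 <= u <= D -> d x (f u) = u.
  move=> hu; rewrite -[in LHS]f0 fd ?lexx ?D0 // sub0r normrN ger0_norm //.
  by case/andP: hu.
have fy u : 0 <= u <= D -> d (f u) y = D - u.
  move=> hu; rewrite -[in LHS]f1 fd ?lexx ?D0 // distrC ger0_norm // subr_ge0.
  by case/andP: hu.
clear fd; have -> : segment x y = (f \o k) @` `[0, D].
  apply/seteqP; split=> [z|_ [u _ <-]] /=; rewrite /segment /= -/D; last first.
    by rewrite fx // fy //; lra.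
  move=> h; have z1 := mdist_ge0 x z; have z2 := mdist_ge0 z y.
  have hz : 0 <= d x z <= D by apply/andP; split; lra.
  have kz : k (d x z) = d x z by rewrite /k max_l ?min_l; case/andP: hz.
  exists (d x z); first by rewrite in_itv.
  rewrite kz; apply/esym; apply: (between_uniq tree h); last by rewrite fx.
  by rewrite /between fx // fy // -/D; lra.
apply: connected_continuous_connected; first exact/connected_intervalP/interval_is_interval.
exact: continuous_subspaceT.
Qed.

(** Each point of the half-tree is joined to [c s] inside it, by [gate_between]. Conversely the gate
    is continuous, so a connected set reaching the other side would meet the gap. *)
Lemma half_tree_component c s t : line c -> s < t ->
  is_component (~` [set x | s < gate c x < t]) [set x | gate c x <= s].
Proof.
move=> lc st; exists (c s); first by rewrite /= gate_line ?ltxx //; exact: tree.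
apply/seteqP; split=> [y /= ys|y].
  apply: (connected_component_max (B := segment y (c s))).
  - by rewrite /segment /= mdistxx addr0.
  - move=> z zs /=; have := gate_between tree lc zs; rewrite (gate_line tree s lc).
    move=> h /andP[h1 h2]; move: ys h h1 h2; clear -st.
    by move=> ? /orP[] /andP[? ?] ? ?; lra.
  - exact: segment_connected.
  - by rewrite /segment /= mdistxx add0r.
move=> [C [Cs CA cC] Cy] /=; rewrite leNgt; apply/negP => sy.
have : connected (gate c @` C).
  apply: connected_continuous_connected => //; apply: continuous_subspaceT.
  exact: gate_continuous.
move=> /connected_intervalP itv.
have ty : t <= gate c y.
  by have := CA _ Cy; rewrite /= sy => /negP; rewrite -leNgt.
have [|||z Cz zst] := itv s (gate c y) _ _ ((s + t) / 2).
- by exists (c s) => //; rewrite gate_line //; exact: tree.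
- by exists y.
- by apply/andP; split; lra.
by have := CA _ Cz; rewrite /= zst; case; apply/andP; split; lra.
Qed.

Lemma half_tree_component_opp c s t : line c -> s < t ->
  is_component (~` [set x | s < gate c x < t]) [set x | t <= gate c x].
Proof.
move=> lc st; have := @half_tree_component _ (- t) (- s) (line_opp lc).
rewrite ltrN2 => /(_ st); congr (is_component (~` _) _); apply/seteqP;
  by split=> x /=; rewrite gate_opp // ?lerN2 // !ltrN2 // andbC.
Qed.

End Axis.

(** * Schottky pairs, finite orbits and arc length *)

Section Schottky.
Context (R : realType) (X : wtree R).
Implicit Types (x y z : realization X) (g : aut X) (c : R -> realization X).
Local Notation tree := (rtree_realization X).

Lemma gate_axis g c m x : axis_line g c m -> gate c (g x) = gate c x + m.
Proof. by move=> [lc m0 gc]; exact: (gate_translate tree x lc (aut_isom g) gc). Qed.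

Lemma gate_axisV g c m x : axis_line g c m -> gate c (g^-1%g x) = gate c x - m.
Proof. by move=> gcm; rewrite -{2}(aut_invK g x) (gate_axis _ gcm) addrK. Qed.

Lemma image_aut g (A B : set (realization X)) :
  (forall x, A x <-> B (g x)) -> g @` A = B.
Proof.
move=> AB; apply/seteqP; split=> [_ [x Ax <-]|y By]; first exact/AB.
by exists (aut_inv g y); [apply/AB|]; rewrite aut_invK.
Qed.

(** The arc is refined twice, since an arc free of vertices may have a translate that contains
    one. *)
Lemma fundamental_arc_ex g c m (a0 a1 : R) : locally_finite X -> axis_line g c m ->
  a1 - a0 < m ->
  exists s t, [/\ a1 - m < s, s < t, t < a0, inner_arc c s t
    & inner_arc c (s + m) (t + m)].
Proof.
move=> lf gcm am; have [lc m0 gc] := gcm.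
have [s [t [s1 st t0 arc]]] := @inner_arc_ex _ _ c (a1 - m) a0 lf lc ltac:(lra).
have [s' [t' [ss st' tt arc']]] := inner_arc_ex lf (line_shift m lc) st.
exists s', t'; split=> //; [lra|lra| |].
- by move=> u /andP[? ?]; apply: arc; apply/andP; split; lra.
- move=> u /andP[? ?]; rewrite -(subrK m u); apply: arc'.
  by apply/andP; split; lra.
Qed.

(** As the interval from [a0] to [a1] is shorter than [m1], an arc and its translate by [m1] enclose
    it; likewise on the other axis. A half-tree of one generator has gates outside that generator's
    interval, hence gates inside the other interval, away from the other half-trees. *)
Lemma schottky_of_separated g1 g2 c1 c2 m1 m2 (a0 a1 b0 b1 : R) :
  locally_finite X -> axis_line g1 c1 m1 -> axis_line g2 c2 m2 ->
  separated c1 c2 a0 a1 b0 b1 ->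
  a0 <= a1 -> a1 - a0 < m1 -> b0 <= b1 -> b1 - b0 < m2 ->
  schottky_pair g1 g2 /\ free_of_rank 2 (generated [set g1; g2]).
Proof.
move=> lf ax1 ax2 sep a01 am b01 bm.
have [s1 [t1 [as1 st1 ta1 arc1 arc1']]] := fundamental_arc_ex lf ax1 am.
have [s2 [t2 [as2 st2 ta2 arc2 arc2']]] := fundamental_arc_ex lf ax2 bm.
have disj x : (gate c1 x < a0) || (a1 < gate c1 x) ->
    (gate c2 x < b0) || (b1 < gate c2 x) -> False.
  by move=> h1 h2; have := sep x; rewrite negb_and -!ltNge => /(_ h1) /andP[];
     case/orP: h2; lra.
pose g (i : bool) := if i then g1 else g2.
pose c (i : bool) := if i then c1 else c2.
pose m (i : bool) := if i then m1 else m2.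
pose s (i : bool) := if i then s1 else s2.
pose t (i : bool) := if i then t1 else t2.
have ax i : axis_line (g i) (c i) (m i) by case: i.
have st i : s i < t i by case: i.
have tsm i : t i < s i + m i by rewrite /t /s /m; case: i; lra.
have arc i : inner_arc (c i) (s i) (t i) by case: i.
have arc' i : inner_arc (c i) (s i + m i) (t i + m i) by case: i.
have lc i : line (c i) by case: (ax i).
have m0 i : 0 < m i by case: (ax i).
have far x i j : i <> j -> (gate (c i) x < t i) || (s i + m i < gate (c i) x) ->
    (gate (c j) x < t j) || (s j + m j < gate (c j) x) -> False.
  case: i; case: j => //= _; rewrite /c /t /s /m /= => h1 h2; apply: (disj x);
  by [case/orP: h1 => ?; apply/orP; [left|right]; lra|
      case/orP: h2 => ?; apply/orP; [left|right]; lra].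
split; last first.
  (* These domains absorb the open segment on the positive side only, so a point of the first arc is
     left over as the base point. *)
  pose U i (e : bool) : set (realization X) :=
    if e then [set x | s i + m i < gate (c i) x] else [set x | gate (c i) x <= s i].
  have [u us ut] : exists2 u, s1 < u & u < t1.
    by exists ((s1 + t1) / 2); lra.
  apply: (@ping_pong _ _ (fun g : aut X => g : realization X -> realization X) _ _ g U (c1 u)) => //.
  - move=> i e j e' x Ui Uj.
    have [ij|/eqP ij] := eqVneq i j; last first.
      exfalso; apply: (far x _ _ ij); apply/orP; have := st i; have := st j.
        by move: Ui; rewrite /U; case: e => /=; [right|left]; lra.
      by move: Uj; rewrite /U; case: e' => /=; [right|left]; lra.
    split=> //; subst j; have := st i; have := tsm i.
    by move: Ui Uj; rewrite /U; case: e; case: e' => //=; lra.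
  - move=> i e; rewrite /U; case: i; rewrite /s /m /c /=.
      by case: e => /=; rewrite (gate_line tree u (lc true : line c1)); lra.
    have h : b0 <= gate c2 (c1 u) <= b1.
      by apply: sep; rewrite (gate_line tree u (lc true : line c1)) negb_and -!ltNge; apply/orP; left; lra.
    by case/andP: h => ? ?; case: e => /=; lra.
  - by move=> i x; rewrite /U /= (gate_axis _ (ax i)); lra.
  - by move=> i x; rewrite /U /= (gate_axisV _ (ax i)); lra.
split; [exact: axis_line_hyperbolic ax1|exact: axis_line_hyperbolic ax2|].
pose sh i (e : bool) := if e then m i else 0.
exists (fun i e => [set x | s i + sh i e < gate (c i) x < t i + sh i e]).
exists (fun i e => if e then [set x | t i + m i <= gate (c i) x]
                   else [set x | gate (c i) x <= s i]).
have sh_arc i e : inner_arc (c i) (s i + sh i e) (t i + sh i e).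
  by case: e; rewrite /sh ?addr0.
have st_sh i e : s i + sh i e < t i + sh i e by rewrite ltrD2r.
split.
- move=> i e; rewrite (inner_arc_segment (lc i) (st_sh i e) (sh_arc i e)); split.
    exists (c i (s i + sh i e)), (c i (t i + sh i e)); split=> //.
    by move/(line_inj (lc i)); have := st_sh i e; lra.
  move=> x [xs nx]; apply: inner_not_branch.
  have : [set x | s i + sh i e < gate (c i) x < t i + sh i e] x.
    by rewrite (inner_arc_segment (lc i) (st_sh i e) (sh_arc i e)).
  move=> /= /andP[h1 h2]; have inn : inner_point (c i (gate (c i) x)).
    by apply: (sh_arc i e); rewrite !ltW.
  by rewrite (gate_inner (lc i) inn erefl).
- move=> i; apply: image_aut => x /=; rewrite -/(g i) (gate_axis _ (ax i)) /sh !addr0.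
  by rewrite !ltrD2r.
- move=> i e; split; last first.
    case: e; [exists (c i (t i + m i))|exists (c i (s i))];
    by rewrite /= (gate_line tree _ (lc i)).
  case: e; rewrite /sh.
    by apply: half_tree_component_opp => //; rewrite ltrD2r.
  by rewrite !addr0; exact: half_tree_component.
- move=> [i e] [j e'] _ _ [x [/= Hi Hj]].
  have [ij|/eqP ij] := eqVneq i j; last first.
    exfalso; apply: (far x _ _ ij); apply/orP; have := st i; have := st j.
      by move: Hi; case: (e) => /=; [right|left]; lra.
    by move: Hj; case: (e') => /=; [right|left]; lra.
  subst j; have := st i; have := tsm i; move: Hi Hj.
  by case: e; case: e' => //= *; exfalso; lra.
move=> i; rewrite -/(g i); split; apply: image_aut => x /=; rewrite /sh.
  rewrite (gate_axis _ (ax i)); have := st i; have := tsm i; split.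
    move=> /negP; rewrite -ltNge => h.
    case: (ltP (gate (c i) x) (t i)) => h'; [left; apply/andP; split|right]; lra.
  by move=> h; apply/negP; rewrite -ltNge; case: h => [/andP[? ?]|?]; lra.
rewrite -/(g i)^-1%g (gate_axisV _ (ax i)) !addr0; have := st i; have := tsm i; split.
  move=> /negP; rewrite -ltNge => h.
  case: (ltP (s i) (gate (c i) x - m i)) => h'; [left; apply/andP; split|right]; lra.
by move=> h; apply/negP; rewrite -ltNge; case: h => [/andP[? ?]|?]; lra.
Qed.

End Schottky.

Lemma pigeonhole (T : Type) (f : nat -> T) (S : set T) : finite_set S ->
  (forall n, S (f n)) -> exists i j, (i < j)%N /\ f i = f j.
Proof.
move=> finS fS; apply: contrapT => ninj; apply: infinite_nat.
have inj : {in [set: nat] &, injective f}.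
  move=> i j _ _ fij; case: (ltngtP i j) => // ij; exfalso; apply: ninj.
    by exists i, j.
  by exists j, i.
rewrite -(eq_finite_set (inj_card_eq inj)); apply: sub_finite_set finS.
by move=> _ [n _ <-].
Qed.

Section Orbits.
Context (R : realType) (X : wtree R).
Implicit Types (x y z p q : realization X) (g : aut X) (c : R -> realization X) (e : edge X).
Local Notation d := (@mdist R (realization X)).
Local Notation tree := (rtree_realization X).

(** Points at small distance [k] on the three legs would be distinct points of one edge, where only
    the parameters [u + k] and [u - k] are available. *)
Lemma inner_no_tripod x y1 y2 y3 : inner_point x -> x <> y1 -> x <> y2 -> x <> y3 ->
  between y1 x y2 -> between y2 x y3 -> between y1 x y3 -> False.
Proof.
move=> [e [u [/andP[u0 uw] eu]]] n1 n2 n3 b12 b23 b13.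
have pos y : x <> y -> 0 < d x y by move=> ?; rewrite mdist_gt0; apply/eqP.
pose k := Num.min (Num.min (d x y1) (Num.min (d x y2) (d x y3)))
  (Num.min (u / 2) ((weight e - u) / 2)).
have [k1 k2 k3 k4 k5] : [/\ k <= d x y1, k <= d x y2, k <= d x y3, k <= u / 2
    & k <= (weight e - u) / 2].
  by rewrite /k !ge_min !lexx !orbT.
have k0 : 0 < k by rewrite /k !lt_min !pos //=; apply/andP; split; lra.
have pt y : k <= d x y -> exists z s, [/\ d x z = k, between x z y,
    edge_point e s z & s = u + k \/ s = u - k].
  move=> ky; have [z [xz zy]] := tree.2 x y k ltac:(lra).
  have [||s [_ es ds]] := near_inner (q := z) eu; rewrite ?xz; [lra|lra|].
  exists z, s; split=> //; first by rewrite /between; lra.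
  by move: ds; rewrite xz; clear; abs_lra.
have sep y y' z z' : between y x y' -> d x z = k -> d x z' = k ->
    between x z y -> between x z' y' -> z <> z'.
  move=> yxy xz xz' bz bz' zz; subst z'; move: yxy xz bz bz'; rewrite /between.
  by have := metric_triangle y z y'; clear -k0; dlra.
have [z1 [s1 [d1 c1 e1 h1]]] := pt _ k1; have [z2 [s2 [d2 c2 e2 h2]]] := pt _ k2.
have [z3 [s3 [d3 c3 e3 h3]]] := pt _ k3.
have m12 : s1 <> s2.
  by move=> ss; subst s2; apply: (sep _ _ _ _ b12 d1 d2 c1 c2); exact: edge_point_inj e1 e2.
have m23 : s2 <> s3.
  by move=> ss; subst s3; apply: (sep _ _ _ _ b23 d2 d3 c2 c3); exact: edge_point_inj e2 e3.
have m13 : s1 <> s3.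
  by move=> ss; subst s3; apply: (sep _ _ _ _ b13 d1 d3 c1 c3); exact: edge_point_inj e1 e3.
by case: h1; case: h2; case: h3 => ? ? ?; subst s1 s2 s3.
Qed.

(** The end of the overlap is the centre of a tripod, a property that every automorphism
    preserves. *)
Lemma overlap_end_not_inner (a b : R -> realization X) (L : R) g :
  line a -> line b -> 0 < L -> overlap a b L -> ~ inner_point (g (a 0)).
Proof.
move=> la lb L0 ov inn.
have e0 : a 0 = b 0 by apply/ov; lra.
have ab : d (a 1) (b 1) = 2.
  by rewrite (overlap_dist_ge tree _ la lb L0 ov) // normr1; lra.
have nz s : s != 0 -> g (a 0) <> g (a s).
  by move=> s0 /(can_inj (@aut_funK _ _ g))/(line_inj la) e; rewrite e eqxx in s0.
apply: (inner_no_tripod (y1 := g (a (- L))) (y2 := g (a 1)) (y3 := g (b 1)) inn).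
- by apply: nz; rewrite oppr_eq0; lra.
- by apply: nz; exact: oner_neq0.
- by rewrite e0 => /(can_inj (@aut_funK _ _ g))/(line_inj lb); lra.
- by rewrite /between !aut_isom !la; abs_lra.
- by rewrite /between !aut_isom ab e0 lb -e0 la; abs_lra.
- rewrite /between !aut_isom; have -> : a (- L) = b (- L) by apply/ov; lra.
  by rewrite e0 !lb; abs_lra.
Qed.

(** A shorter translation would move the vertex [p] to an inner point. The bound depends on [p]
    alone, not on the automorphism. *)
Lemma overlap_translation_lb p : locally_finite X -> exists2 r : R, 0 < r &
  forall g a b L m, axis_line g a m -> line b -> 0 < L -> overlap a b L ->
    a 0 = p -> r <= m.
Proof.
move=> lf; have [inn|/not_inner_point[v ->]] := pselect (inner_point p).
  (* The value 1 is arbitrary: an inner point is never the end of an overlap. *)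
  exists 1 => // g a b L m [la _ _] lb L0 ov ap.
  by have := overlap_end_not_inner (g := 1%g) la lb L0 ov; rewrite /= ap.
have [r r0 hr] := vertex_isolated v lf; exists r => // g a b L m [la m0 ga] lb L0 ov av.
rewrite leNgt; apply/negP => mr.
apply: (overlap_end_not_inner (g := g) la lb L0 ov); rewrite ga add0r; apply: hr.
  by rewrite -av la; abs_lra.
by rewrite -av => /(line_inj la); lra.
Qed.

Lemma finite_small_sphere p : locally_finite X ->
  exists2 r, 0 < r & forall k, 0 < k < r -> finite_set [set q | d p q = k].
Proof.
move=> lf.
have fin (A : set (edge X)) (P : edge X -> bool -> R) (S : set (realization X)) :
    finite_set A -> (forall q, S q -> exists e b, A e /\ edge_point e (P e b) q) ->
    finite_set S.
  move=> finA hS.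
  pose F (eb : edge X * bool) := xget p [set q | edge_point eb.1 (P eb.1 eb.2) q].
  apply: (@sub_finite_set _ _ (F @` (A `*` [set: bool]))); last first.
    by apply: finite_image; apply: finite_setX => //; exact: finite_finset.
  move=> q /hS[e [b [Ae eq]]]; exists (e, b) => //.
  by rewrite /F; case: xgetP => [q' _ eq'|/(_ q)//]; exact: edge_point_inj eq' eq.
have [[e [u [/andP[u0 uw] eu]]]|/not_inner_point[v ->]] := pselect (inner_point p).
  exists (Num.min u (weight e - u)); first by rewrite lt_min; apply/andP; split; lra.
  move=> k /andP[k0]; rewrite lt_min => /andP[ku kw].
  apply: (fin [set e] (fun _ b => if b then u + k else u - k)) => // q /= pq.
  have [||s [_ es ds]] := near_inner (q := q) eu; rewrite ?pq //.
  exists e, (u <= s); split=> //; case: leP => us; move: es; rewrite pq in ds.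
    by have -> : s = u + k by move: ds us; clear; abs_lra.
  by have -> : s = u - k by move: ds us; clear; abs_lra.
have [r r0 hr] := near_vertex v lf; exists r => // k /andP[k0 kr].
apply: (fin (incident v) (fun e b => if b then k else weight e - k)) => // q /= vq.
have [||e [b [ve _ eq]]] := hr q; rewrite ?vq //.
  by move=> e; move: vq k0; rewrite e mdistxx => <-; rewrite ltxx.
by exists e, b; rewrite -vq.
Qed.

(** A point [z] of the edge near [p] has its orbit in a finite sphere, so a power of [g] fixes it.
    That power fixes [q] too, since the edge and its image could only part at an inner point. *)
Lemma orbit_edge g e (s t : R) p q : locally_finite X -> edge_point e s p ->
  edge_point e t q -> g p = p -> exists2 n : nat, (0 < n)%N & (g ^+ n)%g q = q.
Proof.
move=> lf ep eq gp; have [->|pq] := pselect (q = p); first by exists 1%N.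
have pq0 : 0 < d p q by rewrite mdist_gt0; apply/eqP => e'; exact: pq.
have [r r0 hr] := finite_small_sphere p lf.
pose k := Num.min (d p q / 2) (r / 2).
have [k1 k2] : k <= d p q / 2 /\ k <= r / 2 by rewrite /k !ge_min !lexx orbT.
have k0 : 0 < k by rewrite /k lt_min; apply/andP; split; lra.
have finS := hr k ltac:(lra).
have hk : 0 <= k <= d p q by apply/andP; split; lra.
have [z [pz zq]] := geodesic_edge ep eq hk.
have gnp n : (g ^+ n)%g p = p by elim: n => // n IH; rewrite expgS /= IH.
have [i [j [ij gij]]] : exists i j : nat, (i < j)%N /\ (g ^+ i)%g z = (g ^+ j)%g z.
  apply: (pigeonhole (f := fun n => (g ^+ n)%g z) finS) => n.
  by rewrite /= -{1}(gnp n) aut_isom.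
pose n := (j - i)%N; pose f := (g ^+ n)%g.
have fz : f z = z.
  apply: (can_inj (@aut_funK _ _ (g ^+ i)%g)).
  by rewrite -[LHS]/((g ^+ i * f)%g z) /f -expgnDr /n subnKC 1?ltnW.
have fp : f p = p by exact: gnp.
exists n; first by rewrite subn_gt0.
rewrite -/f; apply: contrapT => fq.
have [m [m1 m2 m3]] := median_ex tree p q (f q).
have dpq : d p (f q) = d p q by rewrite -{1}fp aut_isom.
have zfq : d z (f q) = d z q by rewrite -{1}fz aut_isom.
have qfq : 0 < d q (f q) by rewrite mdist_gt0; apply/eqP => e'; apply: fq.
have hm : k <= d p m < d p q.
  have := metric_triangle q z (f q); move: m1 m2 m3; rewrite /between.
  by rewrite dpq zfq; clear -qfq zq; move=> *; apply/andP; split; dlra.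
have inn : inner_point m.
  have ds := mdist_edge ep eq.
  have /andP[s0 sw] := edge_point_range ep; have /andP[t0 tw] := edge_point_range eq.
  pose u := if s <= t then s + d p m else s - d p m.
  have [hu us ut] : [/\ 0 < u < weight e, `|s - u| = d p m & `|u - t| = d p q - d p m].
    move: hm k0 s0 sw t0 tw; rewrite /u ds; clear; move: (d p m) => D.
    by case: (leP s t) => st /andP[h1 h2] *; split; try (apply/andP; split); abs_lra.
  have [m' em'] := edge_point_ex (e := e) (t := u) ltac:(by case/andP: hu => ? ?; rewrite !ltW).
  suff -> : m = m' by exists e, u.
  apply: (between_uniq tree m1); last by rewrite (mdist_edge ep em') us.
  by rewrite /between (mdist_edge ep em') (mdist_edge em' eq) us ut; lra.
have dm : d m q = d p q - d p m by move: m1; rewrite /between; lra.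
have dm' : d m (f q) = d p q - d p m by move: m3; rewrite /between dpq; lra.
apply: (inner_no_tripod inn _ _ _ m1 m2 m3).
- by move=> e'; move: hm; rewrite e' mdistxx => /andP[]; lra.
- by move=> e'; move: hm; rewrite e' => /andP[]; lra.
- by move=> e'; move: hm; rewrite e' dpq => /andP[]; lra.
Qed.

Lemma orbit_finite g p q : locally_finite X -> g p = p ->
  exists2 n : nat, (0 < n)%N & (g ^+ n)%g q = q.
Proof.
move=> lf; have [L] := chain_ex p q => h; elim: h g => {p q L} [p|e s t p p' q L ep ep' _ IH] g gp.
  by exists 1%N.
have [n n0 gn] := orbit_edge lf ep ep' gp; have [k k0 gk] := IH _ gn.
by exists (n * k)%N; rewrite ?muln_gt0 ?n0 // expgnA.
Qed.

Lemma expg_fix g x (n : nat) : g x = x -> (g ^+ n)%g x = x.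
Proof. by move=> gx; elim: n => // n IH; rewrite expgS /= IH. Qed.

(** Some power fixes the finitely many vertices of the subtree given by discreteness, hence also the
    edges between them. *)
Lemma elliptic_finite_order (G : set (aut X)) g : locally_finite X -> discrete G ->
  is_subgroup G -> G g -> elliptic g -> exists2 n : nat, (0 < n)%N & (g ^+ n = 1)%g.
Proof.
move=> lf [T [finT _ trivT]] [G1 GM _] Gg [p gp].
have [n n0 hn] : exists2 n : nat, (0 < n)%N & forall v, T v -> (g ^+ n)%g (Vert v) = Vert v.
  have [k] := (finite_setP T).1 finT; clear -lf gp; elim: k T => [|k IH] T.
    by rewrite II0 card_eq0 => /eqP ->; exists 1%N.
  move=> /eq_cardSP[v Tv /IH[n n0 hn]].
  have [j j0 hj] := orbit_finite (Vert v) lf gp.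
  exists (n * j)%N; first by rewrite muln_gt0 n0.
  move=> u Tu; have [->|uv] := pselect (u = v).
    by rewrite mulnC expgnA; exact: expg_fix.
  by rewrite expgnA; apply: expg_fix; exact: hn.
exists n => //; apply: trivT.
  by elim: (n) => // k IH; rewrite expgS; exact: GM.
move=> [v|e t ht] /= hx; first exact: hn.
have [hs htg] := hx; have es := hn _ hs; have et := hn _ htg.
have p0 : edge_point e 0 (Vert (src e)) by apply: Or31.
have p1 : edge_point e (weight e) (Vert (tgt e)) by apply: Or32.
have px : edge_point e t (Inner ht) by apply: Or33; exists ht.
have [t0 tw] := andP ht.
have b : between (Vert (src e)) (Inner ht) (Vert (tgt e)).
  by rewrite /between (mdist_edge p0 px) (mdist_edge px p1) (mdist_edge p0 p1); abs_lra.
apply: (between_uniq tree _ b).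
  by rewrite /between -{1}es -{1}et !aut_isom.
by rewrite -{1}es aut_isom.
Qed.

End Orbits.

Section ArcLength.
Context (R : realType) (X : wtree R).
Implicit Types (x y z p q : realization X) (g : aut X) (c : R -> realization X).
Local Notation d := (@mdist R (realization X)).
Local Notation tree := (rtree_realization X).

Lemma line_segmentE c (u v : R) : line c -> u <= v ->
  segment (c u) (c v) = c @` [set t | u <= t <= v].
Proof.
move=> lc uv; apply/seteqP; split=> [z h|_ [t ht <-]]; last exact: between_line.
have hz := between_line_eq tree lc h uv.
have d0 := mdist_ge0 (c u) z; have d1 := mdist_ge0 z (c v).
have : d (c u) (c v) = v - u by rewrite lc distrC ger0_norm // subr_ge0.
move: h; rewrite /segment /= => h huv.
by exists (u + d (c u) z) => //=; apply/andP; split; lra.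
Qed.

Lemma arc_length_ge c (u v : R) (S : set (realization X)) : line c -> u <= v ->
  c @` [set t | u <= t <= v] `<=` S -> ((v - u)%:E <= arc_length S)%E.
Proof.
move=> lc uv cS; apply: ereal_sup_ubound; right; exists (c u), (c v).
by rewrite line_segmentE // lc distrC ger0_norm ?subr_ge0.
Qed.

Lemma arc_length_segment c (u v : R) : line c -> u <= v ->
  arc_length (c @` [set t | u <= t <= v]) = (v - u)%:E.
Proof.
move=> lc uv; apply/eqP; rewrite eq_le (@arc_length_ge c) // andbT.
apply: ge_ereal_sup => _ [->|[x [y [xy ->]]]]; rewrite lee_fin; first by rewrite subr_ge0.
have [|s /andP[? ?] <-] := xy x; first by rewrite /segment /= mdistxx add0r.
have [|t /andP[? ?] <-] := xy y; first by rewrite /segment /= mdistxx addr0.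
by rewrite lc; abs_lra.
Qed.

End ArcLength.

(** * The Euclidean algorithm *)

Section Euclid.
Context (R : realType) (a b : R).
Local Notation m := (mseq a b).
Local Notation q := (qseq a b).
Implicit Types i j k : nat.

Definition mpos n := forall i, (0 < i <= n)%N -> 0 < m i.

Lemma mseq_next i : (0 < i)%N -> 0 < m i -> 0 < m i.+1 ->
  0 <= m i.+2 < m i.+1.
Proof.
move=> i0 mi mi1; rewrite mseqSS // /qseq.
have x0 : 0 <= m i / m i.+1 by rewrite divr_ge0 ?ltW.
have /andP[h1 h2] := truncn_itv x0.
rewrite ler_pdivlMr // in h1; rewrite ltr_pdivrMr // -natr1 mulrDl mul1r in h2.
by apply/andP; split; lra.
Qed.

Lemma qseq_gt0 i : (0 < i)%N -> 0 < m i.+1 -> m i.+1 <= m i -> (0 < q i)%N.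
Proof.
move=> i0 mi1 mle; have x0 : 0 <= m i / m i.+1.
  by rewrite divr_ge0 // ltW // (lt_le_trans mi1).
rewrite lt0n; apply/eqP => q0; have /andP[_] := truncn_itv x0.
by rewrite -/(q i) q0 ltr_pdivrMr // mul1r ltNge mle.
Qed.

Context (b0 : 0 < b) (ba : b <= a).

Lemma mseq_dec i : (0 < i)%N -> mpos i -> 0 <= m i.+1 <= m i.
Proof.
case: i => // -[_ _|i _ pos]; first by rewrite ba (ltW b0).
by have /andP[-> /ltW ->] := mseq_next (ltn0Sn i) (pos i.+1 (leqnSn _)) (pos i.+2 (leqnn _)).
Qed.

Lemma mseq_ge0 i : (0 < i)%N -> (forall j, (0 < j < i)%N -> m j != 0) -> 0 <= m i.
Proof.
elim/ltn_ind: i => -[//|[|[|i]]] IH _ ne.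
- exact: ltW (lt_le_trans b0 ba).
- exact: ltW.
have pos j : (0 < j < i.+3)%N -> 0 < m j.
  move=> /andP[j0 ji]; rewrite lt_neqAle eq_sym ne ?j0 //=; apply: IH => // u /andP[u0 uj].
  by apply: ne; rewrite u0 (ltn_trans uj).
have p1 : 0 < m i.+1 by apply: pos; rewrite /= ltnS leqnSn.
have p2 : 0 < m i.+2 by apply: pos; rewrite /= ltnS leqnn.
by have /andP[] := mseq_next (ltn0Sn i) p1 p2.
Qed.

Lemma mseq_cases : (forall n, mpos n) \/
  exists k, [/\ (1 < k)%N, mpos k & m k.+1 = 0].
Proof.
have [[i /andP[i0 /eqP mi0]]|no] := pselect (exists i, (0 < i)%N && (m i == 0)).
  right; have ex : exists i, (0 < i)%N && (m i == 0).
    by exists i; rewrite i0 mi0 eqxx.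
  case: (ex_minnP ex) => n /andP[n0 /eqP mn] nmin.
  case: n n0 mn nmin => [//|[|[|k]]] _ mn nmin.
  - by move: mn (lt_le_trans b0 ba); rewrite /mseq /= => ->; rewrite ltxx.
  - by move: mn b0; rewrite /mseq /= => ->; rewrite ltxx.
  exists k.+2; split=> // j /andP[j0 jk].
  have ne u : (0 < u <= k.+2)%N -> m u != 0.
    by move=> /andP[u0 uk]; apply/eqP => mu; have := nmin u; rewrite u0 mu eqxx => /(_ isT); rewrite ltnNge uk.
  rewrite lt_neqAle eq_sym ne ?j0 //=; apply: mseq_ge0 => // u /andP[u0 uj].
  by apply: ne; rewrite u0 (leq_trans (ltnW uj)).
left=> n i /andP[i0 _]; have ne u : (0 < u)%N -> m u != 0.
  by move=> u0; apply/negP => mu; apply: no; exists u; rewrite u0.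
by rewrite lt_neqAle eq_sym ne //=; apply: mseq_ge0 => // u /andP[u0 _]; exact: ne.
Qed.

(** Quotients are at least 1, so two steps subtract at least the term in between; terms bounded
    below by [e] would make the odd-indexed ones drop by [e] forever. *)
Lemma mseq_small (e : R) : (forall n, mpos n) -> 0 < e ->
  exists2 i, (0 < i)%N & m i < e.
Proof.
move=> pos e0; apply: contrapT => no.
have ge i : (0 < i)%N -> e <= m i.
  by move=> i0; rewrite leNgt; apply/negP => h; apply: no; exists i.
have dec n : m n.*2.+1 <= a - n%:R * e.
  elim: n => [|n IH]; first by rewrite mul0r subr0.
  rewrite doubleS mseqSS // -natr1 mulrDl mul1r.
  have p1 : 0 < m n.*2.+2 by apply: (pos n.*2.+2); rewrite /= leqnn.
  have q0 : (0 < q n.*2.+1)%N.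
    by apply: qseq_gt0 => //; have /andP[] := mseq_dec (ltn0Sn _) (pos n.*2.+1).
  have : m n.*2.+2 <= (q n.*2.+1)%:R * m n.*2.+2 by rewrite ler_peMl ?ler1n // ltW.
  by have := ge n.*2.+2 isT; lra.
pose n := Num.bound (a / e).
have := archi_boundP (ltW (divr_gt0 (lt_le_trans b0 ba) e0)); rewrite -/n ltr_pdivrMr // => h.
have : 0 < m n.*2.+1 by apply: (pos n.*2.+1); rewrite /= leqnn.
by have := dec n; lra.
Qed.

Lemma common_divisor_sym (x y c : R) : common_divisor x y c -> common_divisor y x c.
Proof. by case. Qed.

Lemma common_divisor_sub (x y c : R) (n : nat) :
  common_divisor (x - n%:R * y) y c <-> common_divisor x y c.
Proof.
split=> [[c0 [u hu] [v hv]]|[c0 [u hu] [v hv]]]; split=> //; try by exists v.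
- exists (u + n%:Z * v); rewrite intrD intrM mulrDl -hu -mulrA -hv.
  by rewrite -[n%:Z%:~R]/(n%:R) addrNK.
- by exists (u - n%:Z * v); rewrite intrD rmorphN /= intrM mulrDl -hu mulNr -mulrA -hv.
Qed.

Lemma mseq_common_divisor i c : (0 < i)%N ->
  common_divisor (m i) (m i.+1) c <-> common_divisor a b c.
Proof.
case: i => // i _; elim: i => [//|i <-]; rewrite [X in common_divisor _ X]mseqSS //.
split=> [/common_divisor_sym|] h; last apply: common_divisor_sym.
  exact: (common_divisor_sub _ _ _ _).1 h.
exact: (common_divisor_sub _ _ _ _).2 h.
Qed.

Section Terminating.
Context (k : nat) (k1 : (1 < k)%N) (pos : mpos k) (mk0 : m k.+1 = 0).

Lemma mseq_last_divisor : common_divisor a b (m k).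
Proof.
have k0 := ltnW k1; apply/(mseq_common_divisor _ k0); rewrite mk0; split.
- by apply: pos; rewrite k0 leqnn.
- by exists 1; rewrite mul1r.
- by exists 0; rewrite mul0r.
Qed.

Lemma mseq_gcd : m k = real_gcd a b.
Proof.
have k0 := ltnW k1; have mk : 0 < m k by apply: pos; rewrite k0 leqnn.
have mx c : common_divisor a b c -> c <= m k.
  move=> /(mseq_common_divisor _ k0)[c0 [z hz] _].
  have z0 : (0 : R) < z%:~R by rewrite -(pmulr_lgt0 _ c0) -hz.
  by rewrite hz ler_peMl ?(ltW c0) // ler1z -gtz0_ge1 -(ltr0z R).
rewrite /real_gcd; case: xgetP => [c _ [dc hc]|/(_ (m k))].
  by apply/eqP; rewrite eq_le mx // hc //; exact: mseq_last_divisor.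
by case; split; [exact: mseq_last_divisor|exact: mx].
Qed.

Lemma mseq_rational : rational (b / a).
Proof.
have [mk [u hu] [v hv]] := mseq_last_divisor.
exists (v%:~R / u%:~R) => //; rewrite fmorph_div /= !ratr_int.
move: mk hu hv; move: (m k) => c c0 -> ->.
by rewrite -mulf_div divff ?mulr1 // gt_eqF.
Qed.

End Terminating.

Lemma mseq_irrational : irrational (b / a) -> forall n, mpos n.
Proof.
move=> irr; case: mseq_cases => // -[k [k1 pos mk0]]; exfalso; apply: irr.
exact: mseq_rational k1 pos mk0.
Qed.

(** All terms are integer multiples of the common divisor [c], so a positive one cannot be smaller
    than [c]. *)
Lemma mseq_rational_ends : rational (b / a) ->
  exists k, [/\ (1 < k)%N, mpos k & m k.+1 = 0].
Proof.
move=> [r _ hr]; case: mseq_cases => // pos; exfalso.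
have a0 := lt_le_trans b0 ba.
pose c := a / (denq r)%:~R.
have d0 : (0 : R) < (denq r)%:~R by rewrite ltr0z denq_gt0.
have c0 : 0 < c by rewrite divr_gt0.
have cd : common_divisor a b c.
  split=> //; first by exists (denq r); rewrite /c mulrC divfK ?gt_eqF.
  exists (numq r); rewrite /c mulrCA -[_ / _]/(ratr r) hr mulrC divfK //.
  by rewrite gt_eqF.
have [i i0 mi] := mseq_small pos c0.
have [_ [z hz] _] := (mseq_common_divisor c i0).2 cd.
have mi0 : 0 < m i by apply: (pos i); rewrite i0 leqnn.
move: mi mi0; rewrite hz pmulr_lgt0 // ltr0z => h z0.
by move: h; rewrite gtr_pMl // ltrz1 ltNge -gtz0_ge1 z0.
Qed.

Section Thresholds.
Context (l : R).

Definition threshold (jq : nat * nat) :=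
  a + b - m jq.1 + (jq.2%:R - 1) * m jq.1.+1 < l /\
  l <= a + b - m jq.1 + jq.2%:R * m jq.1.+1.

(** The lower threshold of round [j] at quotient 0. By [Wstep], [W j.+1] is the upper threshold at
    the last quotient of round [j], so the rounds tile the lengths starting from [W 1 = 0]. *)
Let W j := a + b - m j - m j.+1.

Let Wstep j : (0 < j)%N -> W j.+1 = a + b - m j + ((q j)%:R - 1) * m j.+1.
Proof. by move=> j0; rewrite /W mseqSS //; lra. Qed.

Lemma threshold_ex j0 : 0 < l -> mpos j0.+1 -> l <= a + b - m j0.+1 - m j0.+2 ->
  exists j n, [/\ threshold (j, n), (1 <= j <= j0)%N & (n < q j)%N].
Proof.
move=> l0 pos lj0.
have ex : exists j, l <= W j.+1 by exists j0.
(* The least round whose range reaches [l]; index 0 is excluded because [W 1 = 0]. *)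
case: (ex_minnP ex) => j lW jmin.
have jj0 : (j <= j0)%N by exact: jmin.
have jgt0 : (0 < j)%N.
  by rewrite lt0n; apply/eqP => jz; move: lW; rewrite jz /W /mseq /=; lra.
have Wj : W j < l.
  rewrite ltNge; apply/negP => h; case: j jgt0 lW jmin jj0 h => // j _ _ jmin _ h.
  by have := jmin j h; rewrite ltnn.
have mj1 : 0 < m j.+1 by apply: pos; rewrite /= ltnS jj0.
have pj : mpos j.
  by move=> u /andP[u0 uj]; apply: pos; rewrite u0 (leq_trans uj) // leqW.
have q0 : (0 < q j)%N.
  by apply: qseq_gt0 => //; have /andP[] := mseq_dec jgt0 pj.
have exn : exists n, l <= a + b - m j + n%:R * m j.+1.
  by exists (q j).-1; rewrite -subn1 natrB // -Wstep.
case: (ex_minnP exn) => n ln nmin; exists j, n; split; last 1 first.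
- by rewrite -(prednK q0) ltnS; apply: nmin; rewrite -subn1 natrB // -Wstep.
- split=> //=; case: n ln nmin => [|n] ln nmin.
    by move: Wj; rewrite /W; lra.
  rewrite -natr1 addrK ltNge; apply/negP => h.
  by have := nmin _ h; rewrite ltnn.
- by rewrite jgt0.
Qed.

(** The half-open intervals are consecutive within a round, and [W] is nondecreasing from one round
    to the next. *)
Lemma threshold_uniq j n j' n' : threshold (j, n) -> threshold (j', n') ->
  (0 < j)%N -> (0 < j')%N -> (n < q j)%N -> (n' < q j')%N ->
  mpos j.+1 -> mpos j'.+1 -> (j, n) = (j', n').
Proof.
have wl u v u' v' : threshold (u, v) -> threshold (u', v') ->
    (0 < u)%N -> (v < q u)%N -> mpos u.+1 -> mpos u'.+1 -> (u < u')%N -> False.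
  move=> [_ /= h1] [/= h2 _] u0 vq posu pos uu.
  have mu1 : 0 < m u.+1 by apply: posu; rewrite /= leqnn.
  have : l <= W u.+1.
    rewrite Wstep //; apply: le_trans h1 _; rewrite lerD2l ler_pM2r //.
    by rewrite lerBrDr natr1 ler_nat.
  have Wu : W u' < l.
    apply: le_lt_trans h2; have mu' : 0 < m u'.+1 by apply: pos; rewrite /= leqnn.
    have vm : 0 <= v'%:R * m u'.+1 by rewrite mulr_ge0 // ltW.
    by rewrite /W; lra.
  rewrite leNgt (le_lt_trans _ Wu) //.
  have Wm i : (0 < i < u')%N -> W i <= W i.+1.
    move=> /andP[i0 iu]; rewrite Wstep // /W.
    have mi1 : 0 < m i.+1 by apply: pos; rewrite /= ltnS ltnW.
    have qm : 0 <= (q i)%:R * m i.+1 by rewrite mulr_ge0 // ltW.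
    by lra.
  move: uu; elim: u' Wm {h2 pos Wu} => // u' IH Wm; rewrite ltnS leq_eqVlt => /orP[/eqP ->//|uu].
  apply: le_trans (Wm u' _); last by rewrite ltnSn (leq_ltn_trans _ uu).
  by apply: IH => // i /andP[i0 iu]; apply: Wm; rewrite i0 ltnW.
move=> h h' j0 j'0 nq nq' pos pos'.
case: (ltngtP j j') => jj; [by case: (wl _ _ _ _ h h')|by case: (wl _ _ _ _ h' h)|].
subst j'; congr pair; have mj1 : 0 < m j.+1 by apply: pos; rewrite /= leqnn.
have wn u v : threshold (j, u) -> threshold (j, v) -> (u < v)%N -> False.
  move=> [_ /= h1] [/= h2 _] uv; move: (lt_le_trans h2 h1).
  by rewrite ltrD2l ltr_pM2r // ltrBlDr natr1 ltr_nat ltnS leqNgt uv.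
by case: (ltngtP n n') => // nn; [case: (wn _ _ h h' nn)|case: (wn _ _ h' h nn)].
Qed.

End Thresholds.
End Euclid.

(** * Pairs of hyperbolic automorphisms *)

Section Coherent.
Context (R : realType) (X : wtree R).
Implicit Types (x y z v : realization X) (a h g : aut X) (L m n : R).
Local Notation d := (@mdist R (realization X)).
Local Notation tree := (rtree_realization X).

(* Hyperbolic automorphisms translating in the same direction along the
   intersection of their axes, a segment of length [L] ending at [v]. *)
Definition coherent v a h m n L := exists al be : R -> realization X,
  [/\ axis_line a al m, axis_line h be n, al 0 = v & overlap al be L].

Lemma divg_act a h x : (h * a^-1)%g (a x) = h x.
Proof. by rewrite /= aut_funK. Qed.

Lemma coherent_sym v a h m n L : 0 <= L -> coherent v a h m n L ->
  coherent v h a n m L.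
Proof.
move=> L0 [al [be [A B a0 ov]]]; exists be, al; split=> //; last exact: overlap_sym.
by rewrite -a0; apply/esym/ov; rewrite oppr_le0 L0 lexx.
Qed.

Lemma coherent_axes v a h m n L : coherent v a h m n L ->
  [/\ hyperbolic a, hyperbolic h, translation_length a = m &
      translation_length h = n].
Proof.
move=> [al [be [A B _ _]]]; split; [exact: axis_line_hyperbolic A|
  exact: axis_line_hyperbolic B|exact: axis_line_length A|exact: axis_line_length B].
Qed.

Lemma coherent_reduce v a h m n L : coherent v a h m n L -> m < L -> m < n ->
  coherent v a (h * a^-1)%g m (n - m) (L - m).
Proof.
move=> [al [be [A B a0 ov]]] mL mn; have [la m0 ga] := A; have [lb n0 hb] := B.
have fa t : (h * a^-1)%g (al (t + m)) = h (al t) by rewrite -ga divg_act.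
have [c [lc fc ovc]] := reduce_hyperbolic tree (aut_isom (h * a^-1)%g)
  (@aut_funK _ _ (h * a^-1)%g) (@aut_invK _ _ (h * a^-1)%g) (aut_isom h) la lb fa hb
  m0 ov mL mn.
by exists al, c; split=> //; split=> //; lra.
Qed.

Lemma coherent_meet v a h m n L : 0 < L -> coherent v a h m n L ->
  (exists u, axis a `&` axis h = segment u v) /\
  arc_length (axis a `&` axis h) = L%:E.
Proof.
move=> L0 [al [be [A B a0 ov]]]; have [la m0 ga] := A; have [lb n0 hb] := B.
have E : axis a `&` axis h = al @` [set t | - L <= t <= 0].
  rewrite (axis_lineE A) (axis_lineE B); apply/seteqP; split=> [x [[s _ <-] [t _]]|_ [t ht <-]].
    by move=> /esym /(overlap_meet tree la lb L0 ov)[_ hs]; exists s.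
  by split; [exists t|exists t => //; apply/esym/ov].
rewrite E; split; last by rewrite arc_length_segment ?sub0r ?opprK // oppr_le0 ltW.
by exists (al (- L)); rewrite -a0 line_segmentE // oppr_le0 ltW.
Qed.

Lemma coherent_schottky v a h m n L : locally_finite X -> coherent v a h m n L ->
  0 < L -> L < m -> L < n -> schottky_pair a h /\ free_of_rank 2 (generated [set a; h]).
Proof.
move=> lf [al [be [A B a0 ov]]] L0 Lm Ln; have [la _ _] := A; have [lb _ _] := B.
apply: (schottky_of_separated lf A B (separated_overlap tree la lb L0 ov)); lra.
Qed.

Lemma coherent_div_neq1 v a h m n L : 0 < L -> coherent v a h m n L ->
  (h * a^-1)%g <> 1%g.
Proof.
move=> L0 [al [be [A B a0 ov]]]; have [la m0 ga] := A; have [lb n0 hb] := B.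
have fa t : (h * a^-1)%g (al (t + m)) = h (al t) by rewrite -ga divg_act.
have [x fx] := quotient_nontrivial tree (aut_isom h) la lb fa hb m0 ov L0 n0.
by move=> e; apply: fx; rewrite e.
Qed.

Lemma coherent_elliptic v a h m L : coherent v a h m m L -> m < L ->
  [/\ elliptic (h * a^-1)%g,
      exists u, axis a `&` fixed_set (h * a^-1)%g = segment u v &
      arc_length (axis a `&` fixed_set (h * a^-1)%g) = (L - m)%:E].
Proof.
move=> [al [be [A B a0 ov]]] mL; have [la m0 ga] := A; have [lb n0 hb] := B.
have fa t : (h * a^-1)%g (al (t + m)) = h (al t) by rewrite -ga divg_act.
have fix_al := reduce_elliptic tree (aut_isom h) la lb fa hb m0 ov mL erefl.
have E : axis a `&` fixed_set (h * a^-1)%g = al @` [set t | - (L - m) <= t <= 0].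
  rewrite (axis_lineE A); apply/seteqP; split=> [x [[s _ <-]]|_ [t /fix_al ht <-]].
    by move=> /fix_al hs; exists s.
  by split=> //; exists t.
split.
- by exists v; rewrite -a0; apply/fix_al; rewrite lexx andbT; lra.
- by exists (al (- (L - m))); rewrite E -a0 line_segmentE //; lra.
- by rewrite E arc_length_segment ?sub0r ?opprK //; lra.
Qed.

Lemma set_distE (A B : set (realization X)) x y : A x -> B y ->
  (forall u w, A u -> B w -> d x y <= d u w) -> set_dist A B = d x y.
Proof.
move=> Ax By lb; apply/eqP; rewrite eq_le; apply/andP; split.
  apply: ge_inf; last by exists x => //; exists y.
  by exists (d x y) => _ [u Au [w Bw <-]]; exact: lb.
apply: lb_le_inf; first by exists (d x y), x => //; exists y.
by move=> _ [u Au [w Bw <-]]; exact: lb.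
Qed.

Lemma bridge_axes a g (al ga : R -> realization X) m n s0 t0 D :
  locally_finite X -> axis_line a al m -> axis_line g ga n ->
  (forall s t, d (al s) (ga t) = `|s - s0| + D + `|t - t0|) -> 0 <= D ->
  [/\ schottky_pair a g, free_of_rank 2 (generated [set a; g]),
      share_no_segment (axis a) (axis g) & set_dist (axis a) (axis g) = D].
Proof.
move=> lf A C br D0; have [la m0 _] := A; have [lc n0 _] := C.
have [S F] : schottky_pair a g /\ free_of_rank 2 (generated [set a; g]).
  by apply: (schottky_of_separated lf A C (separated_bridge tree la lc br)); rewrite ?subrr.
split=> //.
  move=> x y xy; have pt z : segment x y z -> z = al s0.
    move=> /xy; rewrite (axis_lineE A) (axis_lineE C) => -[[s _ <-] [t _ e]].
    have := br s t; rewrite e mdistxx => h; congr al; move: h D0; clear; abs_lra.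
  have ex : x = al s0 by apply: pt; rewrite /segment /= mdistxx add0r.
  have ey : y = al s0 by apply: pt; rewrite /segment /= mdistxx addr0.
  exact: etrans ex (esym ey).
have dD : d (al s0) (ga t0) = D by rewrite br !subrr normr0 add0r addr0.
rewrite -dD (axis_lineE A) (axis_lineE C); apply: set_distE; [by exists s0|by exists t0|].
by move=> _ _ [s _ <-] [t _ <-]; rewrite dD br; abs_lra.
Qed.

Lemma disjoint_axes g1 g2 : locally_finite X -> hyperbolic g1 -> hyperbolic g2 ->
  share_no_segment (axis g1) (axis g2) ->
  schottky_pair g1 g2 /\ free_of_rank 2 (generated [set g1; g2]).
Proof.
move=> lf /axis_line_ex[c1 [m1 A]] /axis_line_ex[c2 [m2 B]] no.
have [l1 _ _] := A; have [l2 _ _] := B.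
have [|s0 [t0 [D [D0 br]]]] := bridge_ex tree l1 l2.
  by move=> x y; rewrite -(axis_lineE A) -(axis_lineE B); exact: no.
by have [] := bridge_axes lf A B br D0.
Qed.

Lemma coherent_period v a h m n : locally_finite X -> coherent v a h m n m -> m <= n ->
  let b := (h * a^-1)%g in
  let l0 := arc_length (axis h `&` (a @` axis h)) in
  let M := n - m in
  (((M / 2)%:E <= l0)%E -> [/\ elliptic b, share_no_segment (axis a) (fixed_set b)
      & set_dist (axis a) (fixed_set b) = M / 2]) /\
  ((l0 < (M / 2)%:E)%E ->
    [/\ schottky_pair a b, free_of_rank 2 (generated [set a; b]),
        translation_length b = M - 2 * fine l0,
        share_no_segment (axis a) (axis b)
      & set_dist (axis a) (axis b) = fine l0]).
Proof.
move=> lf [al [be [A B a0 ov]]] mn b l0 M; have [la m0 ga] := A; have [lb n0 hb] := B.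
have M0 : 0 <= M by rewrite /M subr_ge0.
pose c (t : R) := a (be (t - m)).
have lc : line c by move=> s t; rewrite aut_isom lb; congr Num.norm; lra.
have lc' : line (fun t => c (- t)) by exact: line_opp.
have bc0 : be 0 = c (- 0).
  rewrite /c oppr0 sub0r; have <- : al (- m) = be (- m) by apply/ov; lra.
  by rewrite ga addNr; apply/esym/ov; lra.
have meet x : (axis h `&` (a @` axis h)) x <-> exists2 t, 0 <= t & x = be t /\ x = c (- t).
  rewrite (axis_lineE B).
  exact: (axes_quotient_meet tree (aut_isom a) la lb ga m0 ov).
have ell : be (M / 2) = c (- (M / 2)) -> [/\ elliptic b,
    share_no_segment (axis a) (fixed_set b) & set_dist (axis a) (fixed_set b) = M / 2].
  move=> e; have [y [by0 ay hy]] := last_step_elliptic tree (aut_isom b) (aut_isom a)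
    (@aut_invK _ _ a) (aut_isom h) la lb ga hb (divg_act a h) m0 mn ov e.
  split; first by exists y.
    move=> x z xz; have pt w : segment x z w -> w = al 0.
      move=> /xz; rewrite (axis_lineE A) => -[[s _ <-] fs].
      by have [_ /(_ erefl) ->] := hy s _ fs.
    have ex : x = al 0 by apply: pt; rewrite /segment /= mdistxx add0r.
    have ez : z = al 0 by apply: pt; rewrite /segment /= mdistxx addr0.
    exact: etrans ex (esym ez).
  rewrite -/M in ay; rewrite -ay (axis_lineE A); apply: set_distE => //.
  move=> _ w [s _ <-] fw; rewrite ay; have [h'' _] := hy s _ fw.
  by have := normr_ge0 s; rewrite -/M in h''; lra.
(* If the rays never part, [l0] need not be finite, but then only the elliptic alternative can
   occur. Otherwise [D] is [l0]. *)
have [agree|[D [D0 agree far]]] := fork tree lb lc' bc0.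
  have e : be (M / 2) = c (- (M / 2)) by apply: agree; rewrite divr_ge0.
  split=> [_|]; first exact: ell.
  rewrite ltNge; have -> // : ((M / 2)%:E <= l0)%E.
  rewrite -[M / 2]subr0; apply: (arc_length_ge (c := be) lb); first by rewrite divr_ge0.
  move=> _ [t /= /andP[t0 _] <-]; apply/meet; exists t => //; split=> //; exact: agree.
have l0D : l0 = D%:E.
  rewrite /l0 (_ : _ `&` _ = be @` [set t | 0 <= t <= D]) ?arc_length_segment ?subr0 //.
  apply/seteqP; split=> [x /meet[t t0 [xb xc]]|_ [t /= ht <-]]; last first.
    apply/meet; exists t; first by case/andP: ht.
    by split=> //; exact: agree.
  exists t => //=; rewrite t0 /= leNgt; apply/negP => Dt.
  have := far t t (ltW Dt) (ltW Dt); rewrite -xb -xc mdistxx; lra.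
rewrite l0D lee_fin lte_fin /=; split=> [MD|DM].
  by apply: ell; apply: agree; rewrite divr_ge0.
have [e [le be' br]] := last_step_hyperbolic tree (aut_isom b) (@aut_funK _ _ b)
  (@aut_invK _ _ b) (aut_isom a) la lb ga hb (divg_act a h) m0 ov D0 DM agree far.
rewrite -/M in be'.
have E : axis_line b e (M - 2 * D) by split=> //; lra.
have br' s t : d (al s) (e t) = `|s - 0| + D + `|t - 0| by rewrite !subr0.
have [S F N dst] := bridge_axes lf A E br' D0.
by split=> //; exact: axis_line_length E.
Qed.

(** On both axes the segment from [vm] to [v] takes up a parameter interval of length [l], so moving
    [v] to parameter 0 aligns the two. [g2] is listed first as the divisor of the first round. *)
Lemma coherent_start g1 g2 vm v l :
  0 < translation_length g1 -> 0 < translation_length g2 ->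
  0 < l -> arc_length (axis g1 `&` axis g2) = l%:E ->
  axis g1 `&` axis g2 = segment vm v -> translates_toward g1 vm v ->
  translates_toward g2 vm v ->
  coherent v g2 g1 (translation_length g2) (translation_length g1) l.
Proof.
move=> m1 m2 l0 arc ax [c1 [l1 r1 t1 [s1 [u1 [su1 cs1 cu1]]]]]
  [c2 [l2 r2 t2 [s2 [u2 [su2 cs2 cu2]]]]].
have ul1 : u1 - s1 = l.
  apply/eqP; rewrite -eqe -arc ax -cs1 -cu1 line_segmentE ?ltW //.
  by rewrite arc_length_segment // ltW.
have ul2 : u2 - s2 = l.
  apply/eqP; rewrite -eqe -arc ax -cs2 -cu2 line_segmentE ?ltW //.
  by rewrite arc_length_segment // ltW.
have A1 : axis_line g1 c1 (translation_length g1) by [].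
have A2 : axis_line g2 c2 (translation_length g2) by [].
exists (fun t => c2 (t + u2)), (fun t => c1 (t + u1)).
split; [exact: axis_line_shift A2|exact: axis_line_shift A1|by rewrite add0r|].
move=> t; split=> [e|ht]; last first.
  apply: (lines_agree tree (line_shift u2 l2) (line_shift u1 l1) _ _ ht).
    have -> : - l + u2 = s2 by lra.
    by rewrite cs2 -cs1; congr c1; lra.
  by rewrite !add0r cu1.
have : (axis g1 `&` axis g2) (c1 (t + u1)).
  by split; [rewrite -r1; exists (t + u1)|rewrite -r2 -e; exists (t + u2)].
rewrite ax -cs1 -cu1 (line_segmentE l1 (ltW su1)) => -[s /= /andP[? ?] /(line_inj l1) st].
by apply/andP; split; lra.
Qed.

End Coherent.

(** * The Euclidean algorithm on the pair of automorphisms *)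

Section Algorithm.
Context (R : realType) (X : wtree R) (g1 g2 : aut X) (vp : realization X) (l : R).
Local Notation m1 := (translation_length g1).
Local Notation m2 := (translation_length g2).
Local Notation Gamma := (generated [set g1; g2]).
Local Notation m := (mseq m1 m2).
Local Notation q_ := (qseq m1 m2).
Local Notation gam := (gseq g1 g2).
Local Notation pos := (mpos m1 m2).

Lemma mul_invgS (G : groupType) (x y : G) (n : nat) :
  (x * y ^- n.+1 = x * y ^- n * y^-1)%g.
Proof. by rewrite expgS invgM mulgA. Qed.

Lemma gseq_generated j n : (0 < j)%N ->
  generated [set gam j.+1; (gam j * gam j.+1 ^- n)%g] = Gamma.
Proof.
case: j => // j _; rewrite generated_mulV; elim: j => [|j IH].
  by rewrite generated_swap.
by rewrite generated_swap (gseqSS g1 g2 (ltn0Sn j)) generated_mulV.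
Qed.

(** At least one more subtraction is possible in the round, so the divisor still has the smaller
    translation length. *)
Lemma mseq_room j n : (0 < j)%N -> pos j.+1 -> (n < q_ j)%N ->
  m j.+1 <= m j - n%:R * m j.+1.
Proof.
move=> j0 pj nq.
have p1 : 0 < m j by apply: pj; rewrite j0 /=.
have p2 : 0 < m j.+1 by apply: pj; rewrite /= leqnn.
have /andP[h _] := mseq_next j0 p1 p2; rewrite mseqSS // in h.
have : n.+1%:R * m j.+1 <= (q_ j)%:R * m j.+1 by rewrite ler_pM2r // ler_nat.
by rewrite -natr1 mulrDl mul1r; lra.
Qed.

(** Within a round, positivity of the two lengths at n + 1 is exactly what [coherent_reduce] needs
    at n. After [q_ j] subtractions the pair is swapped and becomes the case n = 0 of the next
    round. *)
Lemma coherent_gseq j n : 0 <= l -> coherent vp g2 g1 m2 m1 l -> (0 < j)%N -> pos j.+1 ->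
  0 < m j - n%:R * m j.+1 ->
  0 < l - m1 - m2 + m j - (n%:R - 1) * m j.+1 ->
  coherent vp (gam j.+1) (gam j * gam j.+1 ^- n)%g (m j.+1) (m j - n%:R * m j.+1)
    (l - m1 - m2 + m j - (n%:R - 1) * m j.+1).
Proof.
move=> l0 start; case: j => // j _; elim: j n => [|j IHj] n pj.
  elim: n => [|n IHn] p L.
    rewrite expg0 invg1 mulg1 mul0r subr0 /mseq /=.
    by have -> : l - m1 - m2 + m1 - (0 - 1) * m2 = l by lra.
  have m0 : 0 < m 2 by apply: pj.
  move: p L; rewrite -natr1 mulrDl mul1r addrK => p L.
  have := coherent_reduce (IHn ltac:(lra) ltac:(lra)) ltac:(lra) ltac:(lra).
  rewrite mul_invgS; congr (coherent _ _ _ _ _ _); lra.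
have m0 : 0 < m j.+3 by apply: pj; rewrite /= leqnn.
elim: n => [|n IHn] p L.
  rewrite expg0 invg1 mulg1 mul0r subr0.
  have pj' : pos j.+2 by move=> i /andP[i0 ij]; apply: pj; rewrite i0 leqW.
  have E : m j.+1 - (q_ j.+1)%:R * m j.+2 = m j.+3 by rewrite [RHS]mseqSS.
  have E' : l - m1 - m2 + m j.+1 - ((q_ j.+1)%:R - 1) * m j.+2 =
      l - m1 - m2 + m j.+2 - (0 - 1) * m j.+3 by rewrite -E; lra.
  have := IHj (q_ j.+1) pj'; rewrite E E' => /(_ m0 L).
  rewrite -gseqSS //; apply: coherent_sym; exact: ltW.
move: p L; rewrite -natr1 mulrDl mul1r addrK => p L.
have := coherent_reduce (IHn ltac:(lra) ltac:(lra)) ltac:(lra) ltac:(lra).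
rewrite mul_invgS; congr (coherent _ _ _ _ _ _); lra.
Qed.

Context (lf : locally_finite X) (disc : discrete Gamma) (l0 : 0 < l)
  (start : coherent vp g2 g1 m2 m1 l).

Lemma elliptic_not_free v a h p n L : coherent v a h p n L -> 0 < L ->
  generated [set a; (h * a^-1)%g] = Gamma -> elliptic (h * a^-1)%g -> ~ is_free Gamma.
Proof.
move=> coh L0 gen ell; have Gb : Gamma (h * a^-1)%g by rewrite -gen; apply: generated_incl; right.
have [k k0 bk] := elliptic_finite_order lf disc (generated_subgroup _) Gb ell.
exact: not_free_torsion Gb (coherent_div_neq1 L0 coh) k0 bk.
Qed.

(** Equality in the upper threshold means that the current overlap is exactly [m j.+1], one period
    of the divisor. *)
Lemma gseq_period j n : (0 < j)%N -> pos j.+1 -> (n < q_ j)%N ->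
  l = m1 + m2 - m j + n%:R * m j.+1 ->
  let h := (gam j * gam j.+1 ^- n)%g in
  let l0 := arc_length (axis h `&` (gam j.+1 @` axis h)) in
  let ga := gam j.+1 in
  let gb := (gam j * gam j.+1 ^- n.+1)%g in
  let M := m j - n.+1%:R * m j.+1 in
  [/\ hyperbolic h, generated [set ga; gb] = Gamma,
      hyperbolic ga /\ translation_length ga = m j.+1,
      ((M / 2)%:E <= l0)%E ->
        [/\ ~ is_free Gamma, elliptic gb,
            share_no_segment (axis ga) (fixed_set gb)
          & set_dist (axis ga) (fixed_set gb) = M / 2]
    & (l0 < (M / 2)%:E)%E ->
        [/\ free_of_rank 2 Gamma, schottky_pair ga gb,
            translation_length gb = M - 2 * fine l0,
            share_no_segment (axis ga) (axis gb)
          & set_dist (axis ga) (axis gb) = fine l0]].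
Proof.
move=> j0 pj nq le h len ga gb M.
have room := mseq_room j0 pj nq.
have p0 : 0 < m j.+1 by apply: pj; rewrite /= leqnn.
have LE : l - m1 - m2 + m j - (n%:R - 1) * m j.+1 = m j.+1 by rewrite le; lra.
have := coherent_gseq (ltW l0) start j0 pj (n := n); rewrite LE => /(_ ltac:(lra) p0) coh.
have [ha hh ta th] := coherent_axes coh.
have gbE : gb = (h * ga^-1)%g by rewrite /gb mul_invgS.
have ME : M = m j - n%:R * m j.+1 - m j.+1 by rewrite /M -natr1; lra.
have gen : generated [set ga; gb] = Gamma by exact: gseq_generated.
have [c1 c2] := coherent_period lf coh room.
rewrite -/h -/ga -gbE -ME -/len in c1 c2.
split=> // [/c1[ell no dst]|/c2[sch fr tl no dst]].
  split=> //; rewrite gbE in ell gen; exact: elliptic_not_free coh p0 gen ell.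
by rewrite gen in fr.
Qed.

(** The strict thresholds say that the current overlap is positive and shorter than both translation
    lengths. *)
Lemma gseq_short j n : (0 < j)%N -> pos j.+1 -> (n < q_ j)%N ->
  m1 + m2 - m j + (n%:R - 1) * m j.+1 < l ->
  l < m1 + m2 - m j + n%:R * m j.+1 ->
  let ga := gam j.+1 in
  let gb := (gam j * gam j.+1 ^- n)%g in
  [/\ free_of_rank 2 Gamma /\ schottky_pair ga gb, generated [set ga; gb] = Gamma,
      hyperbolic ga /\ translation_length ga = m j.+1,
      hyperbolic gb /\ translation_length gb = m j - n%:R * m j.+1
    & (exists u, axis ga `&` axis gb = segment u vp) /\
      arc_length (axis ga `&` axis gb) =
        (l - m1 - m2 + m j - (n%:R - 1) * m j.+1)%:E].
Proof.
move=> j0 pj nq lo hi ga gb.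
have room := mseq_room j0 pj nq.
have p0 : 0 < m j.+1 by apply: pj; rewrite /= leqnn.
have L0 : 0 < l - m1 - m2 + m j - (n%:R - 1) * m j.+1 by lra.
have coh := coherent_gseq (ltW l0) start j0 pj (n := n) ltac:(lra) L0.
have gen : generated [set ga; gb] = Gamma by exact: gseq_generated.
have [ha hb ta tb] := coherent_axes coh.
have [sch fr] := coherent_schottky lf coh L0 ltac:(lra) ltac:(lra).
by rewrite gen in fr; split=> //; exact: coherent_meet coh.
Qed.

Lemma gseq_long k : (1 < k)%N -> pos k -> m k.+1 = 0 -> m1 + m2 - m k < l ->
  let ga := gam k in
  let gb := gam k.+1 in
  [/\ ~ is_free Gamma, generated [set ga; gb] = Gamma,
      hyperbolic ga /\ translation_length ga = m k,
      elliptic gb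
    & (exists u, axis ga `&` fixed_set gb = segment u vp) /\
      arc_length (axis ga `&` fixed_set gb) = (l - m1 - m2 + m k)%:E].
Proof.
case: k => [//|[//|k]] _ pk mk lk ga gb.
have p0 : 0 < m k.+2 by apply: pk; rewrite /= leqnn.
have p1 : 0 < m k.+1 by apply: pk; rewrite /= leqnSn.
have mE := mseqSS m1 m2 (ltn0Sn k); rewrite mk in mE.
have : (0 < q_ k.+1)%N.
  by rewrite lt0n; apply/eqP => q0; move: mE; rewrite q0 mul0r; lra.
(* One subtraction before the end of the last round both translations have length [m k.+2], and the
   overlap is [l - m1 - m2 + 2 * m k.+2]. *)
case E : (q_ k.+1) mE => [//|n] mE _; rewrite -natr1 mulrDl mul1r in mE.
have nE : m k.+1 - n%:R * m k.+2 = m k.+2 by lra.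
have L0 : 0 < l - m1 - m2 + m k.+1 - (n%:R - 1) * m k.+2 by lra.
have := coherent_gseq (ltW l0) start (ltn0Sn k) pk (n := n); rewrite nE => /(_ p0 L0) coh.
have gbE : gb = (gam k.+1 * gam k.+2 ^- n * (gam k.+2)^-1)%g.
  by rewrite /gb gseqSS // E mul_invgS.
have [ell [u fixE] arc] := coherent_elliptic coh ltac:(lra).
have gen : generated [set ga; gb] = Gamma by rewrite /gb gseqSS //; exact: gseq_generated.
have [ha _ ta _] := coherent_axes coh.
rewrite -gbE in ell fixE arc; split=> //.
  rewrite gbE in ell gen; exact: elliptic_not_free coh L0 gen ell.
split; first by exists u.
by rewrite arc; congr (_%:E); lra.
Qed.

(** Under [m1 + m2 <= l] the overlap remains positive in every round and always ends at [vp], where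
    [overlap_translation_lb] gives one bound for all translation lengths. *)
Lemma gseq_overlap_bound : (forall n, pos n) -> m2 <= m1 -> 0 < m2 -> ~ (m1 + m2 <= l).
Proof.
move=> pos_all m21 m20 lS.
have [r r0 hr] := overlap_translation_lb vp lf.
have [[//|i] _ mi] := mseq_small m20 m21 pos_all r0.
have p1 : 0 < m i.+1 by apply: (pos_all i.+1); rewrite /= leqnn.
have p2 : 0 < m i.+2 by apply: (pos_all i.+2); rewrite /= leqnn.
have L0 : 0 < l - m1 - m2 + m i.+1 - (0%:R - 1) * m i.+2 by lra.
have [al [be [A B a0 ov]]] := coherent_gseq (ltW l0) start (ltn0Sn i) (pos_all i.+2)
  (n := 0%N) ltac:(lra) L0.
have [lb _ _] := B; have := hr _ _ _ _ _ A lb L0 ov a0.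
by have /andP[_] := mseq_dec m20 m21 (ltn0Sn i) (pos_all i.+1); lra.
Qed.

End Algorithm.

Lemma arc_length_ge0 (R : realType) (X : wtree R) (S : set (realization X)) :
  (0 <= arc_length S)%E.
Proof. by apply: ereal_sup_ubound; left. Qed.

Lemma arc_length0 (R : realType) (X : wtree R) (A B : set (realization X)) :
  arc_length (A `&` B) = 0%:E -> share_no_segment A B.
Proof.
move=> arc x y xy; apply: mdist_positivity; apply/eqP.
rewrite eq_le mdist_ge0 andbT -lee_fin -arc.
by apply: ereal_sup_ubound; right; exists x, y.
Qed.

Theorem theorem4p8 (R : realType) (X : wtree R) (g1 g2 : aut X)
    (vm vp : realization X) (l : R) :
  let m1 := translation_length g1 in
  let m2 := translation_length g2 in
  let Gamma := generated [set g1; g2] in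
  let m := mseq m1 m2 in
  let q_ := qseq m1 m2 in
  let gam := gseq g1 g2 in
  locally_finite X ->
  hyperbolic g1 -> hyperbolic g2 -> m2 <= m1 -> 0 < m2 ->
  discrete Gamma ->
  arc_length (axis g1 `&` axis g2) = l%:E ->
  (0 < l -> [/\ axis g1 `&` axis g2 = segment vm vp,
                translates_toward g1 vm vp & translates_toward g2 vm vp]) ->
  (rational (m2 / m1) ->
    exists k : nat,
      [/\ (0 < k)%N, forall i, (0 < i <= k)%N -> 0 < m i,
          m k.+1 = 0, m k = real_gcd m1 m2
        & exactly_one
          (* A1 *)
          [/\ l = 0,
              free_of_rank 2 Gamma,
              generated [set g1; g2] = Gamma,
              schottky_pair g1 g2
            & share_no_segment (axis g1) (axis g2)]
          (* A2 *)
          (0 < l <= m1 + m2 - real_gcd m1 m2 /\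
           exists j q : nat,
           [/\ unique (fun jq : nat * nat =>
                  [/\ m1 + m2 - m jq.1 + (jq.2%:R - 1) * m jq.1.+1 < l,
                      l <= m1 + m2 - m jq.1 + jq.2%:R * m jq.1.+1,
                      (1 <= jq.1 <= k.-1)%N & (jq.2 < q_ jq.1)%N]) (j, q),
               (* A2a *)
               (l = m1 + m2 - m j + q%:R * m j.+1 ->
                let h := (gam j * gam j.+1 ^- q)%g in
                let l0 := arc_length (axis h `&` (gam j.+1 @` axis h)) in
                let ga := gam j.+1 in
                let gb := (gam j * gam j.+1 ^- q.+1)%g in
                let M := m j - q.+1%:R * m j.+1 in
                [/\ hyperbolic h, generated [set ga; gb] = Gamma,
                    hyperbolic ga /\ translation_length ga = m j.+1,
                    ((M / 2)%:E <= l0)%E ->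
                      [/\ ~ is_free Gamma, elliptic gb,
                          share_no_segment (axis ga) (fixed_set gb)
                        & set_dist (axis ga) (fixed_set gb) = M / 2]
                  & (l0 < (M / 2)%:E)%E ->
                      [/\ free_of_rank 2 Gamma, schottky_pair ga gb,
                          translation_length gb = M - 2 * fine l0,
                          share_no_segment (axis ga) (axis gb)
                        & set_dist (axis ga) (axis gb) = fine l0]])
               (* A2b *)
             & (l < m1 + m2 - m j + q%:R * m j.+1 ->
                let ga := gam j.+1 in
                let gb := (gam j * gam j.+1 ^- q)%g in
                [/\ free_of_rank 2 Gamma,
                    schottky_pair ga gb /\ generated [set ga; gb] = Gamma,
                    translation_length ga = m j.+1 /\
                      translation_length gb = m j - q%:R * m j.+1,
                    exists u, axis ga `&` axis gb = segment u vp
                  & arc_length (axis ga `&` axis gb) =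
                      (l - m1 - m2 + m j - (q%:R - 1) * m j.+1)%:E])])
          (* A3 *)
          (m1 + m2 - real_gcd m1 m2 < l /\
           let ga := gam k in
           let gb := gam k.+1 in
           [/\ ~ is_free Gamma, generated [set ga; gb] = Gamma,
               hyperbolic ga /\ translation_length ga = m k,
               elliptic gb
             & (exists u, axis ga `&` fixed_set gb = segment u vp) /\
               arc_length (axis ga `&` fixed_set gb) =
                 (l - m1 - m2 + m k)%:E])])
  /\
  (irrational (m2 / m1) ->
    [/\ forall i, (0 < i)%N -> 0 < m i,
        (* B1 *)
        [/\ l = 0,
            free_of_rank 2 Gamma,
            generated [set g1; g2] = Gamma
          & share_no_segment (axis g1) (axis g2)] \/
        (* B2 *)
        (0 < l < m1 + m2 /\
         exists j q : nat,
         [/\ unique (fun jq : nat * nat =>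
                [/\ m1 + m2 - m jq.1 + (jq.2%:R - 1) * m jq.1.+1 < l,
                    l <= m1 + m2 - m jq.1 + jq.2%:R * m jq.1.+1,
                    (1 <= jq.1)%N & (jq.2 < q_ jq.1)%N]) (j, q),
             (* B2a *)
             (l = m1 + m2 - m j + q%:R * m j.+1 ->
              let h := (gam j * gam j.+1 ^- q)%g in
              let l0 := arc_length (axis h `&` (gam j.+1 @` axis h)) in
              let ga := gam j.+1 in
              let gb := (gam j * gam j.+1 ^- q.+1)%g in
              let M := m j - q.+1%:R * m j.+1 in
              [/\ hyperbolic h, generated [set ga; gb] = Gamma,
                  hyperbolic ga /\ translation_length ga = m j.+1,
                  ((M / 2)%:E <= l0)%E ->
                    [/\ ~ is_free Gamma, elliptic gb,
                        share_no_segment (axis ga) (fixed_set gb)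
                      & set_dist (axis ga) (fixed_set gb) = M / 2]
                & (l0 < (M / 2)%:E)%E ->
                    [/\ free_of_rank 2 Gamma,
                        hyperbolic gb /\
                          translation_length gb = M - 2 * fine l0,
                        share_no_segment (axis ga) (axis gb)
                      & set_dist (axis ga) (axis gb) = fine l0]])
             (* B2b *)
           & (l < m1 + m2 - m j + q%:R * m j.+1 ->
              let ga := gam j.+1 in
              let gb := (gam j * gam j.+1 ^- q)%g in
              [/\ free_of_rank 2 Gamma, generated [set ga; gb] = Gamma,
                  hyperbolic ga /\ translation_length ga = m j.+1,
                  hyperbolic gb /\
                    translation_length gb = m j - q%:R * m j.+1
                & axis ga `&` axis gb !=set0 /\
                  arc_length (axis ga `&` axis gb) =
                    (l - m1 - m2 + m j - (q%:R - 1) * m j.+1)%:E])])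
        (* B3 *)
      & ~ (m1 + m2 <= l)]).
Proof.
move=> m1 m2 Gamma m q_ gam lf h1 h2 m21 m20 disc arc ov.
have l0 : 0 <= l by rewrite -lee_fin -arc arc_length_ge0.
have m10 : 0 < m1 := lt_le_trans m20 m21.
have start : 0 < l -> coherent vp g2 g1 m2 m1 l.
  by move=> l1; have [ax t1 t2] := ov l1; exact: coherent_start m10 m20 l1 arc ax t1 t2.
have disj : l = 0 -> [/\ free_of_rank 2 Gamma, schottky_pair g1 g2
    & share_no_segment (axis g1) (axis g2)].
  move=> lz; have no : share_no_segment (axis g1) (axis g2).
    by apply: arc_length0; rewrite arc lz.
  by have [sch fr] := disjoint_axes lf h1 h2 no.
split=> [rat|irr].
  have [k [k1 pk mk0]] := mseq_rational_ends m20 m21 rat.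
  have k0 := ltnW k1; have gcdE := mseq_gcd k1 pk mk0.
  have mkp : 0 < m k by apply: pk; rewrite k0 leqnn.
  (* Needed to exclude the third case when [l = 0], where it would make the gcd exceed [m1 + m2]. *)
  have mk1 : m k <= m1.
    have H i : (0 < i <= k)%N -> m i <= m1.
      elim: i => // -[_ _|i IH /= ik]; first exact: lexx.
      have pi : mpos m1 m2 i.+1.
        by move=> u /andP[u0 ui]; apply: pk; rewrite u0 (leq_trans ui) // ltnW.
      have /andP[_ /le_trans ->] := mseq_dec m20 m21 (ltn0Sn i) pi => //.
      by apply: IH; exact: ltnW.
    by apply: H; rewrite k0 /=.
  exists k; split=> //.
  case: (ltgtP l 0) => [|l1|lz]; first by rewrite ltNge l0.
    case: (leP l (m1 + m2 - real_gcd m1 m2)) => lg.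
      apply: Or32; split; [by case=> le0; move: l1; rewrite le0 ltxx| |by case].
      split; first by rewrite ?l1 ?lg.
      have kE : k = k.-1.+1 by rewrite prednK.
      (* Round [k.-1] is the last one, and its range ends at [m1 + m2] minus the gcd because
         [m k.+1 = 0]. *)
      have [||j [n [th /andP[j0 jk] nq]]] := threshold_ex m20 m21 (l := l) (j0 := k.-1) l1.
      - by rewrite -kE.
      - by rewrite -kE mk0 subr0 gcdE.
      have pj u : (0 < u <= k.-1)%N -> mpos m1 m2 u.+1.
        move=> /andP[u0 uk] i /andP[i0 iu]; apply: pk; rewrite i0 (leq_trans iu) //.
        by rewrite kE ltnS.
      exists j, n; split.
      + split; first by case: th => ? ?; split=> //; rewrite j0 jk.
        move=> [j' n'] [/= a1 a2 /andP[j'0 j'k] n'q].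
        apply: (threshold_uniq th (j' := j') (n' := n')) => //.
          by apply: pj; rewrite j0 jk.
        by apply: pj; rewrite j'0 j'k.
      + move=> le; apply: (gseq_period lf disc l1 (start l1) j0 _ nq le).
        by apply: pj; rewrite j0 jk.
      + move=> ll; case: th => /= ll' _; have pj' : mpos m1 m2 j.+1 by apply: pj; rewrite j0 jk.
        have [[fr sch] gen [_ ta] [_ tb] [ex al]] := gseq_short lf l1 (start l1) j0 pj' nq ll' ll.
        by split.
    apply: Or33; split; [by case=> le0; move: l1; rewrite le0 ltxx|by case=> /andP[]|].
    by split=> //; apply: (gseq_long lf disc l1 (start l1) k1 pk mk0); rewrite gcdE.
  apply: Or31; have [fr sch no] := disj lz; split=> //; first by case=> /andP[].
  by case=> gl _; move: gl; rewrite ?lz -gcdE; lra.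
have pos := mseq_irrational m20 m21 irr.
have bound : ~ (m1 + m2 <= l).
  move=> lS; have l1 : 0 < l by lra.
  exact: (gseq_overlap_bound lf l1 (start l1) pos m21 m20 lS).
split=> //; first by move=> i i0; apply: (pos i); rewrite i0 leqnn.
case: (ltgtP l 0) => [|l1|lz]; first by rewrite ltNge l0.
  right; have lS : l < m1 + m2 by rewrite ltNge; apply/negP.
  split; first by rewrite ?l1 ?lg.
  (* Half of the defect, because the bound in [threshold_ex] subtracts two terms, both at most
     [m i.+1]. *)
  have e0 : 0 < (m1 + m2 - l) / 2 by lra.
  have [[//|i] _ mi] := mseq_small m20 m21 pos e0.
  have [|j [n [th /andP[j0 _] nq]]] := threshold_ex m20 m21 (l := l) (j0 := i) l1 (pos i.+1).
    by have /andP[_] := mseq_dec m20 m21 (ltn0Sn i) (pos i.+1); rewrite -/m in mi *; lra.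
  exists j, n; split.
  - split; first by case: th => ? ?; split.
    move=> [j' n'] [/= a1 a2 j'0 n'q].
    exact: (threshold_uniq th (j' := j') (n' := n')).
  - move=> le; have [hh gen ta c1 c2] := gseq_period lf disc l1 (start l1) j0 (pos j.+1) nq le.
    split=> // /c2[fr [_ hb _] tl no dst]; by split.
  - move=> ll; case: th => /= ll' _.
    have [[fr _] gen ta tb [[u ex] al]] := gseq_short lf l1 (start l1) j0 (pos j.+1) nq ll' ll.
    split=> //; split=> //; rewrite ex; exists vp.
    by rewrite /segment /= mdistxx addr0.
left; have [fr sch no] := disj lz; by split.
Qed.
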